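(* Assume that (A2) $\lim_{\eta\to0}\mathbb{P}^x\{\tau_{\mathcal O}<\eta\}=0$ uniformly in $x$ from compact subsets of $\mathcal O$, and (A3) $(X(t))$ is strongly Feller, i.e. $x\mapsto\mathbb{E}^x\{h(X(t))\}$ is continuous for every measurable bounded $h:E\to\mathbb{R}$ and every $t>0$. Then the value function $w(s,x)=\sup_\tau J(s,x,\tau)$ is continuous on $[0,\infty)\times\mathcal O$.
   Context: Setting. $E$ is a locally compact separable space with a metric $\rho$ for which every closed ball is compact. $(X(t))_{t\ge0}$ is a standard Markov process on $E$ (strong Markov, càdlàg, quasi-left-continuous, with complete right-continuous filtration) with laws $\mathbb{P}^x$ and expectations $\mathbb{E}^x$, $x\in E$. It is weakly Feller: $P_t\mathcal C_0\subseteq\mathcal C_0$, where $P_th(x)=\mathbb{E}^x\{h(X(t))\}$ and $\mathcal C_0$ is the space of continuous bounded functions $E\to\mathbb{R}$ vanishing at infinity. $\mathcal O\subset E$ is an open set and $\tau_{\mathcal O}=\inf\{t\ge0: X(t)\notin\mathcal O\}$. $\alpha>0$. The functions $f,F:[0,\infty)\times E\to\mathbb{R}$ are measurable, bounded, and continuous in $s$ uniformly in $x$ from compact sets (for every $s$ and compact $K\subseteq E$, $\sup_{x\in K}|F(s',x)-F(s,x)|\to0$ as $s'\to s$, and likewise for $f$), and $F$ is continuous on $[0,\infty)\times\mathcal O$. For $(s,x)\in[0,\infty)\times E$ and a stopping time $\tau$ (possibly infinite, with the discounted terminal payoff at an infinite time read as $0$), $$J(s,x,\tau)=\mathbb{E}^x\Big\{\int_0^{\tau\wedge\tau_{\mathcal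 O}}e^{-\alpha u}f(s+u,X(u))\,du+e^{-\alpha(\tau\wedge\tau_{\mathcal O})}F\big(s+(\tau\wedge\tau_{\mathcal O}),X(\tau\wedge\tau_{\mathcal O})\big)\Big\}.$$ The supremum in $w$ is over all stopping times. *)

(* Defs.v *)
From HB Require Import structures.
From mathcomp Require Import all_boot all_order all_algebra.
From mathcomp Require Import all_classical all_reals all_analysis.
From mathcomp Require Import measurable_realfun.

Set Implicit Arguments.
Unset Strict Implicit.
Unset Printing Implicit Defensive.

Import Order.TTheory GRing.Theory Num.Theory.
Import numFieldNormedType.Exports.

Local Open Scope classical_set_scope.
Local Open Scope ring_scope.

(* Conventions.  Time is a real number [t] and only [0 <= t] is ever used: the
   values of processes, filtrations and of [f], [F] at negative times are
   irrelevant.  Random times take values in [\bar R]. *)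

Definition separable (E : topologicalType) : Prop :=
  exists2 D : set E, countable D & dense D.

(* A measurable type is pointed in the library, so that the state space, which
   carries its Borel sigma-algebra, has to be nonempty. *)
#[short(type="pmetricType")]
HB.structure Definition PointedMetric (K : numDomainType) :=
  { M of Metric K M & isPointed M }.

Definition borel (R : realType) (E : pmetricType R) : measurableType _ :=
  g_sigma_algebraType (@open E).

Definition half_line (R : realType) : set R := [set t | 0 <= t].

Section process.
Context {R : realType} {E : pmetricType R} {d : measure_display}
  {Omega : measurableType d}.

(* The measurable structure carried by [Omega] is the ambient sigma-algebra, on
   which all the laws [P x] are defined. *)
Variables (Filt : R -> set (set Omega)) (X : R -> Omega -> E)
  (P : E -> probability Omega R).

Record filtration : Prop := {
  filtration_sigma : forall t : R, 0 <= t -> sigma_algebra [set: Omega] (Filt t);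
  filtration_sub : forall t : R, 0 <= t -> Filt t `<=` measurable;
  filtration_le : forall s t : R, 0 <= s -> s <= t -> Filt s `<=` Filt t
}.

Definition right_continuous_filtration : Prop :=
  forall t : R, 0 <= t -> Filt t = \bigcap_(s in [set s | t < s]) Filt s.

(* Completeness with respect to the whole family of laws: every subset of an
   event that is null under all the [P x] belongs to [Filt 0].  The usual
   completion, the intersection of the completions over all the initial laws,
   has this property. *)
Definition complete_filtration : Prop :=
  forall A N : set Omega, measurable N -> (forall x, P x N = 0%E) ->
    A `<=` N -> Filt 0 A.

Definition stopping_time (tau : Omega -> \bar R) : Prop :=
  (forall w, (0 <= tau w)%E) /\
  (forall t : R, 0 <= t -> Filt t [set w | (tau w <= t%:E)%E]).

Definition stopped_sigma_algebra (tau : Omega -> \bar R) : set (set Omega) :=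
  [set A | measurable A /\
     forall t : R, 0 <= t -> Filt t (A `&` [set w | (tau w <= t%:E)%E])].

Definition transition (t : R) (h : E -> R) : E -> R :=
  fun x => fine 'E_(P x)[h \o X t]%E.

Definition bounded_borel (h : E -> R) : Prop :=
  measurable_fun [set: borel E] (h : borel E -> R) /\ bounded_fun h.

Definition adapted : Prop :=
  forall t : R, 0 <= t -> forall B : set (borel E), measurable B ->
    Filt t (X t @^-1` B).

Definition cadlag : Prop := forall w,
  (forall t : R, 0 <= t -> X s w @[s --> t^'+] --> X t w) /\
  (forall t : R, 0 < t -> exists l : E, X s w @[s --> t^'-] --> l).

(* [E^x(h(X(tau + t)) | F_tau) = (P_t h)(X(tau))] on [tau < +oo], with the
   conditional expectation spelled out by integration over the events of
   [F_tau].  The simple Markov property is the case of constant [tau].  This form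
   needs no shift operators on [Omega]. *)
Definition strong_Markov_property : Prop :=
  forall tau, stopping_time tau ->
  forall A, stopped_sigma_algebra tau A ->
  forall t : R, 0 <= t -> forall h, bounded_borel h -> forall x,
    let B := A `&` [set w | (tau w < +oo)%E] in
    ('E_(P x)[fun w => (\1_B w * h (X (fine (tau w) + t) w))%R] =
     'E_(P x)[fun w => (\1_B w * transition t h (X (fine (tau w)) w))%R])%E.

Definition quasi_left_continuous : Prop :=
  forall (taun : nat -> Omega -> \bar R) (tau : Omega -> \bar R),
    (forall n, stopping_time (taun n)) ->
    (forall n w, (taun n w <= taun n.+1 w)%E) ->
    (forall w, taun n w @[n --> \oo] --> tau w) ->
  forall x, {ae P x, forall w, (tau w < +oo)%E ->
    X (fine (taun n w)) w @[n --> \oo] --> X (fine (tau w)) w}.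

(* The process has an infinite lifetime, i.e. [X t w] lies in [E] at all times,
   and no cemetery point is needed. *)
Record standard_Markov_process : Prop := {
  standard_filtration : filtration;
  standard_right_continuous : right_continuous_filtration;
  standard_complete : complete_filtration;
  standard_adapted : adapted;
  standard_start : forall x, P x [set w | X 0 w = x] = 1%E;
  standard_kernel : forall t : R, 0 <= t ->
    forall B : set (borel E), measurable B ->
    measurable_fun [set: borel E] (fun x : borel E => P x (X t @^-1` B));
  standard_cadlag : cadlag;
  standard_strong_Markov : strong_Markov_property;
  standard_quasi_left_continuous : quasi_left_continuous
}.

Definition vanishes_at_infinity (h : E -> R) : Prop :=
  forall e : R, 0 < e ->
    exists2 K : set E, compact K & forall x, ~ K x -> `|h x| < e.

Definition C0 : set (E -> R) :=
  [set h | [/\ continuous h, bounded_fun h & vanishes_at_infinity h]].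

Definition weakly_Feller : Prop :=
  forall t : R, 0 <= t -> forall h, C0 h -> C0 (transition t h).

Definition strongly_Feller : Prop :=
  forall h, bounded_borel h -> forall t : R, 0 < t -> continuous (transition t h).

Definition exit_time (O : set E) (w : Omega) : \bar R :=
  ereal_inf [set t%:E | t in [set t : R | 0 <= t /\ ~ O (X t w)]].

Definition no_immediate_exit (O : set E) : Prop :=
  forall K : set E, compact K -> K `<=` O -> forall e : R, 0 < e ->
    \forall eta \near 0^'+, forall x, K x ->
      (P x [set w | (exit_time O w < eta%:E)%E] < e%:E)%E.

Definition payoff (O : set E) (alpha : R) (f F : R -> E -> R)
    (s : R) (tau : Omega -> \bar R) (w : Omega) : R :=
  let T := mine (tau w) (exit_time O w) in
  \int[@lebesgue_measure R]_(u in [set u : R | 0 <= u /\ (u%:E <= T)%E])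
     (expR (- alpha * u) * f (s + u) (X u w))
  + (if T is t%:E then expR (- alpha * t) * F (s + t) (X t w) else 0).

Definition J (O : set E) (alpha : R) (f F : R -> E -> R)
    (s : R) (x : E) (tau : Omega -> \bar R) : R :=
  fine 'E_(P x)[payoff O alpha f F s tau]%E.

Definition value (O : set E) (alpha : R) (f F : R -> E -> R)
    (s : R) (x : E) : R :=
  sup [set J O alpha f F s x tau | tau in stopping_time].

End process.

Section functionals.
Context {R : realType} {E : pmetricType R}.
Implicit Type g : R -> E -> R.

Definition measurable_functional g : Prop :=
  measurable_fun (@half_line R `*` [set: borel E])
    (fun z : R * borel E => g z.1 z.2).

Definition bounded_functional g : Prop :=
  [bounded g z.1 z.2 | z in @half_line R `*` [set: E]].

Definition time_continuous g : Prop :=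
  forall s : R, 0 <= s -> forall K : set E, compact K -> forall e : R, 0 < e ->
    \forall s' \near within (@half_line R) (nbhs s),
      forall x, K x -> `|g s' x - g s x| < e.

Definition jointly_continuous_on (O : set E) g : Prop :=
  {within @half_line R `*` O, continuous (fun z : R * E => g z.1 z.2)}.

End functionals.

(* Main.v *)
(* Let [Psi s b p] be the payoff collected along a path [p] stopped at
   [b /\ sigma], where [sigma] is the limit of the hitting times of shrinking
   neighbourhoods of the complement of [O].  Quasi-left-continuity makes [sigma]
   almost surely equal to the exit time from [O], so that
   [J s x tau = E^x (Psi s tau X)].

   In space: near [x0] in [O], waiting for a short time [eta] before stopping
   costs little, uniformly in [tau], because a weakly Feller process does not
   leave a small ball quickly, uniformly in the starting point near [x0].  Hence
   [w s x] is uniformly close to [e^(- alpha eta) (P_eta V) x], with [V] the value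
   at time [s + eta] of the problem restarted from [X eta]; this is continuous in
   [x] by the strong Feller property.  A measurable [V] is obtained by backward
   induction on dyadic grids of stopping dates.

   In time: up to a large time the paths started near [x0] stay in a compact
   ball, on which [f] and [F] are uniformly continuous in time, and discounting
   makes the rest negligible.

   Both path estimates rest on [E^x (A_a h) (X tau) >= (A_a h) x - T / a] for
   stopping times [tau <= T], [0 <= h <= 1] and the time average
   [A_a h = a^-1 \int_0^a P_u h du], which lies in [C0] with [h]. *)
Require Import Defs.
From HB Require Import structures.
From mathcomp Require Import all_boot all_order all_algebra.
From mathcomp Require Import all_classical all_reals all_analysis.
From mathcomp Require Import measurable_realfun ring lra.
Set Implicit Arguments.
Unset Strict Implicit.
Unset Printing Implicit Defensive.
Import Order.TTheory GRing.Theory Num.Theory.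
Import numFieldNormedType.Exports.
Local Open Scope classical_set_scope.
Local Open Scope ring_scope.

(** * Means of bounded measurable functions *)

Section bounded_means.
Context {d : measure_display} {T : measurableType d} {R : realType}.

(** A stopping time of [Filt] need not be a function of the path, and [Omega] carries no shifts, so
    the problem restarted at time [t] cannot be posed on shifted stopping times. Restarting is
    instead expressed by integrals over arbitrary events of [Filt t], the payoff being a functional
    of the [rc_path]-valued variable [future t]. In this form an inequality valid for all events
    passes through backward induction, and optimal stopping times on a grid are assembled piecewise,
    without measurable selection. The average [A_a h] replaces [h] because [P_t (A_a h)] varies in
    [t] at rate at most [1 / a]; this survives evaluation at stopping times, uniformly in them,
    while the weak Feller property gives no rate for [h] itself. Stopping dates are rounded upward
    because paths are only right-continuous. The recurring bound [M / alpha + M] is a running payoff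
    of rate at most [M], discounted for ever, plus one terminal payoff. *)

Definition bounded_measurable (Z : T -> R) : Prop :=
  measurable_fun setT Z /\ exists M : R, forall w, `|Z w| <= M.

Implicit Types (Z W : T -> R).

Lemma bounded_measurable_cst (c : R) : bounded_measurable (cst c).
Proof. by split; [exact: measurable_cst|exists `|c|]. Qed.

Lemma bounded_measurableD Z W :
  bounded_measurable Z -> bounded_measurable W ->
  bounded_measurable (fun w => Z w + W w).
Proof.
move=> [mZ [M ZM]] [mW [M' WM]]; split; first exact: measurable_funD.
by exists (M + M') => w; rewrite (le_trans (ler_normD _ _))// lerD.
Qed.

Lemma bounded_measurableM Z W :
  bounded_measurable Z -> bounded_measurable W ->
  bounded_measurable (fun w => Z w * W w).
Proof.
move=> [mZ [M ZM]] [mW [M' WM]]; split; first exact: measurable_funM.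
by exists (M * M') => w; rewrite normrM ler_pM.
Qed.

Lemma bounded_measurableZ (c : R) Z :
  bounded_measurable Z -> bounded_measurable (fun w => c * Z w).
Proof. by move=> mZ; apply: bounded_measurableM => //; exact: bounded_measurable_cst. Qed.

Lemma bounded_measurableB Z W :
  bounded_measurable Z -> bounded_measurable W ->
  bounded_measurable (fun w => Z w - W w).
Proof.
move=> [mZ [M ZM]] [mW [M' WM]]; split; first exact: measurable_funB.
by exists (M + M') => w; rewrite (le_trans (ler_normB _ _))// lerD.
Qed.

Lemma bounded_measurable_indic (A : set T) :
  measurable A -> bounded_measurable (\1_A).
Proof.
move=> mA; split; first exact: measurable_indic.
by exists 1 => w; rewrite indicE; case: (_ \in _); rewrite /= ?normr1 ?normr0.
Qed.

Lemma bounded_measurable_max Z W :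
  bounded_measurable Z -> bounded_measurable W ->
  bounded_measurable (fun w => Num.max (Z w) (W w)).
Proof.
move=> [mZ [M ZM]] [mW [M' WM]]; split; first exact: measurable_maxr.
exists (Num.max M M') => w; rewrite le_max.
by case: (leP (Z w) (W w)) => _; rewrite ?ZM ?WM ?orbT.
Qed.

Lemma bounded_measurable_integrable (mu : probability T R) Z :
  bounded_measurable Z -> mu.-integrable setT (EFin \o Z).
Proof.
move=> [mZ [M ZM]]; apply: measurable_bounded_integrable => //.
  by rewrite (le_lt_trans (probability_le1 _ _))// ltry.
exists `|M|; split; first exact: num_real.
by move=> x Mx w _ /=; rewrite (le_trans (ZM _))// (le_trans (ler_norm _))// ltW.
Qed.

Variable mu : probability T R.

Local Notation mean Z := (\int[mu]_w Z w).

Lemma fine_expectation Z : fine 'E_mu[Z]%E = mean Z.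
Proof. by rewrite unlock. Qed.

Lemma EFin_mean Z : bounded_measurable Z ->
  (mean Z)%:E = (\int[mu]_w (Z w)%:E)%E.
Proof.
move=> bZ; rewrite /Rintegral fineK//.
exact/integrable_fin_num/bounded_measurable_integrable.
Qed.

Lemma mean_cst (c : R) : mean (fun=> c) = c.
Proof. by rewrite Rintegral_cst// [X in _ * fine X]probability_setT mulr1. Qed.

Lemma meanD Z W : bounded_measurable Z -> bounded_measurable W ->
  mean (fun w => Z w + W w) = mean Z + mean W.
Proof. by move=> bZ bW; rewrite RintegralD//; exact: bounded_measurable_integrable. Qed.

Lemma meanB Z W : bounded_measurable Z -> bounded_measurable W ->
  mean (fun w => Z w - W w) = mean Z - mean W.
Proof. by move=> bZ bW; rewrite RintegralB//; exact: bounded_measurable_integrable. Qed.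

Lemma meanZ (c : R) Z : bounded_measurable Z ->
  mean (fun w => c * Z w) = c * mean Z.
Proof. by move=> bZ; rewrite RintegralZl//; exact: bounded_measurable_integrable. Qed.

Lemma le_mean Z W : bounded_measurable Z -> bounded_measurable W ->
  (forall w, Z w <= W w) -> mean Z <= mean W.
Proof.
by move=> bZ bW ZW; apply: le_Rintegral => //; exact: bounded_measurable_integrable.
Qed.

Lemma mean_ge0 Z : (forall w, 0 <= Z w) -> 0 <= mean Z.
Proof. by move=> Z0; apply: Rintegral_ge0. Qed.

Lemma mean_norm_le Z (M : R) : measurable_fun setT Z ->
  (forall w, `|Z w| <= M) -> `|mean Z| <= M.
Proof.
move=> mZ ZM; have bZ : bounded_measurable Z by split => //; exists M.
rewrite ler_norml -{1}(mean_cst (- M)) -{2}(mean_cst M); apply/andP; split.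
  by apply: le_mean => //; [exact: bounded_measurable_cst|move=> w; have := ZM w; rewrite ler_norml => /andP[]].
by apply: le_mean => //; [exact: bounded_measurable_cst|move=> w; have := ZM w; rewrite ler_norml => /andP[]].
Qed.

Lemma mean_indic (A : set T) : measurable A -> mean (\1_A) = fine (mu A).
Proof. by move=> mA; rewrite /Rintegral integral_indic// setIT. Qed.

Lemma mean_ae_eq (N : set T) Z W : bounded_measurable Z -> bounded_measurable W ->
  measurable N -> mu N = 0%E -> (forall w, ~ N w -> Z w = W w) ->
  mean Z = mean W.
Proof.
move=> [mZ _] [mW _] mN N0 ZW; congr fine.
apply: ae_eq_integral => //; try exact/measurable_EFinP.
exists N; split => // w /= H; apply: contrapT => /ZW E; apply: H => _ /=; by rewrite E.
Qed.

Lemma mean_cvg (Zn : nat -> T -> R) Z (M : R) :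
  (forall n, measurable_fun setT (Zn n)) -> (forall n w, `|Zn n w| <= M) ->
  {ae mu, forall w, Zn n w @[n --> \oo] --> Z w} -> measurable_fun setT Z ->
  mean (Zn n) @[n --> \oo] --> mean Z.
Proof.
move=> mZn ZnM cZ mZ.
have cst_int : mu.-integrable setT (EFin \o cst M).
  exact/bounded_measurable_integrable/bounded_measurable_cst.
have cvgE : {ae mu, forall w, setT w ->
    (EFin \o Zn n) w @[n --> \oo] --> (EFin \o Z) w}.
  by move: cZ; apply: filterS => w cw _; apply: cvg_EFin; [exact: nearW|exact: cw].
have domE : {ae mu, forall w, forall n, setT w ->
    (`|(EFin \o Zn n) w| <= (EFin \o cst M) w)%E}.
  by apply: aeW => w n _ /=; rewrite lee_fin.
have [iZ _ cI] := @dominated_convergence _ _ R mu setT measurableT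
  (fun n => EFin \o Zn n) (EFin \o Z) (EFin \o cst M)
  (fun n => (measurable_EFinP _ _).2 (mZn n)) ((measurable_EFinP _ _).2 mZ)
  cvgE cst_int domE.
by apply: fine_cvg; rewrite [X in _ --> X]/= fineK//; exact: integrable_fin_num.
Qed.

End bounded_means.

(** * The functional monotone class theorem *)

Section functional_monotone_class.
Context {d : measure_display} {T : measurableType d} {R : realType}.
Variable Q : (T -> R) -> Prop.
Hypothesis Q_linear : forall (a : R) (Z W : T -> R),
  bounded_measurable Z -> bounded_measurable W -> Q Z -> Q W ->
  Q (fun w => a * Z w + W w).
Hypothesis Q_limit : forall (Zn : nat -> T -> R) (Z : T -> R) (M : R),
  (forall n, bounded_measurable (Zn n)) -> (forall n, Q (Zn n)) ->
  (forall n w, `|Zn n w| <= M) -> bounded_measurable Z ->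
  (forall w, Zn n w @[n --> \oo] --> Z w) -> Q Z.

(** Rounding [Z + M] down to multiples of [1 / (n + 1)] gives finitely valued functions converging
    uniformly to [Z], to which the limit closure of [Q] applies. *)
Lemma monotone_class_simple :
  (forall A, measurable A -> Q (\1_A)) -> forall Z, bounded_measurable Z -> Q Z.
Proof.
move=> Q1 Z bZ; have [mZ [M ZM]] := bZ.
have M0 w : 0 <= Z w + M by have := ZM w; rewrite ler_norml => /andP[+ _]; rewrite -subr_ge0 opprK.
(* The shift by [M] makes [y] nonnegative, so that [truncn] is its integer part. *)
pose y (n : nat) w := (Z w + M) * n.+1%:R.
have y0 n w : 0 <= y n w by rewrite mulr_ge0.
pose B (n k : nat) := [set w | Num.truncn (y n w) = k].
have mB n k : measurable (B n k).
  have -> : B n k = y n @^-1` `[k%:R, k.+1%:R[%classic.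
    by apply/seteqP; split => w /=; rewrite in_itv/= -truncn_eq// => /eqP.
  rewrite -[X in measurable X]setTI.
  have my : measurable_fun setT (y n).
    by apply: measurable_funM => //; exact: measurable_funD.
  by apply: my => //; exact: measurable_itv.
pose c (n k : nat) : R := k%:R / n.+1%:R - M.
(* The rounded function cut to the levels below [m], accumulated one level at a time to match the
   closure of [Q] under [a * Z + W]. *)
pose S := fix S (n m : nat) (w : T) : R :=
  if m is m'.+1 then c n m' * \1_(B n m') w + S n m' w else 0.
have SE n m w : S n m w = if (Num.truncn (y n w) < m)%N then c n (Num.truncn (y n w)) else 0.
  elim: m => [//|m IH] /=; rewrite IH indicE ltnS.
  case: ltngtP => [E|E|E]; last by rewrite mem_set// mulr1 addr0 E.
    by rewrite memNset ?mulr0 ?add0r//= => E'; rewrite E' ltnn in E.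
  by rewrite memNset ?mulr0 ?add0r//= => E'; rewrite E' ltnn in E.
have QS n m : bounded_measurable (S n m) /\ Q (S n m).
  elim: m => [|m [bS QS]] /=.
    have -> : (fun=> 0) = \1_(set0 : set T) :> (T -> R).
      by apply/funext => w; rewrite indicE in_set0.
    by split; [exact: bounded_measurable_indic|exact: Q1].
  split.
    by apply: bounded_measurableD => //; apply: bounded_measurableZ; exact: bounded_measurable_indic.
  by apply: Q_linear => //; [exact: bounded_measurable_indic|exact: Q1].
(* [Z + M] is at most [M + M], so [K n] levels exhaust its values. *)
pose K n := (Num.truncn ((M + M) * n.+1%:R)).+1.
have near_n n w : `|Z w - S n (K n) w| <= n.+1%:R^-1.
  have n0 : 0 < n.+1%:R :> R by rewrite ltr0n.
  rewrite SE /K ltnS le_truncn; last first.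
    by rewrite ler_pM2r// lerD2r (le_trans (ler_norm _)).
  have /andP[] := truncn_itv (y0 n w); set k := Num.truncn _.
  rewrite /c /y -ler_pdivrMr// -ltr_pdivlMr// -(natr1 k) mulrDl mul1r => h1 h2.
  by rewrite opprB addrA ger0_norm ?subr_ge0// lerBlDl ltW.
apply: (@Q_limit (fun n => S n (K n)) Z (M + 1)) => //.
- by move=> n; case: (QS n (K n)).
- by move=> n; case: (QS n (K n)).
- move=> n w; rewrite -(subrK (Z w) (S n (K n) w)) addrC.
  rewrite (le_trans (ler_normD _ _))// lerD// distrC (le_trans (near_n _ _))//.
  by rewrite invf_le1 ?ltr0n// ler1n.
- move=> w; apply/cvgrPdist_le => e e0; near=> n.
  rewrite (le_trans (near_n _ _))// ltW//.
  by near: n; exact: near_infty_natSinv_lt (PosNum e0).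
Unshelve. all: by end_near. Qed.

(** The sets whose indicator satisfies [Q] form a Dynkin system: complements are affine combinations
    with the constant [1], disjoint unions are bounded limits of finite sums. Dynkin's theorem
    carries [Q] from the pi-system [G] to all measurable sets. *)
Lemma functional_monotone_class (G : set (set T)) :
  @measurable _ T = <<s G >> -> setI_closed G ->
  Q (cst 1) -> (forall A, G A -> Q (\1_A)) ->
  forall Z, bounded_measurable Z -> Q Z.
Proof.
move=> GE GI Q1 QG; apply: monotone_class_simple => A; rewrite GE; move: A.
apply: (@dynkin_induction _ T G (fun A => Q (\1_A))) => //.
- by rewrite indicT.
- move=> S mS QS; have -> : \1_(~` S) = (fun w => -1 * \1_S w + cst 1 w) :> (T -> R).
    by apply/funext => w; rewrite !indicE in_setC/=; case: (w \in S) => /=; lra.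
  apply: Q_linear => //; first exact: bounded_measurable_indic.
  exact: bounded_measurable_cst.
- move=> F mF tF QF.
  pose U n := \bigcup_(k < n) F k.
  have mU n : measurable (U n) by apply: bigcup_measurable => k _; exact: mF.
  have QU n : Q (\1_(U n)).
    elim: n => [|n IH].
      have -> : \1_(U 0) = (fun w => -1 * cst 1 w + cst 1 w) :> (T -> R).
        by apply/funext => w; rewrite /U bigcup_mkord big_ord0 indicE in_set0/=; lra.
      by apply: Q_linear => //; exact: bounded_measurable_cst.
    have -> : \1_(U n.+1) = (fun w => 1 * \1_(F n) w + \1_(U n) w) :> (T -> R).
      apply/funext => w; rewrite mul1r /U bigcup_mkord big_ord_recr/= -bigcup_mkord !indicE.
      rewrite in_setU; case: (boolP (w \in F n)) => Fn; last by rewrite orbF add0r.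
      rewrite orbT memNset ?addr0// => -[k /= kn Fk].
      have := tF k n I I; rewrite -[_ !=set0]/(exists _, _) => /(_ (ex_intro _ w (conj Fk (set_mem Fn)))) E.
      by rewrite E ltnn in kn.
    by apply: Q_linear => //; exact: bounded_measurable_indic.
  apply: (@Q_limit (fun n => \1_(U n)) _ 1) => //.
  + by move=> n; exact: bounded_measurable_indic.
  + by move=> n w; rewrite indicE; case: (_ \in _); rewrite ?normr1 ?normr0.
  + by apply: bounded_measurable_indic; exact: bigcup_measurable.
  + move=> w; have [[k _ Fk]|nF] := pselect ((\bigcup_k F k) w).
      rewrite indicE mem_set; last by exists k.
      apply: cvg_near_cst; exists k.+1 => // n /= kn.
      by rewrite indicE mem_set//; exists k.
    rewrite indicE memNset//; apply: cvg_near_cst; apply: nearW => n.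
    by rewrite indicE memNset// => -[k _ Fk]; apply: nF; exists k.
Qed.

End functional_monotone_class.

(** * Right-continuous paths *)

(** Paths are indexed by all of [R], so that evaluation at a real-valued random time needs no side
    condition. *)
Definition rc_path (R : realType) (E : pmetricType R) : Type :=
  {p : R -> E | forall t, p s @[s --> t^'+] --> p t}.

Section path_structure.
Context {R : realType} {E : pmetricType R}.

Definition path_at (t : R) (p : rc_path E) : E := sval p t.
Arguments path_at : simpl never.

Lemma path_at_cvg (t : R) (p : rc_path E) :
  path_at s p @[s --> t^'+] --> path_at t p.
Proof. by case: p. Qed.

Lemma cst_right_continuous (x : E) (t : R) :
  (fun _ : R => x) s @[s --> t^'+] --> x.
Proof. exact: cvg_cst. Qed.

Definition cst_path (x : E) : rc_path E := exist _ _ (@cst_right_continuous x).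

HB.instance Definition _ := gen_eqMixin (rc_path E).
HB.instance Definition _ := gen_choiceMixin (rc_path E).
HB.instance Definition _ := isPointed.Build (rc_path E) (cst_path point).

Lemma path_at_right (G : set E) (p : rc_path E) (t : R) :
  nbhs (path_at t p) G ->
  exists2 e : R, 0 < e & forall s, t <= s < t + e -> G (path_at s p).
Proof.
move=> nG; have [e /= e0 He] : (path_at s p @[s --> t^'+]) G by exact: path_at_cvg.
exists e => // s /andP[]; rewrite le_eqVlt => /predU1P[<- _|ts st].
  exact: nbhs_singleton.
by apply: He => //=; rewrite distrC ger0_norm ?subr_ge0 1?ltW// ltrBlDl.
Qed.

Lemma shift_right_continuous (t : R) (p : rc_path E) (u : R) :
  path_at (t + Num.max s 0) p @[s --> u^'+] --> path_at (t + Num.max u 0) p.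
Proof.
move=> G /path_at_right[e e0 He]; exists e => // s /= us lt_us; apply: He.
have su : s - u < e by rewrite -(@ger0_norm _ (s - u)) ?subr_ge0 ?ltW// distrC.
by rewrite lerD2l -addrA ltrD2l; case: (leP s 0) => s0; case: (leP u 0) => u0; lra.
Qed.

(* Freezing the path at negative times keeps functionals of the shifted path
   from seeing the past. *)
Definition path_shift (t : R) (p : rc_path E) : rc_path E :=
  exist _ _ (@shift_right_continuous t p).

Lemma path_shift_maxE (t s : R) (p : rc_path E) :
  path_at s (path_shift t p) = path_at (t + Num.max s 0) p.
Proof. by []. Qed.

Lemma rc_path_eq (p q : rc_path E) : (forall t, path_at t p = path_at t q) -> p = q.
Proof.
case: p q => [p hp] [q hq] pq; have pqE : p = q by apply/funext => t; exact: pq.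
by subst q; congr exist; exact: Prop_irrelevance.
Qed.

Lemma path_shiftE (t s : R) (p : rc_path E) : 0 <= s ->
  path_at s (path_shift t p) = path_at (t + s) p.
Proof. by move=> s0; rewrite path_shift_maxE max_l. Qed.

Definition path_cylinders : set (set (rc_path E)) :=
  [set S | exists t, exists2 B : set (borel E), measurable B & S = path_at t @^-1` B].

End path_structure.
Arguments path_at {R E} t p : simpl never.

Definition path_space (R : realType) (E : pmetricType R) : measurableType _ :=
  g_sigma_algebraType (@path_cylinders R E).

Section path_measurability.
Context {R : realType} {E : pmetricType R}.
Local Notation D := (path_space E).

Lemma measurable_path_at (t : R) :
  measurable_fun [set: D] (path_at t : D -> borel E).
Proof.
by move=> _ B mB; rewrite setTI; apply: sub_gen_smallest; exists t, B.
Qed.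

Lemma measurable_to_path d (T : measurableType d) (phi : T -> D) :
  (forall t, measurable_fun setT (path_at t \o phi : T -> borel E)) ->
  measurable_fun setT phi.
Proof.
move=> mphi; apply: (@measurability _ _ _ D _ _ (@path_cylinders R E)) => //.
by move=> _ [_ [t [B mB ->]] <-]; exact: (mphi t measurableT B mB).
Qed.

Lemma open_borel (U : set E) : open U -> measurable (U : set (borel E)).
Proof. exact: sub_gen_smallest. Qed.

Lemma closed_borel (U : set E) : closed U -> measurable (U : set (borel E)).
Proof.
by move=> cU; rewrite -(setCK U); apply: measurableC; apply: open_borel; exact/closed_openC.
Qed.

Lemma measurable_to_borel d (T : measurableType d) (phi : T -> borel E) :
  (forall U : set E, open U -> measurable (phi @^-1` U)) ->
  measurable_fun setT phi.
Proof.
move=> mphi; apply: (@measurability _ _ _ (borel E) _ _ (@open E)) => //.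
by move=> _ [U oU <-]; rewrite setTI; exact: mphi.
Qed.

Lemma continuous_borel (h : E -> R) : continuous h ->
  measurable_fun [set: borel E] (h : borel E -> R).
Proof.
move=> ch; apply: (measurability _ (RGenOpens.measurableE R)).
by move=> _ [_ [a [b ->]] <-]; rewrite setTI; apply: open_borel;
  apply: open_comp => //; exact: interval_open.
Qed.

(** The first point of the grid of step [1 / (n + 1)] strictly after [u]; strictness is required by
    the punctured filter of right limits. *)
Definition right_grid (n : nat) (u : R) : R :=
  (Num.floor (u * n.+1%:R) + 1)%:~R / n.+1%:R.

Lemma right_grid_bounds (n : nat) (u : R) :
  u < right_grid n u <= u + n.+1%:R^-1.
Proof.
have n0 : 0 < n.+1%:R :> R by rewrite ltr0n.
rewrite /right_grid ltr_pdivlMr// floorD1_gt//=.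
by rewrite ler_pdivrMr// mulrDl mulVf ?gt_eqF// intrD lerD2r floor_le_tmp.
Qed.

Lemma right_grid_cvg (u : R) (p : rc_path E) :
  path_at (right_grid n u) p @[n --> \oo] --> path_at u p.
Proof.
apply: (@cvg_comp _ _ _ (fun n => right_grid n u) (fun s => path_at s p) _ (u^'+)); last exact: path_at_cvg.
move=> A -[e /= e0 H].
near=> n; have /andP[h1 h2] := right_grid_bounds n u.
apply: H => //=; rewrite distrC ger0_norm ?subr_ge0 1?ltW// ltrBlDl.
apply: (le_lt_trans h2); rewrite ltrD2l.
by near: n; exact: near_infty_natSinv_lt (PosNum e0).
Unshelve. all: by end_near. Qed.

(** Rounding the time with [right_grid n] leaves countably many evaluations at fixed times, and
    right-continuity recovers the path in the limit. Since [E] is only a metric space, the limit is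
    taken on preimages of open sets. *)
Lemma measurable_path_eval :
  measurable_fun [set: R * D] (fun z => path_at z.1 z.2 : borel E).
Proof.
apply: measurable_to_borel => U oU.
(* The points at distance at least [1 / (m + 1)] from the complement of [U]: the path is in [U] at
   time [u] exactly when some [Um m] eventually contains all its approximations. *)
pose Um (m : nat) : set E := ~` [set x | exists2 y, ~ U y & mdist x y < m.+1%:R^-1].
have cUm m : closed (Um m).
  apply: open_closedC; rewrite openE => x [y nUy xy] /=.
  apply/metricType_numDomainType.nbhs_mdistP.
  exists (m.+1%:R^-1 - mdist x y); first by rewrite /= subr_gt0.
  move=> z /= xz; exists y => //; rewrite (le_lt_trans (metric_triangle _ x _))//.
  by rewrite metric_sym -ltrBrDr.
have -> : (fun z : R * D => path_at z.1 z.2 : borel E) @^-1` U =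
    \bigcup_m \bigcup_N \bigcap_(n in [set n | (N <= n)%N])
      [set z : R * D | Um m (path_at (right_grid n z.1) z.2)].
  apply/seteqP; split => [[u p] /= Up|[u p] /= [m _ [N _ H]]].
    have /metricType_numDomainType.nbhs_mdistP[e /= e0 He] : nbhs (path_at u p) U.
      by move: oU; rewrite openE; exact.
    have [m [_ me]] : exists m : nat, True /\ m.+1%:R^-1 < e / 2.
      have [m _ Hm] := near_infty_natSinv_lt (PosNum (divr_gt0 e0 (ltr0n R 2))).
      by exists m; split => //; exact: (Hm m (leqnn m)).
    have := @right_grid_cvg u p.
    move=> /metricType_numDomainType.cvgrPdist_lt /(_ (e / 2) (divr_gt0 e0 (ltr0n R 2))).
    move=> [N _ HN]; exists m => //; exists N => // n /= Nn [y nUy xy].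
    apply: nUy; apply: He; rewrite /= (le_lt_trans (metric_triangle _ (path_at (right_grid n u) p) _))//.
    rewrite (splitr e) ltrD//; first exact: HN.
    exact: lt_trans me.
  have := @right_grid_cvg u p.
  move=> /metricType_numDomainType.cvgrPdist_lt /(_ m.+1%:R^-1).
  rewrite invr_gt0 ltr0n => /(_ isT)[N' _ HN'].
  apply: contrapT => nU.
  apply: (H (maxn N N') (leq_maxl _ _)); exists (path_at u p) => //.
  by rewrite metric_sym; apply: HN'; exact: leq_maxr.
apply: bigcupT_measurable => m; apply: bigcupT_measurable => N.
apply: bigcap_measurableType => n _.
(* The rounded time is constant on each strip [floor (u * (n + 1)) = k]. *)
have -> : [set z : R * D | Um m (path_at (right_grid n z.1) z.2)] =
    \bigcup_(k : int) ([set u : R | Num.floor (u * n.+1%:R) = k] `*`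
       (path_at ((k + 1)%:~R / n.+1%:R) @^-1` Um m : set D)).
  apply/seteqP; split => [[u p] /= H|[u p] /= [k _ [/= <-]]//].
  by exists (Num.floor (u * n.+1%:R)).
apply: countable_bigcupT_measurable => [|k]; first exact: countableP.
apply: measurableX.
  have -> : [set u : R | Num.floor (u * n.+1%:R) = k] =
     `[k%:~R / n.+1%:R, (k + 1)%:~R / n.+1%:R[%classic.
    apply/seteqP; split => u /=; rewrite in_itv/= ler_pdivrMr ?ltr0n// ltr_pdivlMr ?ltr0n//.
      by move=> <-; rewrite floor_le_tmp floorD1_gt.
    by move=> H; apply: floor_def.
  exact: measurable_itv.
rewrite -[X in measurable X]setTI; apply: measurable_path_at => //.
exact: closed_borel.
Qed.

Lemma measurable_path_at_time d (T : measurableType d) (g : T -> R) (phi : T -> D) :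
  measurable_fun setT g -> measurable_fun setT phi ->
  measurable_fun setT (fun w => path_at (g w) (phi w) : borel E).
Proof.
move=> mg mphi.
apply: (measurableT_comp measurable_path_eval (measurable_fun_pair mg mphi)).
Qed.

End path_measurability.

(** * Hitting times of open sets and the announced exit *)

Section hitting_times.
Context {R : realType} {E : pmetricType R}.
Local Notation D := (path_space E).
Implicit Types (G O : set E) (p : rc_path E).

Definition hitting_time (G : set E) (p : rc_path E) : \bar R :=
  ereal_inf [set t%:E | t in [set t : R | 0 <= t /\ G (path_at t p)]].

Lemma hitting_time_ge0 G p : (0 <= hitting_time G p)%E.
Proof. by apply/ereal_infP => _ [t [t0 _] <-]; rewrite lee_fin. Qed.

Lemma hitting_time_le G p (t : R) : 0 <= t -> G (path_at t p) ->
  (hitting_time G p <= t%:E)%E.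
Proof. by move=> t0 Gt; apply: ereal_inf_lbound; exists t. Qed.

Lemma hitting_time_ltP G p (x : \bar R) : (hitting_time G p < x)%E <->
  exists t, [/\ 0 <= t, G (path_at t p) & (t%:E < x)%E].
Proof.
split=> [/ereal_inf_lt[_ [t [t0 Gt] <-] tx]|[t [t0 Gt tx]]]; first by exists t.
by rewrite (le_lt_trans (hitting_time_le t0 Gt)).
Qed.

Lemma hitting_time_subset G1 G2 p : G1 `<=` G2 ->
  (hitting_time G2 p <= hitting_time G1 p)%E.
Proof.
move=> G12; apply/ereal_infP => _ [t [t0 Gt] <-].
by apply: hitting_time_le => //; exact: G12.
Qed.

(** A right-continuous path stays in the open [G] for a while after entering, hence is there at a
    rational time. Early hitting becomes a countable union, which gives both measurability and
    adaptedness. *)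
Lemma hitting_time_lt_rat G p (u : R) : open G ->
  (hitting_time G p < u%:E)%E <->
  exists q : rat, [/\ 0 <= ratr q :> R, ratr q < u & G (path_at (ratr q) p)].
Proof.
move=> oG; split=> [/hitting_time_ltP[t [t0 Gt]]|[q [q0 qu Gq]]]; last first.
  by apply/hitting_time_ltP; exists (ratr q); rewrite lte_fin.
rewrite lte_fin => tu; have [e e0 He] : exists2 e : R, 0 < e & forall s, t <= s < t + e -> G (path_at s p).
  by apply: path_at_right; move: oG; rewrite openE; exact.
have : t < Num.min u (t + e) by rewrite lt_min tu ltrDl.
move=> /rat_in_itvoo[q]; rewrite in_itv/= lt_min => /and3P[tq qu qe].
exists q; split => //; first by rewrite (le_trans t0)// ltW.
by apply: He; rewrite ltW.
Qed.

(** The infimum need not be attained, but a path outside the closed set [closure G] at time [t]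
    stays outside for some time after [t]. *)
Lemma hitting_time_closure G p (t : R) : hitting_time G p = t%:E ->
  closure G (path_at t p).
Proof.
move=> Gt; apply: contrapT => nG.
have oC : open (~` closure G) by apply: closed_openC; exact: closed_closure.
have [e e0 He] : exists2 e : R, 0 < e & forall s, t <= s < t + e ->
    (~` closure G) (path_at s p).
  by apply: path_at_right; move: oC; rewrite openE; exact.
have : (hitting_time G p < (t + e)%:E)%E by rewrite Gt lte_fin ltrDl.
move=> /hitting_time_ltP[s [s0 Gs]]; rewrite lte_fin => se.
have ts : t <= s by rewrite -lee_fin -Gt hitting_time_le.
by apply: (He s); [rewrite ts|exact: subset_closure].
Qed.

Lemma hitting_time_shift_ge G p (t : R) : 0 <= t ->
  (hitting_time G p <= t%:E + hitting_time G (path_shift t p))%E.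
Proof.
move=> t0; rewrite -leeBlDl//; apply/ereal_infP => _ [s [s0 Gs] <-].
rewrite leeBlDl// -EFinD; apply: hitting_time_le; first exact: addr_ge0.
by rewrite -path_shiftE.
Qed.

Lemma hitting_time_shift G p (t : R) : 0 <= t -> (t%:E < hitting_time G p)%E ->
  hitting_time G p = (t%:E + hitting_time G (path_shift t p))%E.
Proof.
move=> t0 tG; apply/eqP; rewrite eq_le hitting_time_shift_ge//=.
apply/ereal_infP => _ [s [s0 Gs] <-]; rewrite -leeBrDl// -EFinB.
have ts : t < s by rewrite -lte_fin (lt_le_trans tG)// hitting_time_le.
apply: hitting_time_le; first by rewrite subr_ge0 ltW.
by rewrite path_shiftE ?subr_ge0 1?ltW// addrCA subrr addr0.
Qed.

Lemma measurable_hitting_time G : open G ->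
  measurable_fun [set: D] (hitting_time G : D -> \bar R).
Proof.
move=> oG; apply: (measurability _ (ErealGenInftyO.measurableE R)).
move=> _ [_ [u ->] <-]; rewrite setTI.
have -> : hitting_time G @^-1` `]-oo, u%:E[%classic =
    \bigcup_(q : rat) [set p | 0 <= ratr q :> R /\ ratr q < u /\ G (path_at (ratr q) p)].
  apply/seteqP; split => p /=; rewrite in_itv/=.
    by move=> /(hitting_time_lt_rat _ _ oG)[q [? ? ?]]; exists q.
  by move=> [q _ [? [? ?]]]; apply/hitting_time_lt_rat => //; exists q.
apply: bigcupT_measurable_rat => q.
have [q0|q0] := pselect (0 <= ratr q :> R); last first.
  by rewrite (_ : mkset _ = set0) ?measurable0// -subset0 => p [].
have [qu|qu] := pselect (ratr q < u); last first.
  by rewrite (_ : mkset _ = set0) ?measurable0// -subset0 => p [_ []].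
rewrite (_ : mkset _ = path_at (ratr q) @^-1` G); last first.
  by apply/seteqP; split => p //= [_ []].
by rewrite -[X in measurable X]setTI; apply: measurable_path_at => //; exact: open_borel.
Qed.

Definition near_complement (O : set E) (n : nat) : set E :=
  [set x | exists2 y, ~ O y & mdist x y < n.+1%:R^-1].

Lemma near_complement_open O n : open (near_complement O n).
Proof.
rewrite openE => x [y nUy xy] /=.
apply/metricType_numDomainType.nbhs_mdistP.
exists (n.+1%:R^-1 - mdist x y); first by rewrite /= subr_gt0.
move=> z /= xz; exists y => //; rewrite (le_lt_trans (metric_triangle _ x _))//.
by rewrite metric_sym -ltrBrDr.
Qed.

Lemma near_complement_subset O m n : (m <= n)%N ->
  near_complement O n `<=` near_complement O m.
Proof.
move=> mn x [y nOy xy]; exists y => //; apply: (lt_le_trans xy).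
by rewrite lef_pV2 ?posrE ?ltr0n// ler_nat ltnS.
Qed.

Lemma sub_near_complement O n x : ~ O x -> near_complement O n x.
Proof. by move=> nOx; exists x => //; rewrite mdistxx invr_gt0 ltr0n. Qed.

Lemma closure_near_complement O (x : E) : open O ->
  (forall n, closure (near_complement O n) x) -> ~ O x.
Proof.
move=> oO cl Ox.
have /metricType_numDomainType.nbhs_mdistP[e /= e0 He] : nbhs x O.
  by move: oO; rewrite openE; exact.
have [m _ Hm] := near_infty_natSinv_lt (PosNum (divr_gt0 e0 (ltr0n R 2))).
have /= me := Hm m (leqnn m).
have nb : nbhs x [set z | mdist x z < e / 2].
  by apply/metricType_numDomainType.nbhs_mdistP; exists (e / 2); rewrite /= ?divr_gt0.
have [z [[y nOy zy] xz]] := cl m _ nb.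
apply: nOy; apply: He => /=; rewrite (le_lt_trans (metric_triangle _ z _))//.
by rewrite (splitr e) ltrD// (lt_trans zy).
Qed.

(* The hitting times of open sets are Borel, whereas the measurability of the
   exit time itself would require the debut theorem. *)
Definition announced_exit (O : set E) (p : rc_path E) : \bar R :=
  ereal_sup (range (fun n => hitting_time (near_complement O n) p)).

Lemma announced_exit_ge O p n :
  (hitting_time (near_complement O n) p <= announced_exit O p)%E.
Proof. by apply: ereal_sup_ubound; exists n. Qed.

Lemma announced_exit_ge0 O p : (0 <= announced_exit O p)%E.
Proof. by rewrite (le_trans (hitting_time_ge0 (near_complement O 0) p))// announced_exit_ge. Qed.

Lemma announced_exit_gtP O p (x : \bar R) : (x < announced_exit O p)%E <->
  exists n, (x < hitting_time (near_complement O n) p)%E.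
Proof.
split=> [/ereal_sup_gt[_ [n _ <-] ?]|[n xn]]; first by exists n.
by rewrite (lt_le_trans xn)// announced_exit_ge.
Qed.

Lemma announced_exit_le O p (t : R) : 0 <= t -> ~ O (path_at t p) ->
  (announced_exit O p <= t%:E)%E.
Proof.
move=> t0 nO; apply/ereal_supP => _ [n _ <-]; apply: hitting_time_le => //.
exact: sub_near_complement.
Qed.

Lemma announced_exit_in O p (t : R) : 0 <= t -> (t%:E < announced_exit O p)%E ->
  O (path_at t p).
Proof.
move=> t0; apply: contraPP => nO; apply/negP; rewrite -leNgt.
exact: announced_exit_le.
Qed.

(** Some [near_complement O n0] has not been reached by time [t], nor has any smaller neighbourhood,
    so their hitting times shift exactly; by monotonicity the indices below [n0] do not affect the
    supremum. *)
Lemma announced_exit_shift O p (t : R) : 0 <= t -> (t%:E < announced_exit O p)%E ->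
  announced_exit O p = (t%:E + announced_exit O (path_shift t p))%E.
Proof.
move=> t0 /announced_exit_gtP[n0 tn0]; apply/eqP; rewrite eq_le; apply/andP; split.
  apply/ereal_supP => _ [n _ <-]; rewrite (le_trans (hitting_time_shift_ge _ _ t0))//.
  by rewrite leeD2l// announced_exit_ge.
rewrite -leeBrDl//; apply/ereal_supP => _ [n _ <-]; rewrite leeBrDl//.
rewrite (@le_trans _ _ (t%:E + hitting_time (near_complement O (maxn n n0)) (path_shift t p))%E)//.
  rewrite leeD2l//; apply: hitting_time_subset; apply: near_complement_subset.
  exact: leq_maxl.
rewrite -hitting_time_shift//; first exact: announced_exit_ge.
rewrite (lt_le_trans tn0)//; apply: hitting_time_subset; apply: near_complement_subset.
exact: leq_maxr.
Qed.

Lemma measurable_announced_exit O :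
  measurable_fun [set: D] (announced_exit O : D -> \bar R).
Proof.
apply: (measurability _ (ErealGenOInfty.measurableE R)).
move=> _ [_ [u ->] <-]; rewrite setTI.
have -> : announced_exit O @^-1` `]u%:E, +oo[%classic =
    \bigcup_n (hitting_time (near_complement O n) @^-1` `]u%:E, +oo[%classic).
  apply/seteqP; split => p /=.
    by rewrite in_itv/= andbT => /announced_exit_gtP[n ?]; exists n; rewrite //= in_itv/= andbT.
  move=> [n _ /=]; rewrite !in_itv/= !andbT => ?; by apply/announced_exit_gtP; exists n.
apply: bigcupT_measurable => n; rewrite -[X in measurable X]setTI.
apply: measurable_hitting_time => //; first exact: near_complement_open.
exact: emeasurable_itv.
Qed.

End hitting_times.

Lemma bounded_borelP {R : realType} {E : pmetricType R} (h : E -> R) :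
  bounded_borel h <-> bounded_measurable (h : borel E -> R).
Proof.
split=> -[mh].
  move=> [M [_ HM]]; split => //; exists (M + 1) => x.
  by apply: HM; rewrite ?ltrDl.
move=> [M HM]; split => //; exists M; split; first exact: num_real.
by move=> y My x _ /=; rewrite (le_trans (HM x))// ltW.
Qed.

(** * Measurability of means in the starting point *)

Section kernel_mean.
Context {R : realType} {E : pmetricType R} {d : measure_display}
  {Omega : measurableType d} (P : E -> probability Omega R).

Lemma kernel_mean d' (Y : measurableType d') (phi : Omega -> Y) :
  measurable_fun setT phi ->
  (forall S, measurable S ->
     measurable_fun [set: borel E] (fun x : borel E => P x (phi @^-1` S))) ->
  forall Z : Y -> R, bounded_measurable Z ->
  bounded_measurable (fun x : borel E => \int[P x]_w Z (phi w)).
Proof.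
move=> mphi mS Z bZ; split; last first.
  have [mZ [M ZM]] := bZ; exists M => x; apply: mean_norm_le => //.
  exact: measurableT_comp.
have bc (W : Y -> R) : bounded_measurable W -> bounded_measurable (W \o phi).
  by move=> [mW [M WM]]; split; [exact: measurableT_comp|exists M => w; exact: WM].
apply: (@monotone_class_simple _ Y R (fun Z =>
  measurable_fun [set: borel E] (fun x : borel E => \int[P x]_w Z (phi w)))) => //.
- move=> a V W bV bW mV mW.
  have -> : (fun x : borel E => \int[P x]_w (a * V (phi w) + W (phi w))) =
    (fun x => a * (\int[P x]_w V (phi w)) + \int[P x]_w W (phi w)).
    apply/funext => x; rewrite meanD ?meanZ//; try exact: bc.
    by apply: bounded_measurableZ; exact: (bc _ bV).
  by apply: measurable_funD => //; apply: measurable_funM.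
- move=> Zn V M bZn mZn ZnM bV cV.
  apply: (@measurable_fun_cvg _ _ R setT (fun n (x : borel E) => \int[P x]_w Zn n (phi w))) => //.
  move=> x _; apply: (@mean_cvg _ _ _ _ _ _ M).
  + by move=> n; have [] := bc _ (bZn n).
  + by move=> n w; exact: ZnM.
  + by apply: aeW => w; exact: cV.
  + by have [] := bc _ bV.
- move=> S mS'.
  have -> : (fun x : borel E => \int[P x]_w \1_S (phi w)) =
    fine \o (fun x : borel E => P x (phi @^-1` S)).
    apply/funext => x /=; rewrite -mean_indic//.
    by rewrite -[X in measurable X]setTI; exact: mphi.
  by apply: measurableT_comp; [exact: fine_measurable|exact: mS].
Qed.

End kernel_mean.

(** * The Markov property for functionals of the path *)

Section process_lemmas.
Context {R : realType} {E : pmetricType R} {d : measure_display}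
  {Omega : measurableType d}.
Context {Filt : R -> set (set Omega)} {X : R -> Omega -> E}
  {P : E -> probability Omega R}.
Hypothesis std : standard_Markov_process Filt X P.
Local Notation D := (path_space E).

(** [X] is unconstrained at negative times, whereas an [rc_path] is right-continuous on all of [R];
    hence the freezing at [X 0]. *)
Lemma trajectory_right_continuous (w : Omega) (t : R) :
  X (Num.max s 0) w @[s --> t^'+] --> X (Num.max t 0) w.
Proof.
have t0 : 0 <= Num.max t 0 by rewrite le_max lexx orbT.
move=> G nG; have [e /= e0 He] := ((standard_cadlag std w).1 _ t0) G nG.
exists e => // s /= ts lt_ts.
have st : s - t < e by rewrite -(@ger0_norm _ (s - t)) ?subr_ge0 ?ltW// distrC.
have [<-|ne] := eqVneq (Num.max t 0) (Num.max s 0); first exact: nbhs_singleton.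
have lt_m : Num.max t 0 < Num.max s 0.
  by rewrite lt_neqAle ne/= ge_max !le_max lexx ltW ?orbT.
apply: He => //=; rewrite distrC ger0_norm ?subr_ge0 1?ltW//.
by move: lt_m; case: (leP s 0) => s0; case: (leP t 0) => t0'; lra.
Qed.

Definition trajectory (w : Omega) : rc_path E :=
  exist _ _ (@trajectory_right_continuous w).

Lemma trajectoryE (t : R) (w : Omega) : 0 <= t -> path_at t (trajectory w) = X t w.
Proof. by move=> t0; rewrite /path_at/= max_l. Qed.

Definition future (t : R) (w : Omega) : rc_path E := path_shift t (trajectory w).

Lemma futureE (t s : R) (w : Omega) : 0 <= t -> 0 <= s ->
  path_at s (future t w) = X (t + s) w.
Proof. by move=> t0 s0; rewrite path_shiftE// trajectoryE// addr_ge0. Qed.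

Lemma future_at (t u : R) (w : Omega) : 0 <= t ->
  path_at u (future t w) = X (t + Num.max u 0) w.
Proof.
by move=> t0; rewrite path_shift_maxE trajectoryE// addr_ge0// le_max lexx orbT.
Qed.

Lemma future0 (w : Omega) : future 0 w = trajectory w.
Proof.
apply: rc_path_eq => u; rewrite future_at// add0r.
by rewrite /path_at/=.
Qed.

Lemma future_shift (t s : R) (w : Omega) : 0 <= t -> 0 <= s ->
  path_shift s (future t w) = future (t + s) w.
Proof.
move=> t0 s0; apply: rc_path_eq => u.
have u0 : 0 <= Num.max u 0 by rewrite le_max lexx orbT.
rewrite future_at ?addr_ge0// path_shift_maxE future_at// max_l ?addrA//.
exact: addr_ge0.
Qed.

Lemma measurable_X (t : R) : 0 <= t -> measurable_fun setT (X t : Omega -> borel E).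
Proof.
move=> t0 _ B mB; rewrite setTI.
apply: (filtration_sub (standard_filtration std) t0).
exact: (standard_adapted std t0).
Qed.

Lemma measurable_future (t : R) : 0 <= t -> measurable_fun setT (future t : Omega -> D).
Proof.
move=> t0; apply: measurable_to_path => u.
rewrite (_ : _ \o _ = X (t + Num.max u 0)); last by apply/funext => w; exact: future_at.
have tu0 : 0 <= t + Num.max u 0 by rewrite addr_ge0// le_max lexx orbT.
exact: (measurable_X tu0).
Qed.

Lemma filtT (t : R) : 0 <= t -> Filt t setT.
Proof.
move=> t0; have [F0 FC _] := filtration_sigma (standard_filtration std) t0.
by rewrite -(setD0 setT); exact: FC.
Qed.

Lemma filt0 (t : R) : 0 <= t -> Filt t set0.
Proof. by move=> t0; have [] := filtration_sigma (standard_filtration std) t0. Qed.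

Lemma filtC (t : R) A : 0 <= t -> Filt t A -> Filt t (~` A).
Proof.
move=> t0 FA; have [F0 FC _] := filtration_sigma (standard_filtration std) t0.
by rewrite -setTD; exact: FC.
Qed.

Lemma filt_bigcup (t : R) (A : nat -> set Omega) : 0 <= t ->
  (forall n, Filt t (A n)) -> Filt t (\bigcup_n A n).
Proof. by move=> t0; have [_ _] := filtration_sigma (standard_filtration std) t0; exact. Qed.

Lemma filt_bigcap (t : R) (A : nat -> set Omega) : 0 <= t ->
  (forall n, Filt t (A n)) -> Filt t (\bigcap_n A n).
Proof.
move=> t0 FA; rewrite -(setCK (\bigcap_n _)) setC_bigcap; apply: filtC => //.
by apply: filt_bigcup => // n; exact: filtC.
Qed.

Lemma filtU (t : R) A B : 0 <= t -> Filt t A -> Filt t B -> Filt t (A `|` B).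
Proof.
move=> t0 FA FB; rewrite -bigcup2E; apply: filt_bigcup => // -[|[|n]]//=.
exact: filt0.
Qed.

Lemma filtI (t : R) A B : 0 <= t -> Filt t A -> Filt t B -> Filt t (A `&` B).
Proof.
move=> t0 FA FB; rewrite -(setCK (A `&` B)) setCI; apply: filtC => //.
by apply: filtU => //; exact: filtC.
Qed.

Lemma filt_le (s t : R) A : 0 <= s -> s <= t -> Filt s A -> Filt t A.
Proof. by move=> s0 st; exact: (filtration_le (standard_filtration std) s0 st). Qed.

Lemma filt_measurable (t : R) A : 0 <= t -> Filt t A -> measurable A.
Proof. by move=> t0; exact: (filtration_sub (standard_filtration std) t0). Qed.

Lemma filt_rat_bigcup (t : R) (A : rat -> set Omega) : 0 <= t ->
  (forall q, Filt t (A q)) -> Filt t (\bigcup_q A q).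
Proof.
move=> t0 FA; pose B (o : option rat) := if o is Some q then A q else set0.
have -> : \bigcup_q A q = \bigcup_n B (unpickle n).
  apply/seteqP; split => w.
    by move=> [q _ Aq]; exists (pickle q); [exact: I|rewrite pickleK].
  by move=> [n _]; move: (unpickle n) => [q Aq|//]; exists q.
apply: filt_bigcup => // n; move: (unpickle n) => [q|] /=; first exact: FA.
exact: filt0.
Qed.

Lemma filt_rat_bigcup_lt (t u : R) (A : rat -> set Omega) : 0 <= t ->
  (forall q, 0 <= ratr q :> R -> ratr q < u -> Filt t (A q)) ->
  Filt t (\bigcup_(q : rat) [set w | 0 <= ratr q :> R /\ ratr q < u /\ A q w]).
Proof.
move=> t0 FA; apply: filt_rat_bigcup => // q.
have [q0|q0] := pselect (0 <= ratr q :> R); last first.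
  by rewrite (_ : mkset _ = set0); [exact: filt0|rewrite -subset0 => p []].
have [qu|qu] := pselect (ratr q < u); last first.
  by rewrite (_ : mkset _ = set0); [exact: filt0|rewrite -subset0 => p [_ []]].
rewrite (_ : mkset _ = A q); first exact: FA.
by apply/seteqP; split => w //= [_ []].
Qed.

(** For each [s > t] the event is an intersection of events at times in []t, s]], so it lies in
    [Filt s]; right-continuity of the filtration brings it into [Filt t]. *)
Lemma filt_right_continuous (t : R) (tau : Omega -> \bar R) : 0 <= t ->
  (forall u, t < u -> Filt u [set w | (tau w < u%:E)%E]) ->
  Filt t [set w | (tau w <= t%:E)%E].
Proof.
move=> t0 Flt; rewrite (standard_right_continuous std t0) => s /= ts.
have -> : [set w | (tau w <= t%:E)%E] =
   \bigcap_n [set w | (tau w < (t + (s - t) / n.+1%:R)%:E)%E].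
  apply/seteqP; split => w /=.
    move=> tw n _; rewrite /= (le_lt_trans tw)// lte_fin ltrDl divr_gt0// subr_gt0//.
  move=> H; rewrite leNgt; apply/negP => tw.
  have [r tr rt] : exists2 r : R, t < r & (r%:E <= tau w)%E.
    case: (tau w) tw H => [r| |] //= tw _; first by exists r.
    by exists (t + 1); rewrite ?ltrDl// leey.
  have rt0 : 0 < (r - t) / (s - t) by rewrite divr_gt0// subr_gt0.
  have [n _ Hn] := near_infty_natSinv_lt (PosNum rt0).
  have /= hn := Hn n (leqnn n).
  have := H n I; rewrite /= ltNge (le_trans _ rt)// lee_fin -lerBrDl mulrC -ler_pdivlMr ?subr_gt0//.
  exact: ltW.
have s0 : 0 <= s by rewrite (le_trans t0)// ltW.
apply: filt_bigcap => // n.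
have st : 0 < s - t by rewrite subr_gt0.
have tn : t < t + (s - t) / n.+1%:R by rewrite ltrDl divr_gt0.
apply: (@filt_le (t + (s - t) / n.+1%:R)); first by rewrite (le_trans t0)// ltW.
  by rewrite -lerBrDl ler_pdivrMr ?ltr0n// ler_peMr ?ler1n// ltW.
exact: Flt.
Qed.

Lemma stopping_time_lt (tau : Omega -> \bar R) (t : R) : stopping_time Filt tau ->
  0 <= t -> Filt t [set w | (tau w < t%:E)%E].
Proof.
move=> [tau0 Ftau] t0.
have -> : [set w | (tau w < t%:E)%E] =
    \bigcup_(q : rat) [set w | 0 <= ratr q :> R /\ ratr q < t /\ (tau w <= (ratr q)%:E)%E].
  apply/seteqP; split => w /=; last first.
    by move=> [q _ [_ [qt]]] /le_lt_trans; apply; rewrite lte_fin.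
  have := tau0 w; case Er : (tau w) => [r| |]//; rewrite lee_fin lte_fin => r0 rt.
  have /rat_in_itvoo[q] := rt; rewrite in_itv/= => /andP[rq qt].
  exists q => //; rewrite /mkset Er lee_fin; split; last by split => //; exact: ltW.
  by rewrite ltW// (le_lt_trans r0).
apply: (@filt_rat_bigcup_lt t t (fun q => [set w | (tau w <= (ratr q)%:E)%E])) => // q q0 qt.
by apply: (filt_le q0 (ltW qt)); exact: Ftau.
Qed.

Lemma measurable_stopping_time (tau : Omega -> \bar R) : stopping_time Filt tau ->
  measurable_fun setT tau.
Proof.
move=> [tau0 Ftau]; apply: (measurability _ (ErealGenOInfty.measurableE R)).
move=> _ [_ [u ->] <-]; rewrite setTI.
have [u0|u0] := leP 0 u; last first.
  rewrite (_ : _ @^-1` _ = setT)// -subTset => w _ /=.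
  by rewrite in_itv/= andbT (lt_le_trans _ (tau0 w))// lte_fin.
rewrite (_ : _ @^-1` _ = ~` [set w | (tau w <= u%:E)%E]).
  by apply: measurableC; apply: (filt_measurable u0); exact: (Ftau _ u0).
by apply/seteqP; split => w /=; rewrite in_itv/= andbT ltNge => /negP.
Qed.

Lemma stopping_time_cst (t : R) : 0 <= t -> stopping_time Filt (fun=> t%:E).
Proof.
move=> t0; split=> [w|u u0]; first by rewrite lee_fin.
have [tu|tu] := leP t%:E u%:E.
  by rewrite (_ : mkset _ = setT); [exact: filtT|rewrite -subTset].
by rewrite (_ : mkset _ = set0); [exact: filt0|rewrite -subset0].
Qed.

Lemma stopping_time_min (tau sigma : Omega -> \bar R) :
  stopping_time Filt tau -> stopping_time Filt sigma ->
  stopping_time Filt (fun w => mine (tau w) (sigma w)).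
Proof.
move=> [tau0 Ft] [sigma0 Fs]; split=> [w|t t0]; first by rewrite le_min tau0 sigma0.
rewrite (_ : mkset _ = [set w | (tau w <= t%:E)%E] `|` [set w | (sigma w <= t%:E)%E]).
  by apply: filtU => //; [exact: Ft|exact: Fs].
by apply/seteqP; split => w /=; rewrite ge_min => /orP.
Qed.

Lemma stopping_time_max (tau sigma : Omega -> \bar R) :
  stopping_time Filt tau -> stopping_time Filt sigma ->
  stopping_time Filt (fun w => maxe (tau w) (sigma w)).
Proof.
move=> [tau0 Ft] [sigma0 Fs]; split=> [w|t t0]; first by rewrite le_max tau0.
rewrite (_ : mkset _ = [set w | (tau w <= t%:E)%E] `&` [set w | (sigma w <= t%:E)%E]).
  by apply: filtI => //; [exact: Ft|exact: Fs].
by apply/seteqP; split => w /=; rewrite ge_max => /andP.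
Qed.

Lemma filt_hitting_future_lt (G : set E) (t u : R) : open G -> 0 <= t -> 0 <= u ->
  Filt (t + u) [set w | (hitting_time G (future t w) < u%:E)%E].
Proof.
move=> oG t0 u0.
have -> : [set w | (hitting_time G (future t w) < u%:E)%E] =
    \bigcup_(q : rat) [set w | 0 <= ratr q :> R /\ ratr q < u /\ G (X (t + ratr q) w)].
  apply/seteqP; split => w /=.
    by move=> /(hitting_time_lt_rat _ _ oG)[q [? ?]]; rewrite futureE// => ?; exists q.
  move=> [q _ [? [? ?]]]; apply/hitting_time_lt_rat => //; exists q; split => //.
  by rewrite futureE.
have tu0 : 0 <= t + u by exact: addr_ge0.
apply: (@filt_rat_bigcup_lt _ u (fun q => X (t + ratr q) @^-1` G)) => // q q0 qu.
apply: (@filt_le (t + ratr q)); first exact: addr_ge0.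
  by rewrite lerD2l ltW.
by apply: (standard_adapted std); [exact: addr_ge0|exact: open_borel].
Qed.

Lemma filt_hitting_future (G : set E) (t u : R) : open G -> 0 <= t -> 0 <= u ->
  Filt (t + u) [set w | (hitting_time G (future t w) <= u%:E)%E].
Proof.
move=> oG t0 u0.
have -> : [set w | (hitting_time G (future t w) <= u%:E)%E] =
    [set w | (t%:E + hitting_time G (future t w) <= (t + u)%:E)%E].
  by apply/seteqP; split => w /=; rewrite EFinD leeD2lE.
apply: filt_right_continuous; first exact: addr_ge0.
move=> v tuv; have := @filt_hitting_future_lt G t (v - t) oG t0.
rewrite (_ : t + (v - t) = v); last by rewrite addrCA subrr addr0.
rewrite (_ : [set w | (_ < (v - t)%:E)%E] =
    [set w | (t%:E + hitting_time G (future t w) < v%:E)%E]); last first.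
  by apply/seteqP; split => w /=; rewrite EFinB lteBrDl.
by apply; rewrite subr_ge0 (le_trans _ (ltW tuv))// lerDl.
Qed.

Lemma stopping_time_hitting (G : set E) : open G ->
  stopping_time Filt (fun w => hitting_time G (trajectory w)).
Proof.
move=> oG; split=> [w|t t0]; first exact: hitting_time_ge0.
have := @filt_hitting_future G 0 t oG (lexx 0) t0; rewrite add0r.
by under eq_set do rewrite future0.
Qed.

Lemma filt_exit_future (O : set E) (t u : R) : 0 <= t -> 0 <= u ->
  Filt (t + u) [set w | (u%:E < announced_exit O (future t w))%E].
Proof.
move=> t0 u0.
have -> : [set w | (u%:E < announced_exit O (future t w))%E] =
   \bigcup_n ~` [set w | (hitting_time (near_complement O n) (future t w) <= u%:E)%E].
  apply/seteqP; split => w /=.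
    by move=> /announced_exit_gtP[n un]; exists n => //=; apply/negP; rewrite -ltNge.
  by move=> [n _ /=] /negP; rewrite -ltNge => ?; apply/announced_exit_gtP; exists n.
have tu0 : 0 <= t + u by exact: addr_ge0.
apply: filt_bigcup => // n; apply: filtC => //; apply: filt_hitting_future => //.
exact: near_complement_open.
Qed.

Lemma transitionE (t : R) (h : E -> R) (x : E) :
  transition X P t h x = \int[P x]_w h (X t w).
Proof. by rewrite /transition fine_expectation. Qed.

Lemma transition_bounded_measurable (t : R) (h : E -> R) : 0 <= t ->
  bounded_measurable (h : borel E -> R) ->
  bounded_measurable (transition X P t h : borel E -> R).
Proof.
move=> t0 bh; have -> : transition X P t h = (fun x => \int[P x]_w h (X t w)).
  by apply/funext => x; exact: transitionE.
by apply: (@kernel_mean R E _ Omega P _ (borel E) (X t)) => //;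
  [exact: measurable_X|exact: (standard_kernel std)].
Qed.

Lemma bounded_measurable_comp d' (Y : measurableType d') (phi : Omega -> Y) (Z : Y -> R) :
  bounded_measurable Z -> measurable_fun setT phi ->
  bounded_measurable (fun w => Z (phi w)).
Proof. by move=> [mZ [M ZM]] mphi; split; [exact: measurableT_comp|exists M => w; exact: ZM]. Qed.

Lemma strong_Markov_mean (tau : Omega -> \bar R) (t : R) (h : E -> R) (x : E) :
  stopping_time Filt tau -> (forall w, tau w \is a fin_num) -> 0 <= t ->
  bounded_measurable (h : borel E -> R) ->
  \int[P x]_w h (X (fine (tau w) + t) w) =
  \int[P x]_w transition X P t h (X (fine (tau w)) w).
Proof.
move=> stau fin t0 /bounded_borelP bh.
have sT : stopped_sigma_algebra Filt tau setT.
  by split => // u u0; rewrite setTI; have [_] := stau; exact.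
have := @standard_strong_Markov _ _ _ _ _ _ _ std tau stau setT sT t t0 h bh x.
rewrite /= setTI (_ : [set w | (tau w < +oo)%E] = setT); last first.
  by rewrite -subTset => w _ /=; rewrite ltey_eq fin.
move=> /(congr1 fine); rewrite !fine_expectation indicT.
by under eq_Rintegral do rewrite mul1r; under [RHS]eq_Rintegral do rewrite mul1r.
Qed.

Lemma Markov_mean (s t : R) (A : set Omega) (h : E -> R) (x : E) :
  0 <= s -> 0 <= t -> Filt s A -> bounded_measurable (h : borel E -> R) ->
  \int[P x]_w (\1_A w * h (X (s + t) w)) =
  \int[P x]_w (\1_A w * transition X P t h (X s w)).
Proof.
move=> s0 t0 FA /bounded_borelP bh.
have sA : stopped_sigma_algebra Filt (fun=> s%:E) A.
  split; first exact: filt_measurable FA.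
  move=> u u0; have [su|su] := leP s%:E u%:E.
    rewrite (_ : [set w | _] = setT) ?setIT; first exact: filt_le FA.
    by rewrite -subTset => w _.
  by rewrite (_ : [set w | _] = set0) ?setI0; [exact: filt0|rewrite -subset0].
have := @standard_strong_Markov _ _ _ _ _ _ _ std _ (stopping_time_cst s0) A sA t t0 h bh x.
rewrite /= (_ : [set w | (s%:E < +oo)%E] = setT) ?setIT; last first.
  by rewrite -subTset => w _ /=; rewrite ltry.
by move=> /(congr1 fine); rewrite !fine_expectation.
Qed.

Lemma mean_start (h : E -> R) (x : E) : bounded_measurable (h : borel E -> R) ->
  \int[P x]_w h (X 0 w) = h x.
Proof.
move=> bh; have mx : measurable ([set x] : set (borel E)).
  apply: closed_borel; apply: accessible_closed_set1; apply: hausdorff_accessible.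
  exact: metric_hausdorff.
have m0 : measurable (X 0 @^-1` [set x]).
  by rewrite -[X in measurable X]setTI; exact: (measurable_X (lexx 0)).
rewrite -[RHS](mean_cst (P x)).
apply: (@mean_ae_eq _ _ _ _ (~` (X 0 @^-1` [set x]))).
- exact: (bounded_measurable_comp bh (measurable_X (lexx 0))).
- exact: bounded_measurable_cst.
- exact: measurableC.
- by rewrite probability_setC// (standard_start std) subee.
- by move=> w /contrapT /= ->.
Qed.

End process_lemmas.

(** * Cylinder sets of paths *)

Section path_cylinders.
Context {R : realType} {E : pmetricType R}.
Local Notation D := (path_space E).

Definition in_cylinder (l : seq (R * set (borel E))) (p : rc_path E) : bool :=
  all (fun z => path_at z.1 p \in z.2) l.

Definition finite_cylinders : set (set D) :=
  [set S | exists2 l : seq (R * set (borel E)),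
    (forall z, z \in l -> measurable z.2) & S = [set p | in_cylinder l p]].

Lemma measurable_in_cylinder l : (forall z, z \in l -> measurable z.2) ->
  measurable ([set p | in_cylinder l p] : set D).
Proof.
elim: l => [|z l IH] ml.
  by rewrite (_ : mkset _ = setT)// -subTset => p _.
rewrite (_ : mkset _ = (path_at z.1 @^-1` z.2) `&` [set p | in_cylinder l p]).
  apply: measurableI; last by apply: IH => y yl; apply: ml; rewrite inE yl orbT.
  rewrite -[X in measurable X]setTI; apply: measurable_path_at => //.
  by apply: ml; rewrite inE eqxx.
apply/seteqP; split => p /=; rewrite /in_cylinder/=.
  by move=> /andP[/set_mem].
by move=> [pz ->]; rewrite mem_set.
Qed.

Lemma finite_cylinders_setI : setI_closed finite_cylinders.
Proof.
move=> _ _ [l ml ->] [l' ml' ->]; exists (l ++ l').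
  by move=> z; rewrite mem_cat => /orP[]; [exact: ml|exact: ml'].
apply/seteqP; split => p /=; rewrite /in_cylinder all_cat.
  by move=> [-> ->].
by move=> /andP.
Qed.

Lemma finite_cylinders_generate : @measurable _ D = <<s finite_cylinders >>.
Proof.
rewrite eqEsubset; split.
  apply: sub_smallest2r; first exact: smallest_sigma_algebra.
  move=> _ [t [B mB ->]]; exists [:: (t, B)].
    by move=> z; rewrite inE => /eqP ->.
  by apply/seteqP; split => p /=; rewrite /in_cylinder/= andbT; [exact: mem_set|exact: set_mem].
apply: smallest_sub; first exact: sigma_algebra_measurable.
by move=> _ [l ml ->]; exact: measurable_in_cylinder.
Qed.

End path_cylinders.

Section path_Markov.
Context {R : realType} {E : pmetricType R} {d : measure_display}
  {Omega : measurableType d}.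
Context {Filt : R -> set (set Omega)} {X : R -> Omega -> E}
  {P : E -> probability Omega R}.
Hypothesis std : standard_Markov_process Filt X P.
Local Notation D := (path_space E).
Local Notation future := (future std).
Local Notation trajectory := (trajectory std).

Definition path_mean (Z : D -> R) (x : E) : R := \int[P x]_w Z (trajectory w).

(** The two properties are carried together: the second is stated through [path_mean Z], and its
    passage to the limit needs the first. *)
Definition path_Markov (Z : D -> R) : Prop :=
  measurable_fun [set: borel E] (path_mean Z : borel E -> R) /\
  forall (t : R) (A : set Omega) (x : E), 0 <= t -> Filt t A ->
    \int[P x]_w (\1_A w * Z (future t w)) =
    \int[P x]_w (\1_A w * path_mean Z (X t w)).

Lemma bounded_measurable_future (t : R) (Z : D -> R) : 0 <= t ->
  bounded_measurable Z -> bounded_measurable (fun w => Z (future t w)).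
Proof. by move=> t0 bZ; exact: (bounded_measurable_comp bZ (measurable_future std t0)). Qed.

Lemma bounded_measurable_X (t : R) (h : E -> R) : 0 <= t ->
  bounded_measurable (h : borel E -> R) -> bounded_measurable (fun w => h (X t w)).
Proof.
move=> t0 bh.
exact: (bounded_measurable_comp bh (measurable_X std t0)).
Qed.

Lemma path_mean_future0 (Z : D -> R) (x : E) :
  path_mean Z x = \int[P x]_w Z (future 0 w).
Proof. by apply: eq_Rintegral => w _; rewrite future0. Qed.

Lemma measurable_trajectory : measurable_fun setT (trajectory : Omega -> D).
Proof.
have -> : trajectory = future 0 by apply/funext => w; rewrite future0.
exact: measurable_future.
Qed.

Lemma bounded_measurable_trajectory (Z : D -> R) :
  bounded_measurable Z -> bounded_measurable (fun w => Z (trajectory w)).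
Proof. by move=> bZ; exact: (bounded_measurable_comp bZ measurable_trajectory). Qed.

Lemma bounded_path_mean (Z : D -> R) (M : R) : measurable_fun setT Z ->
  (forall p, `|Z p| <= M) -> forall x, `|path_mean Z x| <= M.
Proof.
move=> mZ ZM x; apply: mean_norm_le => //.
exact: measurableT_comp measurable_trajectory.
Qed.

(** The effective time of a constraint, since [path_shift] freezes negative times. *)
Definition clock (z : R * set (borel E)) : R := Num.max z.1 0.

(** Induction on the constraints, in increasing order of time. The event of the earliest one is
    absorbed into [A], the later ones are integrated into [k] by the induction hypothesis, and one
    simple Markov step from [clock z] back to [a] finishes. *)
Lemma sorted_cylinder_Markov l (a : R) : 0 <= a ->
  path <=%R a (map clock l) -> (forall z, z \in l -> measurable z.2) ->
  exists2 k : E -> R, bounded_measurable (k : borel E -> R) &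
  forall (t : R) (A : set Omega) (x : E), 0 <= t -> Filt (t + a) A ->
    \int[P x]_w (\1_A w * (in_cylinder l (future t w))%:R) =
    \int[P x]_w (\1_A w * k (X (t + a) w)).
Proof.
elim: l a => [|z l IH] a a0 /=.
  by move=> _ _; exists (cst 1) => //; exact: bounded_measurable_cst.
move=> /andP[az pl] ml.
have v0 : 0 <= clock z by rewrite (le_trans a0).
have mz : measurable z.2 by apply: ml; rewrite inE eqxx.
have [|k bk Hk] := IH _ v0 pl; first by move=> y yl; apply: ml; rewrite inE yl orbT.
pose h (y : E) := \1_(z.2) y * k y.
have bh : bounded_measurable (h : borel E -> R).
  by apply: bounded_measurableM => //; exact: bounded_measurable_indic.
exists (transition X P (clock z - a) h).
  by apply: (transition_bounded_measurable std) => //; rewrite subr_ge0.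
move=> t A x t0 FA.
have ta0 : 0 <= t + a by exact: addr_ge0.
have za0 : 0 <= clock z - a by rewrite subr_ge0.
have tz : t + a + (clock z - a) = t + clock z by rewrite addrACA addrC addrACA; lra.
have tz0 : 0 <= t + clock z by exact: addr_ge0.
rewrite -(Markov_mean std x ta0 za0 FA bh) tz.
have FB : Filt (t + clock z) (A `&` X (t + clock z) @^-1` z.2).
  apply: (filtI std) => //; last exact: (standard_adapted std).
  by apply: (filt_le std ta0 _ FA); rewrite lerD2l.
transitivity (\int[P x]_w (\1_(A `&` X (t + clock z) @^-1` z.2) w * (in_cylinder l (future t w))%:R)).
  apply: eq_Rintegral => w _; rewrite indicI/= {1}/in_cylinder/= future_at// -/(clock z).
  by rewrite [\1_(_ @^-1` _) w]indicE -mulrA -natrM mulnb.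
rewrite Hk//; apply: eq_Rintegral => w _; rewrite indicI/= /h mulrA//.
Qed.

Lemma cylinder_Markov (S : set D) : finite_cylinders S -> path_Markov (\1_S).
Proof.
move=> [l0 ml0 ->]; pose l := sort (fun z z' => clock z <= clock z') l0.
have ml z : z \in l -> measurable z.2 by rewrite mem_sort; exact: ml0.
have -> : \1_([set p | in_cylinder l0 p]) = (fun p => (in_cylinder l p)%:R) :> (D -> R).
  apply/funext => p; rewrite indicE; congr (_%:R); congr (nat_of_bool _).
  rewrite /in_cylinder (perm_all _ (permEl (perm_sort _ l0))).
  by apply/idP/idP; [move=> /set_mem|move=> ?; exact: mem_set].
have sl : path <=%R 0 (map clock l).
  rewrite path_min_sorted.
    by rewrite sorted_map; apply: sort_sorted => z z'; exact: le_total.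
  by apply/allP => _ /mapP[z _ ->]; rewrite /clock le_max lexx orbT.
have [k bk Hk] := sorted_cylinder_Markov (lexx 0) sl ml.
(* Time [0] and the whole space identify [k] with the mean itself. *)
have kE : path_mean (fun p => (in_cylinder l p)%:R) = k.
  apply/funext => x; rewrite path_mean_future0 -[RHS](mean_start std x bk).
  have := Hk 0 setT x (lexx 0) (filtT std _); rewrite addr0 indicT => /(_ (lexx 0)).
  by under eq_Rintegral do rewrite mul1r; under [RHS]eq_Rintegral do rewrite mul1r.
split; first by rewrite kE; case: bk.
by move=> t A x t0 FA; rewrite kE Hk ?addr0.
Qed.

(** This takes the place of shift operators: given [Filt t], the path [future t] is distributed as a
    path started afresh from [X t]. *)
Theorem functional_Markov (Z : D -> R) : bounded_measurable Z -> path_Markov Z.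
Proof.
have b1 (t : R) (A : set Omega) : 0 <= t -> Filt t A -> bounded_measurable (\1_A : Omega -> R).
  by move=> t0 FA; apply: bounded_measurable_indic; exact: (filt_measurable std t0 FA).
have bM (W : D -> R) : bounded_measurable W -> path_Markov W ->
    bounded_measurable (path_mean W : borel E -> R).
  move=> [mW [M WM]] [mm _]; split => //; exists M; exact: bounded_path_mean.
apply: (@functional_monotone_class _ D R path_Markov _ _ (@finite_cylinders R E)).
- move=> a V W bV bW MV MW.
  have E1 : path_mean (fun p => a * V p + W p) = (fun x => a * path_mean V x + path_mean W x).
    apply/funext => x; rewrite /path_mean meanD ?meanZ//.
    + exact: bounded_measurable_trajectory.
    + by apply: bounded_measurableZ; exact: bounded_measurable_trajectory.
    + exact: bounded_measurable_trajectory.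
  split.
    by rewrite E1; apply: measurable_funD; [apply: measurable_funM => //; exact: MV.1|exact: MW.1].
  move=> t A x t0 FA; rewrite E1.
  have split_mean (p q : Omega -> R) : bounded_measurable p -> bounded_measurable q ->
      \int[P x]_w (\1_A w * (a * p w + q w)) =
      a * (\int[P x]_w (\1_A w * p w)) + \int[P x]_w (\1_A w * q w).
    move=> bp bq; have bA := b1 _ _ t0 FA.
    rewrite -meanZ; last exact: bounded_measurableM.
    rewrite -meanD; last 2 first.
    + by apply: bounded_measurableZ; exact: bounded_measurableM.
    + exact: bounded_measurableM.
    by apply: eq_Rintegral => w _; rewrite mulrDr mulrCA.
  rewrite !split_mean; last 4 first.
  + by apply: (bounded_measurable_X t0); exact: bM.
  + by apply: (bounded_measurable_X t0); exact: bM.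
  + exact: bounded_measurable_future.
  + exact: bounded_measurable_future.
  by rewrite MV.2// MW.2.
- move=> Zn V M bZn MZn ZnM bV cV.
  have cE x : path_mean (Zn n) x @[n --> \oo] --> path_mean V x.
    apply: (@mean_cvg _ _ _ _ _ _ M).
    + by move=> n; have [] := bounded_measurable_trajectory (bZn n).
    + by move=> n w; exact: ZnM.
    + by apply: aeW => w; exact: cV.
    + by have [] := bounded_measurable_trajectory bV.
  have mV : measurable_fun [set: borel E] (path_mean V : borel E -> R).
    apply: (@measurable_fun_cvg _ _ R setT (fun n (x : borel E) => path_mean (Zn n) x)) => //.
    by move=> n; exact: (MZn n).1.
  split => // t A x t0 FA; have bA := b1 _ _ t0 FA.
  have A1 w : `|\1_A w| <= 1 :> R by rewrite indicE; case: (_ \in _); rewrite ?normr1 ?normr0.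
  have bmV : bounded_measurable (path_mean V : borel E -> R).
    by split => //; have [mV' [M' VM]] := bV; exists M'; exact: bounded_path_mean.
  have c1 : \int[P x]_w (\1_A w * Zn n (future t w)) @[n --> \oo] -->
            \int[P x]_w (\1_A w * V (future t w)).
    apply: (@mean_cvg _ _ _ _ _ _ M).
    + by move=> n; have [] := bounded_measurableM bA (bounded_measurable_future t0 (bZn n)).
    + by move=> n w; rewrite normrM -[leRHS]mul1r ler_pM.
    + by apply: aeW => w; apply: cvgM; [exact: cvg_cst|exact: cV].
    + by have [] := bounded_measurableM bA (bounded_measurable_future t0 bV).
  have c2 : \int[P x]_w (\1_A w * path_mean (Zn n) (X t w)) @[n --> \oo] -->
            \int[P x]_w (\1_A w * path_mean V (X t w)).
    apply: (@mean_cvg _ _ _ _ _ _ M).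
    + by move=> n; have [] := bounded_measurableM bA (bounded_measurable_X t0 (bM _ (bZn n) (MZn n))).
    + move=> n w; rewrite normrM -[leRHS]mul1r ler_pM//.
      by apply: bounded_path_mean => //; case: (bZn n).
    + by apply: aeW => w; apply: cvgM; [exact: cvg_cst|exact: cE].
    + by have [] := bounded_measurableM bA (bounded_measurable_X t0 bmV).
  have c12 : (fun n => \int[P x]_w (\1_A w * Zn n (future t w))) =
             (fun n => \int[P x]_w (\1_A w * path_mean (Zn n) (X t w))).
    by apply/funext => n; apply: (MZn n).2.
  by rewrite c12 in c1; exact: (cvg_unique _ c1 c2).
- exact: finite_cylinders_generate.
- exact: finite_cylinders_setI.
- have -> : cst 1 = \1_(setT : set D) :> (D -> R) by rewrite indicT.
  apply: cylinder_Markov; exists [::] => //.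
  by apply/seteqP; split.
- exact: cylinder_Markov.
Qed.

Lemma bounded_measurable_path_mean (Z : D -> R) : bounded_measurable Z ->
  bounded_measurable (path_mean Z : borel E -> R).
Proof.
move=> bZ; split; first exact: (functional_Markov bZ).1.
by have [mZ [M ZM]] := bZ; exists M; exact: bounded_path_mean.
Qed.

End path_Markov.

(** * Time averages of the semigroup *)

Section lebesgue_lemmas.
Context {R : realType}.
Local Notation leb := (@lebesgue_measure R).

Let translate (c : R) : measurableTypeR R -> measurableTypeR R := fun u => u - c.

Let measurable_translate c : measurable_fun setT (translate c).
Proof. by apply: measurable_funB => //; exact: measurable_cst. Qed.

(** The translated measure agrees with Lebesgue measure on half-open intervals, and these determine
    it. *)
Lemma lebesgue_translation (c : R) (A : set R) : measurable A ->
  leb A = leb [set u | A (u - c)].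
Proof.
move=> mA.
apply: (@lebesgue_measure_unique R (pushforward leb (translate c))) => //.
move=> _ [[a b] /= _ <-]; rewrite /pushforward.
have -> : translate c @^-1` `]a, b] = `]a + c, b + c]%classic.
  by apply/seteqP; split => u; rewrite /translate/= !in_itv/= ltrBrDr lerBlDr.
by rewrite !lebesgue_measure_itv/= !lte_fin ltrD2r -!EFinB opprD addrACA subrr addr0.
Qed.

Lemma Rintegral_translation (c : R) (g : R -> R) (D : set R) :
  measurable D -> measurable_fun D g ->
  \int[leb]_(u in D) g u = \int[leb]_(u in [set u | D (u - c)]) g (u - c).
Proof.
move=> mD mg; rewrite /Rintegral; congr fine.
have pos (k : R -> \bar R) : measurable_fun D k -> (forall u, (0 <= k u)%E) ->
    (\int[leb]_(u in D) k u = \int[leb]_(u in [set u | D (u - c)%R]) k (u - c)%R)%E.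
  move=> mk k0.
  have H := @ge0_integral_pushforward _ _ _ _ R (translate c) (measurable_translate c) leb D k mD mk (fun u _ => k0 u).
  rewrite -[RHS]H; apply: eq_measure_integral => B mB _.
  exact: lebesgue_translation.
have mE : measurable_fun D (EFin \o g) by exact/measurable_EFinP.
rewrite integralE [RHS]integralE; congr (_ - _)%E.
  rewrite [LHS](pos _ (measurable_funepos mE) (fun u => funepos_ge0 _ u)).
  by apply: eq_integral => u _; rewrite !funeposE.
rewrite [LHS](pos _ (measurable_funeneg mE) (fun u => funeneg_ge0 _ u)).
by apply: eq_integral => u _; rewrite !funenegE.
Qed.

Lemma Rintegral_dominated d (T : measurableType d) (mu : {measure set T -> \bar R})
    (D : set T) (gn : nat -> T -> R) (g G : T -> R) :
  measurable D -> (forall n, measurable_fun D (gn n)) -> measurable_fun D g ->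
  (forall u, D u -> gn n u @[n --> \oo] --> g u) ->
  mu.-integrable D (EFin \o G) -> (forall n u, D u -> `|gn n u| <= G u) ->
  \int[mu]_(u in D) gn n u @[n --> \oo] --> \int[mu]_(u in D) g u.
Proof.
move=> mD mgn mg cg iG gnG.
have cvgE : {ae mu, forall w, D w -> (EFin \o gn n) w @[n --> \oo] --> (EFin \o g) w}.
  by apply: aeW => w Dw; apply: cvg_EFin; [exact: nearW|exact: cg].
have domE : {ae mu, forall w, forall n, D w -> (`|(EFin \o gn n) w| <= (EFin \o G) w)%E}.
  by apply: aeW => w n Dw /=; rewrite lee_fin gnG.
have [iZ _ cI] := @dominated_convergence _ _ R mu D mD
  (fun n => EFin \o gn n) (EFin \o g) (EFin \o G)
  (fun n => (measurable_EFinP _ _).2 (mgn n)) ((measurable_EFinP _ _).2 mg)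
  cvgE iG domE.
by apply: fine_cvg; rewrite [X in _ --> X]/= fineK//; exact: integrable_fin_num.
Qed.

Lemma expRN_le1 (c u : R) : 0 <= c -> 0 <= u -> expR (- c * u) <= 1.
Proof. by move=> c0 u0; rewrite -[leRHS]expR0 ler_expR mulNr oppr_le0 mulr_ge0. Qed.

(** The exponential density divided by [a], hence of total mass [1 / a]; it dominates the discounted
    running rates. *)
Definition discount (a u : R) : R := if 0 <= u then expR (- a * u) else 0.

Lemma discount_ge0 a u : 0 <= discount a u.
Proof. by rewrite /discount; case: ifP => // _; exact: expR_ge0. Qed.

Lemma measurable_discount a : measurable_fun setT (discount a).
Proof.
apply: measurable_fun_ifT => //; first exact: measurable_fun_ler.
by apply: measurableT_comp => //; apply: measurable_funM => //; exact: measurable_cst.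
Qed.

Lemma discount_pdf a u : 0 < a -> discount a u = a^-1 * exponential_pdf a u.
Proof.
move=> a0; rewrite /discount; case: ifPn => [u0|]; last first.
  by rewrite -ltNge => /lt0_exponential_pdf ->; rewrite mulr0.
by rewrite exponential_pdfE// mulKf// gt_eqF.
Qed.

Lemma integrable_discount a : 0 < a -> leb.-integrable setT (EFin \o discount a).
Proof.
move=> a0; rewrite (_ : _ \o _ = (fun u => (a^-1)%:E * (exponential_pdf a u)%:E)%E).
  by apply: integrableZl => //; exact: integrable_exponential_pdf.
by apply/funext => u /=; rewrite discount_pdf// EFinM.
Qed.

Lemma Rintegral_discount a : 0 < a -> \int[leb]_u discount a u = a^-1.
Proof.
move=> a0; under eq_Rintegral do rewrite discount_pdf//.
rewrite RintegralZl//; last exact: integrable_exponential_pdf.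
by rewrite /Rintegral integral_exponential_pdf//= mulr1.
Qed.

Lemma measurable_Rintegral d (Y : measurableType d) (k : Y * R -> R) :
  measurable_fun setT k ->
  measurable_fun setT (fun y => \int[leb]_u k (y, u)).
Proof.
move=> mk; apply: measurableT_comp; first exact: fine_measurable.
have mE : measurable_fun setT (EFin \o k) by exact/measurable_EFinP.
rewrite (_ : (fun y => _) = (fun y => \int[leb]_u ((EFin \o k)^\+ (y, u)) -
   \int[leb]_u ((EFin \o k)^\- (y, u)))%E).
  apply: emeasurable_funB.
    apply: (@measurable_fun_fubini_tonelli_F _ _ Y (measurableTypeR R) R leb (EFin \o k)^\+%E) => //.
    exact: measurable_funepos.
  apply: (@measurable_fun_fubini_tonelli_F _ _ Y (measurableTypeR R) R leb (EFin \o k)^\-%E) => //.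
  exact: measurable_funeneg.
apply/funext => y; rewrite integralE; congr (_ - _)%E.
by apply: eq_integral => u _; rewrite !funeposE.
by apply: eq_integral => u _; rewrite !funenegE.
Qed.

Lemma Rintegral_finite_bound (D : set R) (g : R -> R) (M : R) :
  measurable D -> (leb D < +oo)%E -> measurable_fun D g ->
  (forall u, D u -> `|g u| <= M) -> `|\int[leb]_(u in D) g u| <= M * fine (leb D).
Proof.
move=> mD D_oo mg gM.
have ig : leb.-integrable D (EFin \o g).
  apply: measurable_bounded_integrable => //; exists M; split; first exact: num_real.
  by move=> y My u Du /=; rewrite (le_trans (gM _ Du))// ltW.
have ic : leb.-integrable D (EFin \o cst M).
  apply: measurable_bounded_integrable => //.
  exists `|M|; split; first exact: num_real.
  by move=> y My u Du /=; rewrite ltW.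
rewrite (le_trans (le_normr_Rintegral _ _))// -Rintegral_cst//.
by apply: le_Rintegral => //; exact: integrable_norm.
Qed.

Lemma lebesgue_co (a b : R) : a <= b -> leb `[a, b[%classic = (b - a)%:E.
Proof.
by move=> ab; rewrite lebesgue_measure_itv/= lte_fin; case: ltgtP ab => // ->; rewrite subrr.
Qed.

Lemma integrable_cst_co (a c : R) : 0 <= a -> leb.-integrable `[0, a[ (EFin \o cst c).
Proof.
move=> a0; apply: measurable_bounded_integrable => //.
  by rewrite [X in (X < _)%E](_ : _ = leb `[0, a[%classic)// lebesgue_co// ltry.
by exists `|c|; split => // M M1 u _ /=; rewrite ltW.
Qed.

Lemma mean_Rintegral d (Omega : measurableType d) (P : probability Omega R)
    (g : R * Omega -> R) (a : R) : 0 <= a ->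
  measurable_fun setT g -> (forall z, 0 <= g z <= 1) ->
  \int[P]_w (\int[leb]_(u in `[0%R, a[) g (u, w)) =
  \int[leb]_(u in `[0%R, a[) (\int[P]_w g (u, w)).
Proof.
move=> a0 mg g01.
have g1 z : `|g z| <= 1 by have /andP[? ?] := g01 z; rewrite ger0_norm.
pose k (z : R * Omega) : R := \1_(`[0%R, a[%classic) z.1 * g z.
have k0 z : 0 <= k z by rewrite mulr_ge0//; have /andP[] := g01 z.
have mk : measurable_fun setT k.
  by apply: measurable_funM => //; apply: measurableT_comp => //; exact: measurable_indic.
have E1 w : (\int[leb]_(u in `[0%R, a[) g (u, w))%:E = (\int[leb]_u (k (u, w))%:E)%E.
  have mgw : measurable_fun setT (fun u => g (u, w)).
    by apply: (measurableT_comp mg); exact: measurable_fun_pair.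
  rewrite /Rintegral fineK; last first.
    apply: integrable_fin_num => //; apply: measurable_bounded_integrable => //.
    + by rewrite [X in (X < _)%E](_ : _ = leb `[0%R, a[%classic)// lebesgue_co// ltry.
    + exact: measurable_funTS.
    + exists 1; split => // y y1 u _ /=; exact: le_trans (ltW y1).
  rewrite integral_mkcond; apply: eq_integral => u _; rewrite /patch /k/= indicE.
  by case: ifPn => _; rewrite /= ?mul1r ?mul0r.
have E2 u : (\1_(`[0%R, a[%classic) u * \int[P]_w g (u, w))%:E = (\int[P]_w (k (u, w))%:E)%E.
  have bgu : bounded_measurable (fun w => g (u, w)).
    by split; [apply: (measurableT_comp mg); exact: measurable_fun_pair|exists 1].
  rewrite -meanZ// EFin_mean//; exact: bounded_measurableZ.
transitivity (fine (\int[P]_w \int[leb]_u (k (u, w))%:E)%E).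
  by rewrite /Rintegral; congr fine; apply: eq_integral => w _; rewrite -E1.
transitivity (fine (\int[leb]_u \int[P]_w (k (u, w))%:E)%E); last first.
  rewrite Rintegral_mkcond /Rintegral; congr fine; apply: eq_integral => u _.
  rewrite -E2 /patch indicE; case: ifPn => _; rewrite /= ?mul1r ?mul0r//.
congr fine; apply/esym.
apply: (@fubini_tonelli _ _ (measurableTypeR R) Omega R leb P (fun z => (k z)%:E)).
  exact/measurable_EFinP.
by move=> z; rewrite lee_fin.
Qed.

End lebesgue_lemmas.

(** * Distances and bump functions *)

Section metric_lemmas.
Context {R : realType} {E : pmetricType R}.

Lemma mdist_continuous (x0 : E) : continuous (fun x : E => mdist x0 x).
Proof.
move=> x; apply/cvgrPdist_lt => e e0.
have : \forall y \near x, mdist x y < e.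
  by apply/metricType_numDomainType.nbhs_mdistP; exists e.
apply: filterS => y xy; rewrite ltr_norml; apply/andP; split.
  by have := metric_triangle x0 x y; lra.
by have := metric_triangle x0 y x; rewrite (metric_sym y x); lra.
Qed.

Lemma closed_ge_mdist (x0 : E) (r : R) : closed [set y : E | r <= mdist x0 y].
Proof.
apply: (closed_comp (f := fun y => mdist x0 y) (D := [set t | r <= t])).
  by move=> y _; exact: mdist_continuous.
exact: closed_ge.
Qed.

Lemma open_gt_mdist (x0 : E) (r : R) : open [set y : E | r < mdist x0 y].
Proof.
apply: (open_comp (f := fun y => mdist x0 y) (D := [set t | r < t])).
  by move=> y _; exact: mdist_continuous.
exact: open_gt.
Qed.

Lemma compact_mdist_bounded (K : set E) (x0 : E) : compact K ->
  exists M : R, forall x, K x -> mdist x0 x <= M.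
Proof.
move=> cK; have : compact ((fun x : E => mdist x0 x) @` K).
  by apply: continuous_compact => //; apply: continuous_subspaceT; exact: mdist_continuous.
move=> /compact_bounded[M [_ HM]]; exists (M + 1) => x Kx.
have := HM (M + 1); rewrite ltrDl ltr01 => /(_ isT (mdist x0 x)) /=.
rewrite ger0_norm ?mdist_ge0//; apply; by exists x.
Qed.

(** Dominated convergence works along sequences, and this reduces continuity to them: a failure
    would provide points within [1 / (n + 1)] of [x] at which [h] stays away from [h x]. *)
Lemma seq_continuous_at (x : E) (h : E -> R) :
  (forall y : nat -> E, (forall n, mdist x (y n) < n.+1%:R^-1) ->
     h (y n) @[n --> \oo] --> h x) ->
  h y @[y --> x] --> h x.
Proof.
move=> H; apply/cvgrPdist_le => e e0; apply: contrapT => Hn.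
have K n : exists y, mdist x y < n.+1%:R^-1 /\ e < `|h x - h y|.
  apply: contrapT => Hy; apply: Hn; apply/metricType_numDomainType.nbhs_mdistP.
  exists n.+1%:R^-1; first by rewrite /= invr_gt0 ltr0n.
  move=> y /= xy; rewrite leNgt; apply/negP => ey; apply: Hy; by exists y.
have [y Hy] := choice K.
have /cvgrPdist_le/(_ e e0)[N _ HN] := H y (fun n => (Hy n).1).
by have := HN N (leqnn N); rewrite leNgt (Hy N).2.
Qed.

(** For [r > 0], equal to [1] up to distance [(c - 1) * r] from [x0] and to [0] from distance
    [c * r] on. Taking [c = 1] gives a peak at [x0]; [r = 1] with large [c] gives a wide plateau. *)
Definition bump (x0 : E) (c r : R) (x : E) : R :=
  Num.max 0 (Num.min 1 (c - mdist x0 x / r)).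

Lemma bump_ge0 x0 c r x : 0 <= bump x0 c r x.
Proof. by rewrite le_max lexx. Qed.

Lemma bump_le1 x0 c r x : bump x0 c r x <= 1.
Proof. by rewrite ge_max ler01 ge_min lexx. Qed.

Lemma bump_eq1 x0 c r x : 1 <= c - mdist x0 x / r -> bump x0 c r x = 1.
Proof. by move=> H; rewrite /bump min_l// max_r. Qed.

Lemma bump_eq0 x0 c r x : 0 < r -> c * r <= mdist x0 x -> bump x0 c r x = 0.
Proof.
move=> r0 H; rewrite /bump max_l//; rewrite ge_min; apply/orP; right.
by rewrite subr_le0 ler_pdivlMr.
Qed.

Lemma bump_continuous x0 c r : continuous (bump x0 c r).
Proof.
move=> x; rewrite /bump.
apply: (@continuous_max _ E (fun=> 0) (fun x => Num.min 1 (c - mdist x0 x / r))).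
  exact: cvg_cst.
apply: (@continuous_min _ E (fun=> 1) (fun x => c - mdist x0 x / r)).
  exact: cvg_cst.
apply: cvgB; first exact: cvg_cst.
by apply: cvgM; [exact: mdist_continuous|exact: cvg_cst].
Qed.

Hypothesis E_balls : forall (x : E) (r : R), compact [set y | mdist x y <= r].

Lemma bump_C0 x0 c r : 0 < r -> C0 (bump x0 c r).
Proof.
move=> r0; split; first exact: bump_continuous.
  exists 1; split => // y y1 x _ /=.
  by rewrite ger0_norm ?bump_ge0// (le_trans (bump_le1 _ _ _ _))// ltW.
move=> e e0; exists [set y | mdist x0 y <= c * r]; first exact: E_balls.
by move=> x /= /negP; rewrite -ltNge => H; rewrite bump_eq0 ?normr0// ltW.
Qed.

End metric_lemmas.

Section time_averages.
Context {R : realType} {E : pmetricType R}.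
Local Notation leb := (@lebesgue_measure R).
Local Notation D := (path_space E).

Definition path_average (a : R) (h : E -> R) (p : rc_path E) : R :=
  a^-1 * \int[leb]_(u in `[0%R, a[) h (path_at u p).

Variables (a : R) (h : E -> R).
Hypothesis a_gt0 : 0 < a.
Hypothesis mh : measurable_fun [set: borel E] (h : borel E -> R).
Hypothesis h01 : forall x, 0 <= h x <= 1.

Lemma measurable_along_path (g : R -> R) (p : rc_path E) : measurable_fun setT g ->
  measurable_fun setT (fun u => h (path_at (g u) p)).
Proof.
move=> mg; apply: (measurableT_comp mh).
exact: (measurable_path_at_time mg (measurable_cst (p : D))).
Qed.

Lemma integrable_along_path (g : R -> R) (p : rc_path E) (x y : R) :
  measurable_fun setT g -> x <= y ->
  leb.-integrable `[x, y[ (EFin \o (fun u => h (path_at (g u) p))).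
Proof.
move=> mg xy; apply: measurable_bounded_integrable => //.
- by rewrite [X in (X < _)%E](_ : _ = leb `[x, y[%classic)// lebesgue_co// ltry.
- by apply: measurable_funTS; exact: measurable_along_path.
- exists 1; split => // M M1 u _ /=; have /andP[h0 h1] := h01 (path_at (g u) p).
  by rewrite ger0_norm// (le_trans h1)// ltW.
Qed.

Lemma integral_along_path_bounds (g : R -> R) (p : rc_path E) (x y : R) :
  measurable_fun setT g -> x <= y ->
  0 <= \int[leb]_(u in `[x, y[) h (path_at (g u) p) <= y - x.
Proof.
move=> mg xy; apply/andP; split.
  by apply: Rintegral_ge0 => u _; have /andP[] := h01 (path_at (g u) p).
apply: (le_trans (ler_norm _)).
have := @Rintegral_finite_bound R `[x, y[%classic (fun u => h (path_at (g u) p)) 1.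
rewrite lebesgue_co//= mul1r; apply => //; first exact: ltry.
  by apply: measurable_funTS; exact: measurable_along_path.
by move=> u _; have /andP[h0 h1] := h01 (path_at (g u) p); rewrite ger0_norm.
Qed.

Lemma path_average_bounds (p : rc_path E) : 0 <= path_average a h p <= 1.
Proof.
have /andP[i0 i1] := integral_along_path_bounds p (@measurable_id _ _ setT) (ltW a_gt0).
have ai : 0 <= a^-1 by rewrite invr_ge0 ltW.
rewrite /path_average mulr_ge0//=.
by rewrite mulrC ler_pdivrMr// mul1r (le_trans i1)// subr0.
Qed.

Lemma bounded_measurable_path_average :
  bounded_measurable (path_average a h : D -> R).
Proof.
split; last first.
  by exists 1 => p; have /andP[? ?] := path_average_bounds p; rewrite ger0_norm.
apply: measurable_funM; first exact: measurable_cst.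
pose k (z : D * R) : R := \1_(`[0%R, a[%classic) z.2 * h (path_at z.2 z.1).
have -> : (fun p : D => \int[leb]_(u in `[0%R, a[) h (path_at u p)) =
          (fun p => \int[leb]_u k (p, u)).
  apply/funext => p; rewrite Rintegral_mkcond; apply: eq_Rintegral => u _.
  by rewrite /patch /k/= indicE; case: ifPn => _; rewrite ?mul1r ?mul0r.
apply: measurable_Rintegral; apply: measurable_funM.
  by apply: measurableT_comp => //; exact: measurable_indic.
apply: (measurableT_comp mh).
exact: (measurable_path_at_time (@measurable_snd _ _ _ _) (@measurable_fst _ _ _ _)).
Qed.

(** The window moves from [[0, a[] to [[t, t + a[] and loses at most the contribution of [[0, t[],
    where [h <= 1]. As the bound holds path by path, it applies to a random [t]. *)
Lemma path_average_shift (t : R) (p : rc_path E) : 0 <= t ->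
  path_average a h p - t / a <= path_average a h (path_shift t p).
Proof.
move=> t0; rewrite /path_average [t / a]mulrC -mulrBr ler_pM2l ?invr_gt0//.
have mid := @measurable_id _ (measurableTypeR R) setT.
have mt : measurable_fun setT (fun u : R => t + u).
  by apply: measurable_funD => //; exact: measurable_cst.
have -> : \int[leb]_(u in `[0%R, a[) h (path_at u (path_shift t p)) =
    \int[leb]_(u in `[t, t + a[) h (path_at u p).
  rewrite (@Rintegral_translation R (- t) _ `[t, (t + a)[%classic)//; last first.
    by apply: measurable_funTS; exact: (measurable_along_path p mid).
  have -> : [set u | `[t, (t + a)[%classic (u - - t)] = `[0, a[%classic.
    by apply/seteqP; split => u /=; rewrite !in_itv/= opprK -lerBlDr subrr (addrC u) ltrD2l.
  apply: eq_Rintegral => u; rewrite inE/= in_itv/= => /andP[u0 _].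
  by rewrite path_shiftE// opprK addrC.
have ta : 0 <= t + a by rewrite addr_ge0// ltW.
have part (y z w : R) : y <= z -> z <= w ->
    \int[leb]_(u in `[y, w[) h (path_at u p) =
    \int[leb]_(u in `[y, z[) h (path_at u p) + \int[leb]_(u in `[z, w[) h (path_at u p).
  move=> yz zw; have -> : `[y, w[%classic = `[y, z[%classic `|` `[z, w[%classic.
    apply/seteqP; split => u /=; rewrite !in_itv/=.
      by move=> /andP[-> ->]; rewrite andbT/=; case: (ltP u z); [left|right].
    by move=> [/andP[-> /lt_le_trans->]//|/andP[/(le_trans yz)-> ->]].
  rewrite Rintegral_setU//.
    rewrite (_ : _ `|` _ = `[y, w[%classic).
      by apply: (integrable_along_path p mid); exact: le_trans zw.
    apply/seteqP; split => u /=; rewrite !in_itv/=.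
      by move=> [/andP[-> /lt_le_trans->]//|/andP[/(le_trans yz)-> ->]].
    by move=> /andP[-> ->]; rewrite andbT/=; case: (ltP u z); [left|right].
  apply/disj_setPS => u /=; rewrite !in_itv/= => -[/andP[_ uz] /andP[zu _]].
  by move: uz; rewrite ltNge zu.
have e1 := part 0 a (t + a) (ltW a_gt0); rewrite lerDr in e1.
have e2 := part 0 t (t + a) t0; rewrite lerDl in e2.
have /andP[p0 _] : 0 <= \int[leb]_(u in `[a, t + a[) h (path_at u p) <= t + a - a.
  by apply: (integral_along_path_bounds p mid); rewrite lerDr.
have /andP[_ q0] := integral_along_path_bounds p mid t0.
rewrite lerBlDl; apply: (@le_trans _ _ (\int[leb]_(u in `[0, t + a[) h (path_at u p))).
  by rewrite e1// lerDl.
by rewrite (e2 (ltW a_gt0)) lerD2r; move: q0; rewrite subr0.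
Qed.

End time_averages.

Section joint_path_mean.
Context {R : realType} {E : pmetricType R} {d : measure_display}
  {Omega : measurableType d}.
Context {Filt : R -> set (set Omega)} {X : R -> Omega -> E}
  {P : E -> probability Omega R}.
Hypothesis std : standard_Markov_process Filt X P.
Local Notation D := (path_space E).

(** Fubini's theorem over time and outcomes needs measurability in the time parameter and the
    starting point jointly; on rectangles the two variables separate. *)
Lemma measurable_joint_path_mean (Z : R * D -> R) : bounded_measurable Z ->
  measurable_fun [set: R * borel E]
    (fun z => path_mean std (fun p => Z (z.1, p)) (z.2 : E)).
Proof.
have sec (W : R * D -> R) u : bounded_measurable W ->
    bounded_measurable (fun p : D => W (u, p)).
  move=> [mW [M WM]]; split; last by exists M.
  by apply: (measurableT_comp mW); exact: measurable_fun_pair.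
pose Q (Z : R * D -> R) := measurable_fun [set: R * borel E]
    (fun z => path_mean std (fun p => Z (z.1, p)) (z.2 : E)).
apply: (@functional_monotone_class _ (R * D)%type R Q _ _
  [set A `*` B | A in (@measurable _ R) & B in (@measurable _ D)]).
- move=> a V W bV bW QV QW.
  rewrite /Q (_ : (fun z => _) = (fun z : R * borel E =>
    a * path_mean std (fun p => V (z.1, p)) (z.2 : E) +
    path_mean std (fun p => W (z.1, p)) (z.2 : E))).
    by apply: measurable_funD => //; apply: measurable_funM.
  apply/funext => z; rewrite /path_mean meanD ?meanZ//.
  + exact: (bounded_measurable_trajectory std (sec V z.1 bV)).
  + apply: bounded_measurableZ.
    exact: (bounded_measurable_trajectory std (sec V z.1 bV)).
  + exact: (bounded_measurable_trajectory std (sec W z.1 bW)).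
- move=> Zn V M bZn QZn ZnM bV cV.
  apply: (@measurable_fun_cvg _ _ R setT (fun n (z : R * borel E) =>
    path_mean std (fun p => Zn n (z.1, p)) (z.2 : E))) => // z _.
  apply: (@mean_cvg _ _ _ _ _ _ M).
  + by move=> n; have [] := bounded_measurable_trajectory std (sec (Zn n) z.1 (bZn n)).
  + by move=> n w; exact: ZnM.
  + by apply: aeW => w; exact: cV.
  + by have [] := bounded_measurable_trajectory std (sec V z.1 bV).
- exact: measurable_prod_measurableType.
- move=> _ _ [A mA [B mB <-]] [A' mA' [B' mB' <-]].
  exists (A `&` A'); first exact: measurableI.
  exists (B `&` B'); first exact: measurableI.
  by apply/seteqP; split => -[u p] /= [[? ?] [? ?]].
- rewrite /Q (_ : (fun z => _) = cst 1); first exact: measurable_cst.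
  by apply/funext => z; rewrite /path_mean mean_cst.
- move=> _ [A mA [B mB <-]].
  rewrite /Q (_ : (fun z => _) = (fun z : R * borel E =>
    \1_A z.1 * path_mean std (\1_B) (z.2 : E))).
    apply: measurable_funM; first by apply: measurableT_comp => //; exact: measurable_indic.
    have bB := bounded_measurable_path_mean std (bounded_measurable_indic mB).
    by apply: (measurableT_comp bB.1).
  apply/funext => z; rewrite /path_mean -meanZ.
    by apply: eq_Rintegral => w _; rewrite !indicE in_setX/= -natrM mulnb.
  by apply: (bounded_measurable_trajectory std); exact: bounded_measurable_indic.
Qed.

End joint_path_mean.

(** * The smoothing operators *)

Section smoothing.
Context {R : realType} {E : pmetricType R} {d : measure_display}
  {Omega : measurableType d}.
Context {Filt : R -> set (set Omega)} {X : R -> Omega -> E}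
  {P : E -> probability Omega R}.
Hypothesis std : standard_Markov_process Filt X P.
Local Notation D := (path_space E).
Local Notation leb := (@lebesgue_measure R).

(** The average [A_a h], written as a mean over paths so that pathwise bounds integrate at once;
    [smoothedE] is the semigroup form. *)
Definition smoothed (a : R) (h : E -> R) (x : E) : R :=
  path_mean std (path_average a h) x.

Lemma path_mean_transition (h : E -> R) (u : R) (x : E) : 0 <= u ->
  path_mean std (fun p => h (path_at u p)) x = transition X P u h x.
Proof.
by move=> u0; rewrite transitionE; apply: eq_Rintegral => w _; rewrite trajectoryE.
Qed.

Section one_function.
Variables (a : R) (h : E -> R).
Hypothesis a_gt0 : 0 < a.
Hypothesis mh : measurable_fun [set: borel E] (h : borel E -> R).
Hypothesis h01 : forall x, 0 <= h x <= 1.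

Lemma bounded_measurable_h : bounded_measurable (h : borel E -> R).
Proof.
by split => //; exists 1 => x; have /andP[? ?] := h01 x; rewrite ger0_norm.
Qed.

Lemma smoothed_bounds x : 0 <= smoothed a h x <= 1.
Proof.
have H p : 0 <= path_average a h p <= 1 by exact: path_average_bounds.
apply/andP; split.
  by apply: mean_ge0 => w; have /andP[] := H (trajectory std w).
apply: (le_trans (ler_norm _)); apply: bounded_path_mean.
  exact: (bounded_measurable_path_average a_gt0 mh h01).1.
by move=> p; have /andP[? ?] := H p; rewrite ger0_norm.
Qed.

Lemma bounded_measurable_smoothed : bounded_measurable (smoothed a h : borel E -> R).
Proof.
apply: bounded_measurable_path_mean; exact: bounded_measurable_path_average.
Qed.

Lemma mean_path_average (psi : Omega -> D) (x : E) : measurable_fun setT psi ->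
  \int[P x]_w path_average a h (psi w) =
  a^-1 * \int[leb]_(u in `[0%R, a[) \int[P x]_w h (path_at u (psi w)).
Proof.
move=> mpsi; pose g (z : R * Omega) := h (path_at z.1 (psi z.2)).
have mg : measurable_fun setT g.
  apply: (measurableT_comp mh); apply: measurable_path_at_time => //.
  by apply: (measurableT_comp mpsi).
rewrite /path_average -(@mean_Rintegral R _ Omega (P x) g a (ltW a_gt0) mg) //; last first.
  by move=> z; exact: h01.
have bI : bounded_measurable (fun w => a * path_average a h (psi w)).
  apply: bounded_measurableZ.
  exact: (bounded_measurable_comp (bounded_measurable_path_average a_gt0 mh h01) mpsi).
rewrite -meanZ.
  by apply: eq_Rintegral.
rewrite (_ : (fun w => _) = (fun w => a * path_average a h (psi w)))//.
by apply/funext => w; rewrite /path_average mulVKf// gt_eqF.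
Qed.

Lemma smoothedE x :
  smoothed a h x = a^-1 * \int[leb]_(u in `[0%R, a[) transition X P u h x.
Proof.
rewrite /smoothed /path_mean mean_path_average; last exact: measurable_trajectory.
congr (_ * _); apply: eq_Rintegral => u; rewrite inE/= in_itv/= => /andP[u0 _].
exact: path_mean_transition.
Qed.

Lemma measurable_path_mean_time (x : E) :
  measurable_fun setT (fun u => path_mean std (fun p => h (path_at u p)) x).
Proof.
have bZ : bounded_measurable (fun z : R * D => h (path_at z.1 z.2)).
  split; last by exists 1 => z; have /andP[? ?] := h01 (path_at z.1 z.2); rewrite ger0_norm.
  by apply: (measurableT_comp mh); exact: measurable_path_eval.
apply: (measurableT_comp (measurable_joint_path_mean std bZ)
  (g := fun u : R => (u, x : borel E))).
by apply: measurable_fun_pair => //; exact: measurable_cst.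
Qed.

(** By the strong Markov property at each lag [u] and Fubini's theorem, the right side is the mean
    of [path_average] along the path shifted by [tau]; the pathwise [path_average_shift] does the
    rest. *)
Lemma le_smoothed_stopping (tau : Omega -> \bar R) (T : R) (x : E) :
  stopping_time Filt tau -> (forall w, (tau w <= T%:E)%E) ->
  smoothed a h x - T / a <= \int[P x]_w smoothed a h (X (fine (tau w)) w).
Proof.
move=> stau tauT.
have tau0 w : (0 <= tau w)%E by case: stau.
have tau_fin w : tau w \is a fin_num.
  by rewrite ge0_fin_numE// (le_lt_trans (tauT w))// ltry.
have ft0 w : 0 <= fine (tau w) by rewrite fine_ge0.
have ftT w : fine (tau w) <= T by rewrite -lee_fin fineK.
have mft : measurable_fun setT (fine \o tau).
  by apply: measurableT_comp; [exact: fine_measurable|exact: (measurable_stopping_time std)].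
pose psi w : D := path_shift (fine (tau w)) (trajectory std w).
have mpsi : measurable_fun setT psi.
  apply: measurable_to_path => u.
  rewrite (_ : _ \o psi = fun w => path_at (fine (tau w) + Num.max u 0) (trajectory std w)).
    apply: measurable_path_at_time; last exact: measurable_trajectory.
    by apply: measurable_funD => //; exact: measurable_cst.
  by apply/funext => w /=; rewrite path_shift_maxE.
have mXtau : measurable_fun setT (fun w => X (fine (tau w)) w : borel E).
  rewrite (_ : (fun w => _) = fun w => path_at (fine (tau w)) (trajectory std w)).
    by apply: measurable_path_at_time => //; exact: measurable_trajectory.
  by apply/funext => w; rewrite trajectoryE.
have bavg := bounded_measurable_path_average a_gt0 mh h01.
have -> : \int[P x]_w smoothed a h (X (fine (tau w)) w) = \int[P x]_w path_average a h (psi w).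
  rewrite mean_path_average//.
  (* Written as a path mean, [P_u h] is jointly measurable in [u] and the state, over all real
     [u]. *)
  pose g (z : R * Omega) := path_mean std (fun p => h (path_at z.1 p)) (X (fine (tau z.2)) z.2).
  have bZ : bounded_measurable (fun z : R * D => h (path_at z.1 z.2)).
    split; last by exists 1 => z; have /andP[? ?] := h01 (path_at z.1 z.2); rewrite ger0_norm.
    by apply: (measurableT_comp mh); exact: measurable_path_eval.
  have mg : measurable_fun setT g.
    apply: (measurableT_comp (measurable_joint_path_mean std bZ)
      (g := fun z : R * Omega => (z.1, X (fine (tau z.2)) z.2 : borel E))).
    by apply: measurable_fun_pair => //; apply: (measurableT_comp mXtau).
  have g01 z : 0 <= g z <= 1.
    have mZ : measurable_fun setT (fun p : D => h (path_at z.1 p)).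
      by apply: (measurableT_comp mh); exact: measurable_path_at.
    apply/andP; split.
      by apply: mean_ge0 => w; have /andP[] := h01 (path_at z.1 (trajectory std w)).
    apply: (le_trans (ler_norm _)); apply: bounded_path_mean => // p.
    by have /andP[? ?] := h01 (path_at z.1 p); rewrite ger0_norm.
  transitivity (\int[P x]_w (a^-1 * \int[leb]_(u in `[0%R, a[) g (u, w))).
    apply: eq_Rintegral => w _; rewrite smoothedE; congr (_ * _).
    apply: eq_Rintegral => u; rewrite inE/= in_itv/= => /andP[u0 _].
    by rewrite /g path_mean_transition.
  rewrite meanZ; last first.
    rewrite (_ : (fun w => _) = (fun w => a * smoothed a h (X (fine (tau w)) w))).
      by apply: bounded_measurableZ; exact: (bounded_measurable_comp bounded_measurable_smoothed mXtau).
    apply/funext => w; rewrite smoothedE mulVKf ?gt_eqF//.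
    apply: eq_Rintegral => u; rewrite inE/= in_itv/= => /andP[u0 _].
    by rewrite /g path_mean_transition.
  congr (_ * _); rewrite (mean_Rintegral _ (ltW a_gt0))//.
  apply: eq_Rintegral => u; rewrite inE/= in_itv/= => /andP[u0 _].
  rewrite /g; under eq_Rintegral do rewrite /= path_mean_transition//.
  rewrite -(strong_Markov_mean std x stau tau_fin u0 bounded_measurable_h).
  by apply: eq_Rintegral => w _; rewrite path_shiftE// trajectoryE// addr_ge0.
rewrite -[T / a](mean_cst (P x)) /smoothed /path_mean -meanB; last 2 first.
- exact: (bounded_measurable_trajectory std bavg).
- exact: bounded_measurable_cst.
apply: le_mean.
- apply: bounded_measurableB; first exact: (bounded_measurable_trajectory std bavg).
  exact: bounded_measurable_cst.
- exact: (bounded_measurable_comp bavg mpsi).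
- move=> w; apply: le_trans (path_average_shift a_gt0 mh h01 (trajectory std w) (ft0 w)).
  by rewrite lerD2l lerN2 ler_pM2r ?invr_gt0.
Qed.

End one_function.

(** Right-continuity at time [0] makes the average over a short window converge to [h (X 0)] on
    every path. *)
Lemma smoothed_small_time (h : E -> R) (x : E) : continuous h ->
  (forall x, 0 <= h x <= 1) ->
  smoothed n.+1%:R^-1 h x @[n --> \oo] --> h x.
Proof.
move=> ch h01; have mh := continuous_borel ch.
have n0 n : 0 < n.+1%:R^-1 :> R by rewrite invr_gt0 ltr0n.
have bh := bounded_measurable_h mh h01.
rewrite -[X in _ --> X](mean_start std x bh).
apply: (@mean_cvg _ _ _ _ _ _ 1).
- move=> n; have [] // := bounded_measurable_trajectory std
    (bounded_measurable_path_average (n0 n) mh h01).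
- by move=> n w; have /andP[? ?] := path_average_bounds (n0 n) mh h01 (trajectory std w); rewrite ger0_norm.
- apply: aeW => w; rewrite -(trajectoryE std w (lexx 0)).
  set p := trajectory std w; apply/cvgrPdist_le => e e0.
  have nh : nbhs (path_at 0 p) [set y | `|h (path_at 0 p) - h y| <= e].
    by have /cvgrPdist_le/(_ e e0) := ch (path_at 0 p).
  have [dl dl0 Hdl] := path_at_right nh.
  near=> n; have adl : n.+1%:R^-1 < dl.
    by near: n; exact: near_infty_natSinv_lt (PosNum dl0).
  set a := n.+1%:R^-1; have a0 : 0 < a by exact: n0.
  have mid := @measurable_id _ (measurableTypeR R) setT.
  have int_cst := integrable_cst_co (h (path_at 0 p)) (ltW a0).
  have -> : h (path_at 0 p) - path_average a h p =
      a^-1 * \int[leb]_(u in `[0, a[) (h (path_at 0 p) - h (path_at u p)).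
    rewrite RintegralB//; last first.
      exact: (integrable_along_path mh h01 p mid (ltW a0)).
    rewrite Rintegral_cst// [X in _ * fine X](_ : _ = leb `[0, a[%classic)//.
    rewrite lebesgue_co ?(ltW a0)//= subr0 mulrBr mulrCA mulVf ?mulr1// gt_eqF//.
  rewrite normrM ger0_norm ?invr_ge0 ?(ltW a0)// mulrC ler_pdivrMr//.
  have := @Rintegral_finite_bound R `[0, a[%classic (fun u => h (path_at 0 p) - h (path_at u p)) e.
  rewrite lebesgue_co ?(ltW a0)//= subr0; apply => //; first exact: ltry.
    apply: measurable_funTS; apply: measurable_funB; first exact: measurable_cst.
    exact: (measurable_along_path mh p mid).
  move=> u; rewrite in_itv/= => /andP[u0 ua]; apply: Hdl.
  by rewrite u0/= add0r (lt_trans ua).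
- exact: (bounded_measurable_comp bh (measurable_X std (lexx 0))).1.
Unshelve. all: by end_near. Qed.

Hypothesis X_weakly_Feller : weakly_Feller X P.
Hypothesis E_balls : forall (x : E) (r : R), compact [set y | mdist x y <= r].

Lemma smoothed_C0 (a : R) (h : E -> R) : 0 < a -> C0 h ->
  (forall x, 0 <= h x <= 1) -> C0 (smoothed a h).
Proof.
move=> a0 h0 h01; have [ch _ _] := h0.
have mh := continuous_borel ch.
have C0t u : 0 <= u -> C0 (transition X P u h) by move=> u0; exact: X_weakly_Feller.
have E1 x : smoothed a h x =
    a^-1 * \int[leb]_(u in `[0%R, a[) path_mean std (fun p => h (path_at u p)) x.
  rewrite smoothedE//; congr (_ * _); apply: eq_Rintegral => u.
  by rewrite inE/= in_itv/= => /andP[u0 _]; rewrite path_mean_transition.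
have int1 := integrable_cst_co 1 (ltW a0).
have bnd u x : `|path_mean std (fun p => h (path_at u p)) x| <= 1.
  apply: bounded_path_mean; last by move=> p; have /andP[? ?] := h01 (path_at u p); rewrite ger0_norm.
  by apply: (measurableT_comp mh); exact: measurable_path_at.
(* One dominated convergence serves both properties: [l] is the transition mean at the limit point
   for continuity, and [0] for decay at infinity. *)
have key (y : nat -> E) (l : R -> R) : measurable_fun setT l ->
    (forall u, 0 <= u -> transition X P u h (y n) @[n --> \oo] --> l u) ->
    smoothed a h (y n) @[n --> \oo] --> a^-1 * \int[leb]_(u in `[0%R, a[) l u.
  move=> ml cl; under eq_fun do rewrite E1.
  apply: cvgM; first exact: cvg_cst.
  apply: (@Rintegral_dominated R _ (measurableTypeR R) leb `[0, a[%classic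
    (fun n u => path_mean std (fun p => h (path_at u p)) (y n)) l (cst 1)) => //.
  - by move=> n; apply: measurable_funTS; exact: measurable_path_mean_time.
  - exact: measurable_funTS.
  - move=> u /=; rewrite in_itv/= => /andP[u0 _].
    by under eq_fun do rewrite path_mean_transition//; exact: cl.
split.
- move=> x; apply: seq_continuous_at => y yx.
  rewrite -[X in _ --> X]/(smoothed a h x) E1; apply: key; first exact: measurable_path_mean_time.
  move=> u u0; rewrite path_mean_transition//.
  have [ct _ _] := C0t u u0.
  apply: (@cvg_comp _ _ _ y (transition X P u h) _ (nbhs x)); last exact: ct.
  apply/metricType_numDomainType.cvgrPdist_lt => e e0; near=> n.
  rewrite (lt_trans (yx n))//; near: n; exact: near_infty_natSinv_lt (PosNum e0).
- exists 1; split => // M M1 x _ /=; have /andP[s0 s1] := smoothed_bounds a0 mh h01 x.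
  by rewrite ger0_norm// (le_trans s1)// ltW.
- move=> e e0; apply: contrapT => Hn.
  (* Without decay there are points leaving every ball at which the average is at least [e]. *)
  have K (n : nat) : exists y, n%:R < mdist point y /\ e <= smoothed a h y.
    apply: contrapT => Hy; apply: Hn; exists [set y | mdist point y <= n%:R]; first exact: E_balls.
    move=> y /= /negP; rewrite -ltNge => ny.
    have /andP[s0 _] := smoothed_bounds a0 mh h01 y.
    rewrite ger0_norm// ltNge; apply/negP => ey; apply: Hy; by exists y.
  have [y Hy] := choice K.
  have : smoothed a h (y n) @[n --> \oo] --> a^-1 * \int[leb]_(u in `[0%R, a[) (cst 0) u.
    apply: key; first exact: measurable_cst.
    move=> u u0; apply/cvgrPdist_lt => e' e'0.
    have [_ _ /(_ e' e'0)[K' cK' HK']] := C0t u u0.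
    have [M HM] := compact_mdist_bounded point cK'.
    near=> n; rewrite sub0r normrN; apply: HK' => /HM.
    apply/negP; rewrite -ltNge; apply: lt_trans (Hy n).1.
    near: n; exact: nbhs_infty_gtr.
  rewrite Rintegral_cst// mul0r mulr0 => /cvgrPdist_lt /(_ e e0)[N _ HN].
  have := HN N (leqnn N); rewrite /= sub0r normrN ger0_norm.
    by rewrite ltNge (Hy N).2.
  by have /andP[] := smoothed_bounds a0 mh h01 (y N).
Unshelve. all: by end_near. Qed.

End smoothing.

(** * Maximal estimates *)

Section finitely_additive.
Context {d : measure_display} {T : measurableType d} {R : realType}.
Variable m : set T -> R.
Hypothesis m_set0 : m set0 = 0.
Hypothesis m_le1 : forall B, measurable B -> m B <= 1.
Hypothesis m_setU : forall B C, measurable B -> measurable C ->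
  m (B `|` C) + m (B `&` C) = m B + m C.
Hypothesis m_ge0 : forall B, measurable B -> 0 <= m B.
Variables (A : nat -> set T) (c : R).
Hypothesis c_gt0 : 0 < c.
Hypothesis mA : forall k, measurable (A k).
Hypothesis A_large : forall k, c <= m (A k).

Let recurrent (B : set T) : Prop := measurable B /\
  exists2 b : R, 0 < b & forall N, exists2 k, (N <= k)%N & b <= m (B `&` A k).

(* Otherwise the traces of the [A k] on [B] would contain arbitrarily many
   almost disjoint sets of mass bounded below. *)
Let recurrent_step (B : set T) (N : nat) : recurrent B ->
  exists2 k, (N <= k)%N & recurrent (B `&` A k).
Proof.
move=> [mB [b b0 HB]]; apply: contrapT => Hn.
(* When no [k] qualifies, the trace of each [A k] on [B] has eventually negligible overlap with the
   later sets. *)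
have tail k : (N <= k)%N -> forall e : R, 0 < e ->
    exists N', forall k', (N' <= k')%N -> m (B `&` A k `&` A k') < e.
  move=> Nk e e0; apply: contrapT => He; apply: Hn; exists k => //.
  split; first exact: measurableI.
  exists e => // N'; apply: contrapT => Hk; apply: He; exists N' => k' Nk'.
  by rewrite ltNge; apply/negP => ek; apply: Hk; exists k'.
(* Each new set has trace at least [b] on [B] and overlap below [b / 2] with the union so far, so
   the mass of [U] in [B] grows by [b / 2] at a time. *)
have grow (j : nat) : exists U, [/\ measurable U, j%:R * (b / 2) <= m (B `&` U) &
    forall e : R, 0 < e -> exists N', forall k', (N' <= k')%N -> m (B `&` U `&` A k') < e].
  elim: j => [|j [U [mU Uj Ue]]].
    exists set0; split => //; first by rewrite mul0r setI0 m_set0.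
    by move=> e e0; exists 0%N => k' _; rewrite setI0 set0I m_set0.
  have b2 : 0 < b / 2 by rewrite divr_gt0.
  have [N' HN'] := Ue _ b2.
  have [k kN bk] := HB (maxn N N').
  have Nk : (N <= k)%N by rewrite (leq_trans (leq_maxl N N')).
  have N'k : (N' <= k)%N by rewrite (leq_trans (leq_maxr N N')).
  exists (U `|` A k); split; first exact: measurableU.
    have := m_setU (measurableI _ _ mB mU) (measurableI _ _ mB (mA k)).
    rewrite -setIUr setIACA setIid setIA => E.
    have := HN' k N'k; rewrite -(natr1 j) mulrDl mul1r.
    move: E Uj bk; move: (m (B `&` (U `|` A k))) (m (B `&` U `&` A k)) (m (B `&` U)) (m (B `&` A k)) (j%:R * (b/2)).
    by move=> v1 v2 v3 v4 v5; lra.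
  move=> e e0; have e2 : 0 < e / 2 by rewrite divr_gt0.
  have [N1 H1] := Ue _ e2; have [N2 H2] := tail k Nk _ e2.
  exists (maxn N1 N2) => k' Nk'.
  have N1k' : (N1 <= k')%N by rewrite (leq_trans (leq_maxl N1 N2)).
  have N2k' : (N2 <= k')%N by rewrite (leq_trans (leq_maxr N1 N2)).
  have mBU := measurableI _ _ (measurableI _ _ mB mU) (mA k').
  have mBA := measurableI _ _ (measurableI _ _ mB (mA k)) (mA k').
  have := m_setU mBU mBA; have := m_ge0 (measurableI _ _ mBU mBA).
  rewrite -setIUl -setIUr => h0 hE; have := H1 k' N1k'; have := H2 k' N2k'.
  move: h0 hE; move: (m (B `&` (U `|` A k) `&` A k')) (m (B `&` U `&` A k')) (m (B `&` A k `&` A k')).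
  move: (m (B `&` U `&` A k' `&` (B `&` A k `&` A k'))).
  by move=> v1 v2 v3 v4; lra.
have b2 : 0 < b / 2 by rewrite divr_gt0.
have [U [mU Uj _]] := grow (Num.truncn (b / 2)^-1).+1.
have := le_trans Uj (m_le1 (measurableI _ _ mB mU)).
rewrite leNgt => /negP; apply; rewrite -ltr_pdivrMr// mul1r.
exact: truncnS_gt.
Qed.

(** Each intersection is kept recurrent, so its trace on a further set has positive mass and is
    nonempty. Finite additivity yields a point for finitely many sets at once only, which is why [y]
    depends on [j]. *)
Lemma finitely_additive_subsequence : exists k : nat -> nat,
  [/\ forall j, (j <= k j)%N & forall j, exists y, forall i, (i <= j)%N -> A (k i) y].
Proof.
have H (z : set T * nat) : exists k, recurrent z.1 ->
    (z.2 <= k)%N /\ recurrent (z.1 `&` A k).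
  have [rz|nrz] := pselect (recurrent z.1); last by exists 0%N.
  by have [k zk rk] := recurrent_step z.2 rz; exists k.
have [kap Hkap] := choice H.
(* The current intersection, together with a lower bound for the next index. *)
pose s := fix s (j : nat) : set T * nat :=
  if j is j'.+1 then ((s j').1 `&` A (kap (s j')), (kap (s j')).+1) else (setT, 0%N).
have rs j : recurrent (s j).1.
  elim: j => [|j IH] /=; last by have [] := Hkap _ IH.
  by split => //; exists c => // N; exists N => //; rewrite setTI.
have sj j : (j <= (s j).2)%N.
  elim: j => [|j IH] //=; rewrite ltnS (leq_trans IH)//.
  by have [] := Hkap _ (rs j).
exists (fun j => kap (s j)); split.
  by move=> j; rewrite (leq_trans (sj j))//; have [] := Hkap _ (rs j).
move=> j; have [_ [b b0 Hb]] := rs j.+1; have [k _ bk] := Hb 0%N.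
have /set0P[y [sy _]] : (s j.+1).1 `&` A k != set0.
  by apply/eqP => E; move: bk; rewrite E m_set0 leNgt b0.
exists y => i ij; suff : (s i.+1).1 y by move=> [].
elim: j ij sy {bk b0 Hb} => [|j IH] ij sy.
  by move: ij; rewrite leqn0 => /eqP ->.
by move: ij; rewrite leq_eqVlt => /predU1P[->//|]; rewrite ltnS => /IH; apply; case: sy.
Qed.

End finitely_additive.

Lemma fmap_ultra (T V : Type) (f : T -> V) (U : set_system T) :
  UltraFilter U -> UltraFilter (f x @[x --> U]).
Proof.
move=> UU; have UF : ProperFilter U := @ultra_proper _ _ UU.
apply: Build_UltraFilter => G GF UG; apply/seteqP; split => // B GB.
have [//|nB] := in_ultra_setVsetC (f @^-1` B) UU.
have /filterI/(_ GB) : G (~` B) by apply: UG.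
by rewrite setICl => /filter_not_empty.
Qed.

Section limit_content.
Context {d : measure_display} {T : measurableType d} {R : realType}.

(* An ultrafilter limit of the laws is only finitely additive, but this is
   enough to find points lying in many of the sets. *)
Lemma content_subsequence (mu : nat -> set T -> R) (A : nat -> set T) (c : R) :
  (forall n, mu n set0 = 0) ->
  (forall n B, measurable B -> 0 <= mu n B <= 1) ->
  (forall n B C, measurable B -> measurable C ->
     mu n (B `|` C) + mu n (B `&` C) = mu n B + mu n C) ->
  0 < c -> (forall k, measurable (A k)) ->
  (forall k, \forall n \near \oo, c <= mu n (A k)) ->
  exists k : nat -> nat,
  [/\ forall j, (j <= k j)%N & forall j, exists y, forall i, (i <= j)%N -> A (k i) y].
Proof.
move=> mu0 mu01 muU c0 mA muA.
have [U [UU oU]] := @ultraFilterLemma nat \oo _.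
have UF : ProperFilter U := @ultra_proper _ _ UU.
(* Limits along an ultrafilter exist by compactness of the unit interval; non-measurable sets get
   the dummy value [0] so that [choice] applies. *)
have lim_ex (B : set T) : exists l : R, measurable B -> mu n B @[n --> U] --> l.
  have [mB|nmB] := pselect (measurable B); last by exists 0.
  have : compact `[0 : R, 1] by exact: segment_compact.
  rewrite compact_ultra => /(_ (mu n B @[n --> U]) (fmap_ultra _ UU))[].
    by apply: nearW => n /=; rewrite in_itv/= mu01.
  by move=> l [_ Hl]; exists l.
have [m Hm] := choice lim_ex.
apply: (@finitely_additive_subsequence _ T R m _ _ _ _ A c) => //.
- have := Hm _ measurable0; under eq_fun do rewrite mu0; move=> H.
  have H0 : 0 @[_ --> U] --> (0 : R) by exact: cvg_cst.
  exact: (cvg_unique _ H H0).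
- move=> B mB; apply: (cvgr_to_le (Hm _ mB)).
  by apply: nearW => n; have /andP[] := mu01 n B mB.
- move=> B C mB mC.
  have h1 : (mu n (B `|` C) + mu n (B `&` C)) @[n --> U] --> m (B `|` C) + m (B `&` C).
    by apply: cvgD; apply: Hm; [exact: measurableU|exact: measurableI].
  have h2 : (mu n B + mu n C) @[n --> U] --> m B + m C by apply: cvgD; exact: Hm.
  have BC : (fun n => mu n (B `|` C) + mu n (B `&` C)) = (fun n => mu n B + mu n C).
    by apply/funext => n; exact: muU.
  by rewrite BC in h1; exact: (cvg_unique _ h1 h2).
- move=> B mB; apply: (cvgr_to_ge (Hm _ mB)).
  by apply: nearW => n; have /andP[] := mu01 n B mB.
- move=> k; apply: (cvgr_to_ge (Hm _ (mA k))).
  by apply: oU; exact: muA.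
Qed.

(** The points [y j] lie in the compact [A (k 0)] and cluster at some [z]; the closed set [A (k N)]
    contains all [y j] with [j >= N], hence [z], and [k N >= N]. *)
Lemma compact_subsequence (V : topologicalType) (A : nat -> set V) (k : nat -> nat) :
  (forall n, compact (A n)) -> (forall n, closed (A n)) ->
  (forall j, (j <= k j)%N) ->
  (forall j, exists y, forall i, (i <= j)%N -> A (k i) y) ->
  exists y, forall N, exists2 n, (N <= n)%N & A n y.
Proof.
move=> cA clA kj Hy; have [y Hyj] := choice Hy.
have : (y j @[j --> \oo]) (A (k 0%N)) by exists 0%N => // j _; exact: Hyj.
move=> /(cA (k 0%N))[z [_ cz]]; exists z => N; exists (k N) => //.
rewrite ((closure_id _).1 (clA (k N))) => B nB.
have : (y j @[j --> \oo]) (A (k N)) by exists N => // j /= Nj; exact: Hyj.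
by move=> /cz /(_ nB) [v []]; exists v.
Qed.

End limit_content.

Section maximal_estimates.
Context {R : realType} {E : pmetricType R} {d : measure_display}
  {Omega : measurableType d}.
Context {Filt : R -> set (set Omega)} {X : R -> Omega -> E}
  {P : E -> probability Omega R}.
Hypothesis std : standard_Markov_process Filt X P.
Hypothesis X_weakly_Feller : weakly_Feller X P.
Hypothesis E_balls : forall (x : E) (r : R), compact [set y | mdist x y <= r].
Local Notation D := (path_space E).
Local Notation prob x A := (fine (P x A)).

Lemma prob_bounds x (A : set Omega) : measurable A -> 0 <= prob x A <= 1.
Proof.
move=> mA; rewrite fine_ge0//= -(@fineK _ (P x A)) ?fin_num_measure//=.
rewrite -lee_fin fineK ?fin_num_measure//; exact: probability_le1.
Qed.

Lemma measurable_X_stopping (tau : Omega -> \bar R) :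
  stopping_time Filt tau -> measurable_fun setT (fun w => X (fine (tau w)) w : borel E).
Proof.
move=> stau; have tau0 w : (0 <= tau w)%E by case: stau.
rewrite (_ : (fun w => _) = fun w => path_at (fine (tau w)) (trajectory std w)).
  apply: measurable_path_at_time; last exact: measurable_trajectory.
  by apply: measurableT_comp; [exact: fine_measurable|exact: (measurable_stopping_time std)].
by apply/funext => w; rewrite trajectoryE// fine_ge0.
Qed.

(** A wide bump [h m] has [A_a (h m) x > 1 - e / 4] near [x0], and [T / a <= e / 4], so the stopped
    mean is at least [1 - e / 2]. Off the compact [K] the averaged bump is below [1 / 2], so
    escaping with probability [p] costs at least [p / 2]. *)
Lemma stopped_compact_containment (x0 : E) (T e : R) : 0 <= T -> 0 < e ->
  exists2 K : set E, compact K & \forall x \near x0,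
  forall tau, stopping_time Filt tau -> (forall w, (tau w <= T%:E)%E) ->
  prob x [set w | ~ K (X (fine (tau w)) w)] <= e.
Proof.
(* The summand [1] keeps [a] positive when [T = 0]. *)
move=> T0 e0; pose a := (4 * T + 1) / e.
have a0 : 0 < a by rewrite divr_gt0// ltr_wpDl// mulr_ge0.
have Ta : T / a <= e / 4.
  rewrite ler_pdivrMr// (_ : e / 4 * a = T + 4^-1) ?lerDl//.
  by rewrite /a; field; rewrite gt_eqF.
pose h (m : nat) := bump x0 m%:R 1.
have h01 m x : 0 <= h m x <= 1 by rewrite bump_ge0 bump_le1.
have hC m : C0 (h m) by exact: bump_C0.
have mh m : measurable_fun [set: borel E] (h m : borel E -> R).
  by apply: continuous_borel; exact: bump_continuous.
have hcvg x : h m x @[m --> \oo] --> (1 : R).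
  apply: cvg_near_cst; near=> m; apply: bump_eq1; rewrite divr1 lerBrDr.
  by near: m; exact: nbhs_infty_ger.
have lim1 : smoothed std a (h m) x0 @[m --> \oo] --> (1 : R).
  rewrite -[X in _ --> X](mean_cst (P x0)).
  apply: (@mean_cvg _ _ _ _ _ _ 1) => //.
  - by move=> m; have [] := bounded_measurable_trajectory std (bounded_measurable_path_average a0 (mh m) (h01 m)).
  - by move=> m w; have /andP[? ?] := path_average_bounds a0 (mh m) (h01 m) (trajectory std w); rewrite ger0_norm.
  - apply: aeW => w; set p := trajectory std w.
    have -> : 1 = a^-1 * \int[lebesgue_measure]_(u in `[0%R, a[) (cst 1 u) :> R.
      rewrite Rintegral_cst// [X in _ * (_ * fine X)](_ : _ = (@lebesgue_measure R) `[0, a[%classic)//.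
      by rewrite lebesgue_co ?(ltW a0)//= mul1r subr0 mulVf// gt_eqF.
    apply: cvgM; first exact: cvg_cst.
    apply: (@Rintegral_dominated R _ (measurableTypeR R) lebesgue_measure `[0, a[%classic
      (fun m u => h m (path_at u p)) (cst 1) (cst 1)) => //.
    + move=> m; apply: measurable_funTS.
      exact: (measurable_along_path (mh m) p (@measurable_id _ (measurableTypeR R) setT)).
    + exact: (integrable_cst_co 1 (ltW a0)).
    + by move=> m u _; have /andP[? ?] := h01 m (path_at u p); rewrite ger0_norm.
have e8 : 0 < e / 8 by rewrite divr_gt0.
have [m _ Hm] := (cvgrPdist_lt _ _).1 lim1 _ e8.
have {Hm} hm : 1 - e / 8 < smoothed std a (h m) x0.
  by have := Hm m (leqnn m); rewrite /= ltr_norml => /andP[_]; lra.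
have [sc sb sv] := smoothed_C0 std X_weakly_Feller E_balls a0 (hC m) (h01 m).
have [K cK HK] := sv 2^-1 ltac:(by rewrite invr_gt0).
exists K => //.
near=> x => tau stau tauT.
have hx : `|smoothed std a (h m) x0 - smoothed std a (h m) x| < e / 8.
  by near: x; exact: (cvgrPdist_lt _ _).1 (sc x0) _ e8.
have hx' : 1 - e / 4 < smoothed std a (h m) x.
  by move: hx; rewrite ltr_norml => /andP[_]; lra.
have := le_smoothed_stopping std a0 (mh m) (h01 m) x stau tauT.
have mK : measurable ([set w | ~ K (X (fine (tau w)) w)]).
  have clK : closed K by apply: compact_closed => //; exact: metric_hausdorff.
  have := measurable_X_stopping stau measurableT (measurableC (closed_borel clK)).
  by rewrite setTI.
have bs := bounded_measurable_comp (bounded_measurable_smoothed std a0 (mh m) (h01 m)) (measurable_X_stopping stau).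
have := @le_mean _ _ _ (P x) (fun w => smoothed std a (h m) (X (fine (tau w)) w))
  (fun w => 1 - 2^-1 * \1_[set w | ~ K (X (fine (tau w)) w)] w) bs.
rewrite meanB; [|exact: bounded_measurable_cst|by apply: bounded_measurableZ; exact: bounded_measurable_indic].
rewrite mean_cst meanZ; last exact: bounded_measurable_indic.
rewrite mean_indic// => H1 H2.
have : \int[P x]_w smoothed std a (h m) (X (fine (tau w)) w) <= 1 - 2^-1 * prob x [set w | ~ K (X (fine (tau w)) w)].
  apply: H1.
    apply: bounded_measurableB; first exact: bounded_measurable_cst.
    by apply: bounded_measurableZ; exact: bounded_measurable_indic.
  move=> w; have /andP[s0 s1] := smoothed_bounds std a0 (mh m) (h01 m) (X (fine (tau w)) w).
  rewrite indicE; have [Kw|nKw] := pselect (K (X (fine (tau w)) w)).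
    by rewrite memNset ?mulr0 ?subr0//= => /(_ Kw).
  rewrite mem_set// mulr1; have := HK _ nKw; rewrite ger0_norm//; lra.
move: (prob x _) (\int[P x]_w _) H2 => p0 i0.
by move: hx' Ta; move: (T / a) (smoothed std a (h m) x) => v1 v2; lra.
Unshelve. all: by end_near. Qed.

(* [A_a h] tends to [h] only pointwise as [a] tends to 0.  If the estimate failed,
   the laws of the stopped positions along a sequence would give mass bounded
   below to every compact [A k] on which [h = 0] and [A_(a k) h >= e / 4]; a point
   lying in infinitely many [A k] contradicts the pointwise convergence. *)
Lemma stopped_displacement (x0 : E) (r e : R) : 0 < r -> 0 < e ->
  exists2 eta : R, 0 < eta & \forall x \near x0,
  forall tau, stopping_time Filt tau -> (forall w, (tau w <= eta%:E)%E) ->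
  prob x [set w | r <= mdist x0 (X (fine (tau w)) w)] <= e.
Proof.
move=> r0 e0; apply: contrapT => Hn.
have bad (n : nat) : exists z : E * (Omega -> \bar R), [/\ mdist x0 z.1 < n.+1%:R^-1,
    stopping_time Filt z.2, (forall w, (z.2 w <= n.+1%:R^-1%:E)%E) &
    e < prob z.1 [set w | r <= mdist x0 (X (fine (z.2 w)) w)]].
  have n0 : 0 < n.+1%:R^-1 :> R by rewrite invr_gt0 ltr0n.
  apply: contrapT => Hz; apply: Hn; exists n.+1%:R^-1 => //.
  apply/metricType_numDomainType.nbhs_mdistP; exists n.+1%:R^-1 => // x /= xx0 tau stau tauT.
  by rewrite leNgt; apply/negP => ee; apply: Hz; exists (x, tau).
have [z Hz] := choice bad.
pose x n := (z n).1; pose tau n := (z n).2.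
have stau n : stopping_time Filt (tau n) by case: (Hz n).
have tauT n w : (tau n w <= n.+1%:R^-1%:E)%E by have [_ _ + _] := Hz n; exact.
have xx0 : x n @[n --> \oo] --> x0.
  apply/metricType_numDomainType.cvgrPdist_lt => e' e'0; near=> n.
  have [xn _ _ _] := Hz n; rewrite (lt_trans xn)//.
  by near: n; exact: near_infty_natSinv_lt (PosNum e'0).
pose h := bump x0 1 r.
have h01 y : 0 <= h y <= 1 by rewrite bump_ge0 bump_le1.
have hC : C0 h by exact: bump_C0.
have ch : continuous h by exact: bump_continuous.
have mh : measurable_fun [set: borel E] (h : borel E -> R) by exact: continuous_borel.
have hx0 : h x0 = 1 by apply: bump_eq1; rewrite mdistxx mul0r subr0.
pose a (k : nat) : R := k.+1%:R^-1.
have a0 k : 0 < a k by rewrite invr_gt0 ltr0n.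
pose f k := smoothed std (a k) h.
have fC k : C0 (f k) := smoothed_C0 std X_weakly_Feller E_balls (a0 k) hC h01.
have f01 k y : 0 <= f k y <= 1 by exact: smoothed_bounds.
have e4 : 0 < e / 4 by rewrite divr_gt0.
have e8 : 0 < e / 8 by rewrite divr_gt0.
have fcvg y : f k y @[k --> \oo] --> h y by exact: smoothed_small_time.
have [k0 _ Hk0] := (cvgrPdist_lt _ _).1 (fcvg x0) _ e8.
have {}Hk0 k : (k0 <= k)%N -> 1 - e / 8 < f k x0.
  by move=> /Hk0 /=; rewrite hx0 ltr_norml => /andP[_]; lra.
(* The offset [k0] ensures [f (k0 + k) x0 > 1 - e / 8] for every [k]. *)
pose A k := [set y | r <= mdist x0 y /\ e / 4 <= f (k0 + k)%N y].
have clA k : closed (A k).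
  apply: closedI; first exact: closed_ge_mdist.
  apply: (closed_comp (f := f (k0 + k)%N) (D := [set t | e / 4 <= t])).
    by move=> y _; have [c _ _] := fC (k0 + k)%N; exact: c.
  exact: closed_ge.
have cA k : compact (A k).
  have [_ _ /(_ _ e4)[K cK HK]] := fC (k0 + k)%N.
  apply: (subclosed_compact (clA k) cK) => y [_ fy]; apply: contrapT => /HK.
  by rewrite ger0_norm ?ltNge ?fy//; have /andP[] := f01 (k0 + k)%N y.
have mA k : measurable (A k : set (borel E)) by exact: closed_borel.
have mX n : measurable_fun setT (fun w => X (fine (tau n w)) w : borel E).
  exact: measurable_X_stopping.
pose mu n (B : set (borel E)) := prob (x n) [set w | B (X (fine (tau n w)) w)].
have mB n (B : set (borel E)) : measurable B -> measurable [set w | B (X (fine (tau n w)) w)].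
  by move=> mB; rewrite -[X in measurable X]setTI; exact: mX.
(* The function is at most [1] everywhere, and below [e / 4] where the process has escaped without
   being in [A k]. Its mean exceeds [1 - e / 2] while escape has probability above [e], which leaves
   more than [e / 4] for [A k]. *)
have muA k : \forall n \near \oo, e / 4 <= mu n (A k).
  have ck : f (k0 + k)%N (x n) @[n --> \oo] --> f (k0 + k)%N x0.
    have [c _ _] := fC (k0 + k)%N.
    by apply: (@cvg_comp _ _ _ x (f (k0 + k)%N) _ (nbhs x0)) => //; exact: c.
  near=> n.
  have fn : 1 - e / 4 < f (k0 + k)%N (x n).
    have : `|f (k0 + k)%N x0 - f (k0 + k)%N (x n)| < e / 8.
      by near: n; exact: (cvgrPdist_lt _ _).1 ck _ e8.
    by rewrite ltr_norml => /andP[_]; have := Hk0 (k0 + k)%N (leq_addr _ _); lra.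
  have small : n.+1%:R^-1 / a (k0 + k)%N < e / 4.
    rewrite ltr_pdivrMr//; near: n.
    exact: near_infty_natSinv_lt (PosNum (mulr_gt0 e4 (a0 (k0 + k)%N))).
  have := le_smoothed_stopping std (a0 (k0 + k)%N) mh h01 (x n) (stau n) (tauT n).
  rewrite -/(f (k0 + k)%N).
  have bs := bounded_measurable_comp
    (bounded_measurable_smoothed std (a0 (k0 + k)%N) mh h01) (mX n).
  have [_ _ _ En] := Hz n; rewrite -/(x n) -/(tau n) in En.
  have mF : measurable [set w | r <= mdist x0 (X (fine (tau n w)) w)].
    by apply: (mB n [set y | r <= mdist x0 y]); apply: closed_borel; exact: closed_ge_mdist.
  have bF := @bounded_measurable_indic _ _ R _ mF.
  have bA := @bounded_measurable_indic _ _ R _ (mB n _ (mA k)).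
  have b1 := @bounded_measurable_cst _ Omega R (1 + e / 4).
  have := @le_mean _ _ _ (P (x n)) (fun w => f (k0 + k)%N (X (fine (tau n w)) w))
    (fun w => (1 + e / 4) - \1_[set w | r <= mdist x0 (X (fine (tau n w)) w)] w +
       \1_[set w | A k (X (fine (tau n w)) w)] w) bs
    (bounded_measurableD (bounded_measurableB b1 bF) bA).
  rewrite meanD//; last exact: bounded_measurableB.
  rewrite meanB// mean_cst !mean_indic//; last exact: mB.
  move=> H1 H2; have {H1} := H1 _.
  have pw w : f (k0 + k)%N (X (fine (tau n w)) w) <= (1 + e / 4) -
      \1_[set w | r <= mdist x0 (X (fine (tau n w)) w)] w +
       \1_[set w | A k (X (fine (tau n w)) w)] w.
    have /andP[f0 f1] := f01 (k0 + k)%N (X (fine (tau n w)) w).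
    rewrite !indicE; have [rw|nrw] := pselect (r <= mdist x0 (X (fine (tau n w)) w)); last first.
      rewrite memNset//; case: (_ \in _) => /=; lra.
    rewrite mem_set//; have [fw|fw] := leP (e / 4) (f (k0 + k)%N (X (fine (tau n w)) w)).
      rewrite mem_set//=; lra.
    by case: (_ \in _) => /=; lra.
  move=> /(_ pw); rewrite -/(mu n (A k)).
  move: H2 fn small En.
  move: (\int[P (x n)]_w _) (f (k0 + k)%N (x n)) (n.+1%:R^-1 / a (k0 + k)%N).
  by move: (mu n (A k)) (prob (x n) _) => v1 v2 v3 v4 v5; lra.
have mu0 n : mu n set0 = 0.
  by rewrite /mu (_ : mkset _ = set0) ?measure0// -subset0.
have mu01 n B : measurable B -> 0 <= mu n B <= 1 by move=> mB'; apply: prob_bounds; exact: mB.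
have muU n B C : measurable B -> measurable C ->
    mu n (B `|` C) + mu n (B `&` C) = mu n B + mu n C.
  move=> mB' mC'; rewrite /mu.
  have m1 := mB n _ mB'; have m2 := mB n _ mC'.
  have -> : [set w | (B `|` C) (X (fine (tau n w)) w)] =
    [set w | B (X (fine (tau n w)) w)] `|` [set w | C (X (fine (tau n w)) w)] by [].
  have -> : [set w | (B `&` C) (X (fine (tau n w)) w)] =
    [set w | B (X (fine (tau n w)) w)] `&` [set w | C (X (fine (tau n w)) w)] by [].
  rewrite -!(@mean_indic _ _ _ (P (x n)))//; [|exact: measurableI|exact: measurableU].
  rewrite -!meanD; try exact: bounded_measurable_indic.
  - by apply: eq_Rintegral => w _; rewrite !indicE in_setU in_setI;
      case: (w \in _); case: (w \in _) => /=; lra.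
  - by apply: bounded_measurable_indic; exact: measurableU.
  - by apply: bounded_measurable_indic; exact: measurableI.
have [k [kj Hk]] := content_subsequence mu0 mu01 muU e4 mA muA.
have [y Hy] := compact_subsequence cA clA kj Hk.
have hy : h y = 0 by apply: bump_eq0; rewrite ?mul1r//; have [? _ []] := Hy 0%N.
have := fcvg y; rewrite hy => /cvgrPdist_lt /(_ _ e4)[N _ HN].
have [n Nn [_ fy]] := Hy N.
have := HN (k0 + n)%N (leq_trans Nn (leq_addl _ _)); rewrite /= sub0r normrN ger0_norm.
  by rewrite ltNge fy.
by have /andP[] := f01 (k0 + n)%N y.
Unshelve. all: by end_near. Qed.

(** Turns bounds at stopping times into bounds over a whole time interval: at its hitting time a
    right-continuous path is in the closure of [G]. *)
Lemma hitting_prob_le (G C : set E) (T : R) (x : E) : open G -> closed C ->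
  closure G `<=` C -> 0 <= T ->
  prob x [set w | (hitting_time G (trajectory std w) <= T%:E)%E] <=
  prob x [set w | C (X (fine (mine (hitting_time G (trajectory std w)) T%:E)) w)].
Proof.
move=> oG cC GC T0.
have stau := stopping_time_min std (stopping_time_hitting std oG) (stopping_time_cst std T0).
have mX := measurable_X_stopping stau.
have m2 : measurable [set w | C (X (fine (mine (hitting_time G (trajectory std w)) T%:E)) w)].
  by rewrite -[X in measurable X]setTI; apply: mX => //; exact: closed_borel.
have m1 : measurable [set w | (hitting_time G (trajectory std w) <= T%:E)%E].
  have [_ /(_ T T0) FT] := stopping_time_hitting std oG.
  exact: (filt_measurable std T0 FT).
apply: fine_le; rewrite ?fin_num_measure//.
apply: le_measure; rewrite ?inE// => w /= wT.
rewrite min_l//; have := hitting_time_ge0 G (trajectory std w).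
case Et : (hitting_time G (trajectory std w)) wT => [t| |]//=; rewrite !lee_fin => tT t0.
by apply: GC; rewrite -(trajectoryE std w t0); exact: hitting_time_closure.
Qed.

Lemma closure_gt_mdist (x0 : E) (r : R) :
  closure [set y : E | r < mdist x0 y] `<=` [set y | r <= mdist x0 y].
Proof.
rewrite [X in _ `<=` X]((closure_id _).1 (@closed_ge_mdist _ _ x0 r)); apply: closure_subset => y /=.
exact: ltW.
Qed.

Lemma path_stays_bounded (x0 : E) (T e : R) : 0 <= T -> 0 < e ->
  exists M : R, \forall x \near x0,
  prob x [set w | (hitting_time [set y | (M < mdist x0 y)%R] (trajectory std w) <= T%:E)%E] <= e.
Proof.
move=> T0 e0; have [K cK HK] := stopped_compact_containment x0 T0 e0.
have [M HM] := compact_mdist_bounded x0 cK.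
exists (M + 1); near=> x.
have H0 := hitting_prob_le x (open_gt_mdist x0 (M + 1))
  (@closed_ge_mdist _ _ x0 (M + 1)) (@closure_gt_mdist x0 (M + 1)) T0.
have H : forall tau, stopping_time Filt tau -> (forall w, (tau w <= T%:E)%E) ->
  prob x [set w | ~ K (X (fine (tau w)) w)] <= e by near: x; exact: HK.
pose tau w := mine (hitting_time [set y | (M + 1 < mdist x0 y)%R] (trajectory std w)) T%:E.
have stau : stopping_time Filt tau.
  exact: (stopping_time_min std (stopping_time_hitting std (open_gt_mdist x0 (M + 1))) (stopping_time_cst std T0)).
have tauT w : (tau w <= T%:E)%E by rewrite ge_min lexx orbT.
apply: (le_trans H0); apply: le_trans (H tau stau tauT).
have mX := measurable_X_stopping stau.
have mK : measurable ([set w | ~ K (X (fine (tau w)) w)]).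
  have clK : closed K by apply: compact_closed => //; exact: metric_hausdorff.
  have := mX measurableT _ (measurableC (closed_borel clK)).
  by rewrite setTI.
have mM : measurable [set w | M + 1 <= mdist x0 (X (fine (tau w)) w)].
  have := mX measurableT _ (closed_borel (@closed_ge_mdist _ _ x0 (M + 1))).
  by rewrite setTI.
apply: fine_le; rewrite ?fin_num_measure//.
apply: le_measure; rewrite ?inE// => w /= Mw /HM; apply/negP; rewrite -ltNge.
by rewrite (lt_le_trans _ Mw)// ltrDl.
Unshelve. all: by end_near. Qed.

Lemma path_stays_near (x0 : E) (r e : R) : 0 < r -> 0 < e ->
  exists2 eta : R, 0 < eta & \forall x \near x0,
  prob x [set w | (hitting_time [set y | (r < mdist x0 y)%R] (trajectory std w) <= eta%:E)%E] <= e.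
Proof.
move=> r0 e0; have [eta eta0 Heta] := stopped_displacement x0 r0 e0.
exists eta => //; near=> x.
have H0 := hitting_prob_le x (open_gt_mdist x0 r)
  (@closed_ge_mdist _ _ x0 r) (@closure_gt_mdist x0 r) (ltW eta0).
have H : forall tau, stopping_time Filt tau -> (forall w, (tau w <= eta%:E)%E) ->
  prob x [set w | r <= mdist x0 (X (fine (tau w)) w)] <= e by near: x; exact: Heta.
apply: (le_trans H0); apply: H; last by move=> w; rewrite ge_min lexx orbT.
exact: (stopping_time_min std (stopping_time_hitting std (open_gt_mdist x0 r)) (stopping_time_cst std (ltW eta0))).
Unshelve. all: by end_near. Qed.

End maximal_estimates.

(** * The payoff along a path *)

Section payoff_functional.
Context {R : realType} {E : pmetricType R}.
Local Notation leb := (@lebesgue_measure R).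
Local Notation D := (path_space E).

Variables (O : set E) (alpha : R) (f F : R -> E -> R) (M : R).
Hypothesis alpha_gt0 : 0 < alpha.
Hypothesis mf : measurable_fun [set: R * borel E] (fun z => f z.1 z.2).
Hypothesis mF : measurable_fun [set: R * borel E] (fun z => F z.1 z.2).
Hypothesis fM : forall s x, `|f s x| <= M.
Hypothesis FM : forall s x, `|F s x| <= M.

Definition running_rate (s : R) (p : rc_path E) (u : R) : R :=
  expR (- alpha * u) * f (s + u) (path_at u p).

Definition running (s : R) (T : \bar R) (p : rc_path E) : R :=
  \int[leb]_(u in [set u : R | 0 <= u /\ (u%:E <= T)%E]) running_rate s p u.

Definition terminal (s : R) (T : \bar R) (p : rc_path E) : R :=
  if T is t%:E then expR (- alpha * t) * F (s + t) (path_at t p) else 0.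

Definition path_payoff (s : R) (b : \bar R) (p : rc_path E) : R :=
  let T := mine b (announced_exit O p) in running s T p + terminal s T p.

Let M_ge0 : 0 <= M. Proof. exact: le_trans (normr_ge0 _) (fM 0 point). Qed.

Lemma measurable_running_rate d (Y : measurableType d) (g : Y -> R) (psi : Y -> D) (s : R) :
  measurable_fun setT g -> measurable_fun setT psi ->
  measurable_fun setT (fun y => running_rate s (psi y) (g y)).
Proof.
move=> mg mpsi; apply: measurable_funM.
  by apply: measurableT_comp => //; apply: measurable_funM => //; exact: measurable_cst.
apply: (measurableT_comp mf (g := fun y => (s + g y, path_at (g y) (psi y) : borel E))).
apply: measurable_fun_pair; last exact: measurable_path_at_time.
by apply: measurable_funD => //; exact: measurable_cst.
Qed.

Lemma measurable_rate_along s p : measurable_fun setT (running_rate s p).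
Proof.
exact: (measurable_running_rate s (@measurable_id _ (measurableTypeR R) setT) (measurable_cst (p : D))).
Qed.

Lemma running_rate_bound s p u : 0 <= u -> `|running_rate s p u| <= M * discount alpha u.
Proof.
move=> u0; rewrite normrM ger0_norm ?expR_ge0// /discount u0 mulrC.
by rewrite ler_pM2r ?expR_gt0.
Qed.

Lemma run_set_E (T : \bar R) : [set u : R | 0 <= u /\ (u%:E <= T)%E] =
  (if T is t%:E then `[0, t]%classic else if T == +oo%E then `[0, +oo[%classic else set0).
Proof.
case: T => [t| |] /=.
- by apply/seteqP; split => u /=; rewrite in_itv/= lee_fin; [move=> [-> ->]|move=> /andP].
- by apply/seteqP; split => u /=; rewrite in_itv/= andbT leey; [case|].
- by apply/seteqP; split => u //= [_]; rewrite leeNy_eq.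
Qed.

Lemma measurable_run_set (T : \bar R) :
  measurable ([set u : R | 0 <= u /\ (u%:E <= T)%E] : set R).
Proof. by rewrite run_set_E; case: T => //=. Qed.

Lemma integrable_discount_on (S : set R) (c a : R) : 0 < a -> measurable S ->
  leb.-integrable S (EFin \o (fun u => c * discount a u)).
Proof.
move=> a0 mS; apply: (@integrableS _ _ _ leb setT) => //.
rewrite (_ : _ \o _ = (fun u => c%:E * (discount a u)%:E)%E).
  by apply: integrableZl => //; exact: integrable_discount.
by apply/funext => u /=; rewrite EFinM.
Qed.

Lemma integrable_running_rate s p (S : set R) : measurable S ->
  S `<=` [set u | 0 <= u] -> leb.-integrable S (EFin \o running_rate s p).
Proof.
move=> mS S0; apply: (@le_integrable _ _ _ leb S mS _ (EFin \o (fun u => M * discount alpha u))).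
- apply/measurable_EFinP; apply: measurable_funTS.
  exact: (measurable_rate_along s p).
- move=> u Su /=; rewrite lee_fin (le_trans (running_rate_bound s p (S0 u Su)))//.
  exact: ler_norm.
- exact: integrable_discount_on.
Qed.

Lemma integral_le_discount (S : set R) (g : R -> R) (c a : R) : 0 < a -> 0 <= c ->
  measurable S -> S `<=` [set u | 0 <= u] -> measurable_fun S g ->
  (forall u, S u -> `|g u| <= c * discount a u) ->
  `|\int[leb]_(u in S) g u| <= c / a.
Proof.
move=> a0 c0 mS S0 mg gb.
have ig : leb.-integrable S (EFin \o g).
  apply: (@le_integrable _ _ _ leb S mS _ (EFin \o (fun u => c * discount a u))).
  - exact/measurable_EFinP.
  - by move=> u Su /=; rewrite lee_fin (le_trans (gb u Su))// ler_norm.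
  - exact: integrable_discount_on.
rewrite (le_trans (le_normr_Rintegral _ ig))//.
apply: (@le_trans _ _ (\int[leb]_(u in S) (c * discount a u))).
  by apply: le_Rintegral => //; [exact: integrable_norm|exact: integrable_discount_on].
rewrite -(Rintegral_discount a0) -RintegralZl//; last exact: integrable_discount.
rewrite Rintegral_mkcond; apply: le_Rintegral => //.
- have -> : (fun u => c * discount a u) \_ S = (fun u => \1_S u * (c * discount a u)).
    by apply/funext => u; rewrite /patch indicE; case: ifP => _; rewrite ?mul1r ?mul0r.
  apply: (@le_integrable _ _ _ leb setT measurableT _ (EFin \o (fun u => c * discount a u))).
  + apply/measurable_EFinP; apply: measurable_funM; first exact: measurable_indic.
    by apply: measurable_funM; [exact: measurable_cst|exact: measurable_discount].
  + move=> u _ /=; rewrite lee_fin normrM indicE ler_piMl//.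
    by case: (_ \in _); rewrite ?normr1 ?normr0.
  + exact: integrable_discount_on.
- exact: integrable_discount_on.
- by move=> u _; rewrite /patch; case: ifP => // _; rewrite mulr_ge0// discount_ge0.
Qed.

Lemma running_bound s T p : `|running s T p| <= M / alpha.
Proof.
apply: integral_le_discount => //.
- exact: measurable_run_set.
- by move=> u [].
- apply: measurable_funTS.
  exact: (measurable_rate_along s p).
- by move=> u [u0 _]; exact: running_rate_bound.
Qed.

Lemma terminal_bound s T p : (0 <= T)%E -> `|terminal s T p| <= M.
Proof.
case: T => [t| |] //=; rewrite ?normr0// lee_fin => t0.
rewrite normrM ger0_norm ?expR_ge0// -[leRHS]mul1r ler_pM ?expR_ge0//.
by rewrite expRN_le1// ltW.
Qed.

Lemma path_payoff_bound s b p : (0 <= b)%E -> `|path_payoff s b p| <= M / alpha + M.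
Proof.
move=> b0; rewrite (le_trans (ler_normD _ _))// lerD ?running_bound//.
by apply: terminal_bound; rewrite le_min b0 announced_exit_ge0.
Qed.

Lemma measurable_path_payoff d (Y : measurableType d) (b : Y -> \bar R) (psi : Y -> D) s :
  measurable_fun setT b -> measurable_fun setT psi -> (forall y, (0 <= b y)%E) ->
  measurable_fun setT (fun y => path_payoff s (b y) (psi y)).
Proof.
move=> mb mpsi b0.
pose T y := mine (b y) (announced_exit O (psi y)).
have mT : measurable_fun setT T.
  by apply: measurable_mine => //; exact: measurableT_comp (measurable_announced_exit O) mpsi.
apply: measurable_funD.
  pose k (z : Y * R) := if (0 <= z.2) && (z.2%:E <= T z.1)%E then running_rate s (psi z.1) z.2 else 0.
  have -> : (fun y => running s (T y) (psi y)) = (fun y => \int[leb]_u k (y, u)).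
    apply/funext => y; rewrite /running Rintegral_mkcond; apply: eq_Rintegral => u _.
    rewrite /patch /k/=; congr (if _ then _ else _).
    by apply/idP/idP; [move=> /set_mem[-> ->]|move=> /andP[? ?]; exact: mem_set].
  apply: measurable_Rintegral; apply: measurable_fun_ifT => //.
    apply: measurable_and; first exact: measurable_fun_ler.
    apply: (measurable_fun_bool true); rewrite setTI.
    rewrite (_ : _ @^-1` _ = [set z : Y * R | (z.2%:E <= T z.1)%E]).
      rewrite -[X in measurable X]setTI; apply: measurable_lee => //.
        by apply: measurableT_comp => //; exact: EFin_measurable.
      exact: (measurableT_comp mT).
    by apply/seteqP; split.
  apply: measurable_running_rate => //.
  exact: (measurableT_comp mpsi).
have -> : (fun y => terminal s (T y) (psi y)) =
    (fun y => if T y \is a fin_num then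
       expR (- alpha * fine (T y)) * F (s + fine (T y)) (path_at (fine (T y)) (psi y)) else 0).
  by apply/funext => y; rewrite /terminal; case: (T y).
have mfT : measurable_fun setT (fine \o T) by apply: measurableT_comp; [exact: fine_measurable|].
apply: measurable_fun_ifT => //.
  apply: (measurable_fun_bool true).
  rewrite (_ : _ @^-1` _ = [set y | T y \is a fin_num]); last by apply/seteqP; split.
  exact: emeasurable_fin_num.
apply: measurable_funM.
  by apply: measurableT_comp => //; apply: measurable_funM => //; exact: measurable_cst.
apply: (measurableT_comp mF (g := fun y => (s + fine (T y), path_at (fine (T y)) (psi y) : borel E))).
apply: measurable_fun_pair; last exact: measurable_path_at_time.
by apply: measurable_funD => //; exact: measurable_cst.
Qed.

Lemma path_payoff_exited s (b dl : \bar R) p :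
  (announced_exit O p <= dl)%E -> (dl <= b)%E -> path_payoff s b p = path_payoff s dl p.
Proof. by move=> ed db; rewrite /path_payoff !min_r// (le_trans ed db). Qed.

Definition running_before (s dl : R) (p : rc_path E) : R :=
  \int[leb]_(u in `[0%R, dl[) running_rate s p u.

Lemma running_before_bound s dl p : 0 <= dl -> `|running_before s dl p| <= M * dl.
Proof.
move=> dl0.
have := @Rintegral_finite_bound R `[0, dl[%classic (running_rate s p) M.
rewrite lebesgue_co//= subr0; apply => //; first exact: ltry.
  apply: measurable_funTS.
  exact: (measurable_rate_along s p).
move=> u; rewrite /= in_itv/= => /andP[u0 _].
rewrite (le_trans (running_rate_bound s p u0))// -[leRHS]mulr1 ler_wpM2l//.
by rewrite /discount u0 expRN_le1// ltW.
Qed.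

Lemma measurable_running_before s dl : 0 <= dl ->
  measurable_fun [set: D] (running_before s dl : D -> R).
Proof.
move=> dl0.
pose k (z : D * R) := \1_(`[0%R, dl[%classic) z.2 * running_rate s z.1 z.2.
have -> : running_before s dl = (fun p : D => \int[leb]_u k (p, u)).
  apply/funext => p; rewrite /running_before Rintegral_mkcond; apply: eq_Rintegral => u _.
  by rewrite /patch /k/= indicE; case: ifPn => _; rewrite ?mul1r ?mul0r.
apply: measurable_Rintegral; apply: measurable_funM.
  by apply: measurableT_comp => //; exact: measurable_indic.
exact: measurable_running_rate.
Qed.

Lemma running_rate_shift s dl p u : 0 <= u ->
  running_rate s p (dl + u) =
  expR (- alpha * dl) * running_rate (s + dl) (path_shift dl p) u.
Proof.
by move=> u0; rewrite /running_rate path_shiftE// mulrDr expRD mulrA addrA.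
Qed.

Lemma running_split s dl (T : \bar R) p : 0 <= dl -> (0 <= T)%E ->
  running s (dl%:E + T) p =
  running_before s dl p + expR (- alpha * dl) * running (s + dl) T (path_shift dl p).
Proof.
move=> dl0 T0.
pose S := [set u : R | dl <= u /\ (u%:E <= dl%:E + T)%E].
have SE : S = [set u | [set v : R | 0 <= v /\ (v%:E <= T)%E] (u - dl)].
  by apply/seteqP; split => u /=; rewrite subr_ge0 EFinB leeBlDl.
have mS : measurable S.
  rewrite (_ : S = `[dl, +oo[%classic `&` [set u : R | 0 <= u /\ (u%:E <= dl%:E + T)%E]).
    by apply: measurableI => //; exact: measurable_run_set.
  apply/seteqP; split => u /=; rewrite in_itv/= andbT.
    by move=> [du uT]; split => //; split => //; exact: le_trans du.
  by move=> [? []].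
have splitE : [set u : R | 0 <= u /\ (u%:E <= dl%:E + T)%E] = `[0, dl[%classic `|` S.
  apply/seteqP; split => u /=; rewrite in_itv/=.
    by move=> [u0 uT]; have [ud|du] := ltP u dl; [left; rewrite u0|right].
  move=> [/andP[u0 ud]|[du uT]]; last by split => //; exact: le_trans du.
  by split => //; rewrite (@le_trans _ _ dl%:E) ?lee_fin ?(ltW ud)// leeDl.
have mrate : measurable_fun setT (running_rate s p).
  exact: (measurable_rate_along s p).
rewrite /running splitE Rintegral_setU//; last 2 first.
- apply: integrable_running_rate; first exact: measurableU.
  by rewrite -splitE => u [].
- apply/disj_setPS => u /=; rewrite in_itv/= => -[/andP[_ ud] [du _]].
  by move: ud; rewrite ltNge du.
congr (_ + _).
rewrite (@Rintegral_translation R (- dl) _ S mS); last exact: measurable_funTS.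
have -> : [set u | S (u - - dl)] = [set u : R | 0 <= u /\ (u%:E <= T)%E].
  by rewrite SE; apply/seteqP; split => u /=; rewrite opprK addrK.
rewrite -RintegralZl; [|exact: measurable_run_set|]; last first.
  by apply: integrable_running_rate; [exact: measurable_run_set|move=> u []].
apply: eq_Rintegral => u; rewrite inE/= => -[u0 _].
by rewrite opprK addrC running_rate_shift.
Qed.

(** Survival beyond [dl] is essential: a path that has already left [O] may be back in it at [dl],
    and the shift would forget the exit. *)
Lemma path_payoff_split s (dl : R) (b : \bar R) p : 0 <= dl -> (dl%:E <= b)%E ->
  (dl%:E < announced_exit O p)%E ->
  path_payoff s b p = running_before s dl p +
    expR (- alpha * dl) * path_payoff (s + dl) (b - dl%:E)%E (path_shift dl p).
Proof.
move=> dl0 db de; pose T' := mine (b - dl%:E)%E (announced_exit O (path_shift dl p)).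
have T'0 : (0 <= T')%E by rewrite le_min announced_exit_ge0 andbT sube_ge0.
have TE : mine b (announced_exit O p) = (dl%:E + T')%E.
  have bE : b = (dl%:E + (b - dl%:E))%E by rewrite addeC subeK.
  by rewrite (announced_exit_shift dl0 de) {1}bE /T' !minEle leeD2lE//; case: ifP.
rewrite /path_payoff TE running_split// -/T' mulrDr addrA; congr (_ + _).
case: T' T'0 {TE} => [t| |]//=; rewrite ?mulr0// lee_fin => t0.
by rewrite path_shiftE// mulrDr expRD mulrA addrA.
Qed.

Lemma path_payoff0 s p : path_payoff s 0%:E p = F s (path_at 0 p).
Proof.
rewrite /path_payoff min_l ?announced_exit_ge0// /running run_set_E set_itv1 Rintegral_set1 add0r /=.
by rewrite mulr0 expR0 mul1r addr0.
Qed.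

Lemma running_as_full_integral s T p : running s T p =
  \int[leb]_u (if (0 <= u) && (u%:E <= T)%E then running_rate s p u else 0).
Proof.
rewrite /running Rintegral_mkcond; apply: eq_Rintegral => u _; rewrite /patch.
congr (if _ then _ else _).
by apply/idP/idP; [move=> /set_mem[-> ->]|move=> /andP[? ?]; exact: mem_set].
Qed.

Lemma measurable_run_rate_restricted s T p :
  measurable_fun setT (fun u : R => if (0 <= u) && (u%:E <= T)%E then running_rate s p u else 0).
Proof.
apply: measurable_fun_ifT => //; last first.
  exact: (measurable_rate_along s p).
apply: (measurable_fun_bool true); rewrite setTI.
rewrite (_ : _ @^-1` _ = [set u : R | 0 <= u /\ (u%:E <= T)%E]).
  exact: measurable_run_set.
by apply/seteqP; split => u /= /andP.
Qed.

Lemma running_cvg s (Tn : nat -> \bar R) (T : \bar R) p :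
  (forall u : R, 0 <= u -> \forall n \near \oo, (u%:E <= Tn n)%E = (u%:E <= T)%E) ->
  running s (Tn n) p @[n --> \oo] --> running s T p.
Proof.
move=> TnT; rewrite running_as_full_integral.
under eq_fun do rewrite running_as_full_integral.
apply: (@Rintegral_dominated R _ (measurableTypeR R) leb setT _ _ (fun u => M * discount alpha u)) => //.
- by move=> n; exact: measurable_run_rate_restricted.
- exact: measurable_run_rate_restricted.
- move=> u _; have [u0|u0] := leP 0 u; last by exact: cvg_cst.
  apply: cvg_near_cst; have := TnT u u0; apply: filterS => n -> //.
- exact: integrable_discount_on.
- move=> n u _; case: ifP => [/andP[u0 _]|_]; first exact: running_rate_bound.
  by rewrite normr0 mulr_ge0// discount_ge0.
Qed.

Lemma exp_small (c e : R) : 0 < c -> 0 < e -> exists2 U : R, 0 <= U &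
  forall t, U <= t -> M * expR (- c * t) <= e.
Proof.
(* By [1 + x <= expR x], it is enough that [c * U = M / e]. *)
move=> c0 e0; exists (M / e / c); first by rewrite !divr_ge0// ltW.
move=> t Ut; rewrite mulNr expRN ler_pdivrMr ?expR_gt0//.
have : M / e <= expR (c * t).
  apply: le_trans (expR_ge1Dx _); rewrite -[leLHS]add0r lerD//.
  by rewrite [leRHS]mulrC -ler_pdivrMr.
by rewrite ler_pdivrMr// mulrC.
Qed.

Lemma terminal_bound_exp s (T : \bar R) p (U : R) : (U%:E <= T)%E ->
  `|terminal s T p| <= M * expR (- alpha * U).
Proof.
case: T => [t| |] //=; rewrite ?normr0 ?mulr_ge0 ?expR_ge0// lee_fin => Ut.
rewrite normrM ger0_norm ?expR_ge0// mulrC ler_pM ?expR_ge0//.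
by rewrite ler_expR !mulNr lerN2 ler_pM2l.
Qed.

Hypothesis F_joint : forall s x, 0 <= s -> O x -> forall e : R, 0 < e ->
  exists2 dl : R, 0 < dl & forall s' y, 0 <= s' -> `|s' - s| < dl ->
    mdist x y < dl -> `|F s' y - F s x| <= e.

(** The dates [bn n] approach [b] from the right. If [b] precedes the exit, the path is still in
    [O], where [F] is jointly continuous, and is right-continuous; if a finite exit comes by [b],
    the terminal payoff is eventually frozen at the exit; if both are infinite, discounting sends it
    to [0]. *)
Lemma path_payoff_cvg s (bn : nat -> \bar R) (b : \bar R) p : 0 <= s -> (0 <= b)%E ->
  (forall u : R, 0 <= u -> \forall n \near \oo, (u%:E <= bn n)%E = (u%:E <= b)%E) ->
  (forall r : R, b = r%:E -> exists2 rn : nat -> R,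
     (\forall n \near \oo, bn n = (rn n)%:E /\ r <= rn n) & rn n @[n --> \oo] --> r) ->
  path_payoff s (bn n) p @[n --> \oo] --> path_payoff s b p.
Proof.
move=> s0 b0 bnb bnr; set e := announced_exit O p.
have e0 : (0 <= e)%E := announced_exit_ge0 O p.
rewrite /path_payoff -/e; apply: cvgD.
  apply: running_cvg => u u0; have := bnb u u0; apply: filterS => n.
  by rewrite !le_min => ->.
have [eb|be] := leP e b; last first.
  case: b b0 be bnb bnr => [r| |]//= r0 re bnb bnr; last by move: re; rewrite ltNge leey.
  rewrite lee_fin in r0.
  have [rn Hrn rnr] := bnr r erefl.
  have Or : O (path_at r p) by exact: announced_exit_in.
  have [n0 re'] : exists2 q : R, r < q & (q%:E <= e)%E.
    case: (e) re => [q| |]//; first by rewrite lte_fin => rq; exists q.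
    by move=> _; exists (r + 1); rewrite ?ltrDl// leey.
  move=> qe; rewrite /terminal.
  have lim : expR (- alpha * rn n) * F (s + rn n) (path_at (rn n) p) @[n --> \oo] -->
      expR (- alpha * r) * F (s + r) (path_at r p).
    apply: cvgM.
      apply: (@cvg_comp _ _ _ (fun n => - alpha * rn n) expR _ (nbhs (- alpha * r))).
        by apply: cvgM => //; exact: cvg_cst.
      exact: continuous_expR.
    apply/cvgrPdist_le => e' e'0.
    have [dl dl0 Hdl] := F_joint (addr_ge0 s0 r0) Or e'0.
    have nbp : nbhs (path_at r p) [set y | mdist (path_at r p) y < dl].
      by apply/metricType_numDomainType.nbhs_mdistP; exists dl.
    have [eta eta0 Heta] := path_at_right nbp.
    near=> n; rewrite distrC; have [_ rrn] : bn n = (rn n)%:E /\ r <= rn n by near: n.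
    have small : `|r - rn n| < Num.min dl eta.
      by near: n; apply: (cvgrPdist_lt _ _).1 => //; rewrite lt_min dl0.
    move: small; rewrite lt_min => /andP[sd se].
    apply: Hdl.
    - by rewrite addr_ge0// (le_trans r0).
    - by rewrite opprD addrACA subrr add0r distrC.
    - apply: Heta; rewrite rrn/= -ltrBlDl -(ger0_norm (x := rn n - r)) ?subr_ge0// distrC; exact: se.
  apply: cvg_trans lim; apply: near_eq_cvg; near=> n.
  have [-> rrn] : bn n = (rn n)%:E /\ r <= rn n by near: n.
  have rq : rn n < n0.
    have : `|r - rn n| < n0 - r.
      by near: n; apply: (cvgrPdist_lt _ _).1 => //; rewrite subr_gt0.
    by rewrite distrC ger0_norm ?subr_ge0// ltrD2r.
  by rewrite min_l// (le_trans _ qe)// lee_fin ltW.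
case: e e0 eb => [r| |]//= r0 eb.
  apply: cvg_near_cst; have := bnb r; rewrite -lee_fin => /(_ r0).
  by apply: filterS => n; rewrite eb => H; rewrite min_r.
have bE : b = +oo%E by apply/eqP; rewrite -leye_eq.
apply/cvgrPdist_le => e' e'0.
have [U U0 HU] := exp_small alpha_gt0 e'0.
have := bnb U U0; apply: filterS => n; rewrite bE leey => Un.
rewrite sub0r normrN (le_trans _ (HU U (lexx U)))//.
by apply: terminal_bound_exp; rewrite min_l// leey.
Unshelve. all: by end_near. Qed.

(** If [b >= eta], the splitting is exact up to the running payoff before [eta]. If [b < eta], the
    terminal payoffs at [b] and at [eta] are both within [e] of [F s x0], because the path has
    stayed in the ball; hence [2 * e]. *)
Lemma path_payoff_delay s (eta r e : R) (x0 : E) (b : \bar R) p :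
  0 <= s -> 0 <= eta -> (0 <= b)%E ->
  (forall u y, 0 <= u <= eta -> mdist x0 y <= r ->
     `|expR (- alpha * u) * F (s + u) y - F s x0| <= e) ->
  (eta%:E < hitting_time [set y | (r < mdist x0 y)%R] p)%E ->
  (eta%:E < announced_exit O p)%E ->
  `|path_payoff s b p - expR (- alpha * eta) *
      path_payoff (s + eta) (maxe (b - eta%:E) 0)%E (path_shift eta p)| <=
  M * eta + 2 * e.
Proof.
move=> s0 eta0 b0 osc hit ex.
have e0 : 0 <= e.
  apply: le_trans (osc 0 x0 _ _); rewrite ?lexx ?mdistxx//.
  have : ~~ (r < mdist x0 (path_at 0 p)).
    apply/negP => rp; have := hitting_time_le (lexx 0) (rp : [set y | r < mdist x0 y] _).
    by move=> /(lt_le_trans hit); rewrite lte_fin ltNge eta0.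
  by rewrite -leNgt; apply: le_trans; exact: mdist_ge0.
have stay u : 0 <= u <= eta -> mdist x0 (path_at u p) <= r.
  move=> /andP[u0 ue]; rewrite leNgt; apply/negP => rp.
  have := hitting_time_le u0 (rp : [set y | r < mdist x0 y] (path_at u p)).
  by move=> /(lt_le_trans hit); rewrite lte_fin ltNge ue.
have [etab|beta] := leP eta%:E b.
  rewrite max_l ?sube_ge0// (path_payoff_split s eta0 etab ex) addrK.
  by rewrite (le_trans (running_before_bound s p eta0))// lerDl mulr_ge0.
case: b b0 beta => [t| |]//; rewrite lee_fin lte_fin => t0 te.
rewrite max_r; last by rewrite -EFinB lee_fin subr_le0 ltW.
rewrite path_payoff0 path_shiftE// addr0.
rewrite /path_payoff min_l; last by rewrite (le_trans _ (ltW ex))// lee_fin ltW.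
have h1 : `|running s t%:E p| <= M * eta.
  have lebt : leb `[0, t]%classic = t%:E.
    by rewrite lebesgue_measure_itv/= lte_fin; case: ltgtP t0 => // [_|<-]; rewrite ?sube0.
  rewrite /running run_set_E.
  have := @Rintegral_finite_bound R `[0, t]%classic (running_rate s p) M.
  rewrite lebt /= => H; rewrite (le_trans (H _ _ _ _))//.
  - by rewrite ltry.
  - apply: measurable_funTS.
    exact: (measurable_rate_along s p).
  - move=> u; rewrite /= in_itv/= => /andP[u0 _].
    rewrite (le_trans (running_rate_bound s p u0))// -[leRHS]mulr1 ler_wpM2l//.
    by rewrite /discount u0 expRN_le1// ltW.
  - by rewrite ler_wpM2l// ltW.
have h2 := osc t (path_at t p) _ _; have h3 := osc eta (path_at eta p) _ _.
have {}h2 : `|expR (- alpha * t) * F (s + t) (path_at t p) - F s x0| <= e.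
  by apply: h2; [rewrite t0 ltW|apply: stay; rewrite t0 ltW].
have {}h3 : `|expR (- alpha * eta) * F (s + eta) (path_at eta p) - F s x0| <= e.
  by apply: h3; [rewrite eta0 lexx|apply: stay; rewrite eta0 lexx].
rewrite /terminal -addrA (le_trans (ler_normD _ _))// lerD//.
set A1 := _ * F _ _; set A2 := _ * F _ _.
have -> : A1 - A2 = (A1 - F s x0) - (A2 - F s x0) by rewrite opprB addrA subrK.
rewrite (le_trans (ler_normB _ _))//.
have -> : 2 * e = e + e by rewrite mulr2n mulrDl mul1r.
exact: lerD.
Qed.

(** The discount is split into two factors [expR (- (alpha / 2) * u)]: one makes everything after
    [U] small, the other is left over and gives [(alpha / 2)^-1] by integration in the running part
    and at most [1] in the terminal part. *)
Lemma path_payoff_time s s' (U e : R) (b : \bar R) p : 0 <= U -> 0 <= e -> (0 <= b)%E ->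
  (forall u, 0 <= u <= U -> `|f (s + u) (path_at u p) - f (s' + u) (path_at u p)| <= e) ->
  (forall u, 0 <= u <= U -> `|F (s + u) (path_at u p) - F (s' + u) (path_at u p)| <= e) ->
  `|path_payoff s b p - path_payoff s' b p| <=
  (e + 2 * M * expR (- (alpha / 2) * U)) * ((alpha / 2)^-1 + 1).
Proof.
move=> U0 e0 b0 fe Fe; set c := e + _.
have a2 : 0 < alpha / 2 by rewrite divr_gt0.
have c0 : 0 <= c by rewrite addr_ge0// !mulr_ge0// expR_ge0.
have exp_half u : expR (- alpha * u) = expR (- (alpha / 2) * u) * expR (- (alpha / 2) * u).
  by rewrite -expRD; congr expR; field.
have exp1 u : 0 <= u -> expR (- (alpha / 2) * u) <= 1.
  by move=> u0; rewrite expRN_le1// ltW.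
have key u (x y : R) : 0 <= u -> (u <= U -> `|x - y| <= e) -> `|x| <= M -> `|y| <= M ->
    `|expR (- alpha * u) * x - expR (- alpha * u) * y| <= c * expR (- (alpha / 2) * u).
  move=> u0 xye xM yM; rewrite -mulrBr normrM ger0_norm ?expR_ge0// exp_half -mulrA mulrC.
  rewrite ler_pM2r ?expR_gt0//; have [uU|Uu] := leP u U.
    rewrite (le_trans (ler_pM _ _ (exp1 _ u0) (xye uU)))//.
    by rewrite mul1r /c lerDl !mulr_ge0// expR_ge0.
  rewrite /c -[leLHS]add0r lerD// mulrC ler_pM ?expR_ge0//.
    rewrite (le_trans (ler_normB _ _))// mulr2n mulrDl mul1r lerD//.
  by rewrite ler_expR !mulNr lerN2 ler_pM2l// ltW.
set T := mine b (announced_exit O p).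
have T0 : (0 <= T)%E by rewrite le_min b0 announced_exit_ge0.
rewrite /path_payoff -/T.
have -> : running s T p + terminal s T p - (running s' T p + terminal s' T p) =
  (running s T p - running s' T p) + (terminal s T p - terminal s' T p).
  by rewrite opprD addrACA.
rewrite (le_trans (ler_normD _ _))// mulrDr mulr1 lerD//.
  have mS := measurable_run_set T.
  have iS z : leb.-integrable [set u : R | 0 <= u /\ (u%:E <= T)%E] (EFin \o running_rate z p).
    by apply: integrable_running_rate => // u [].
  rewrite /running -RintegralB//.
  apply: integral_le_discount => //; first by move=> u [].
    apply: measurable_funTS; apply: measurable_funB;
    exact: measurable_rate_along.
  move=> u [u0 uT]; rewrite /discount u0; apply: key => // uU.
  by apply: fe; rewrite u0.
rewrite /terminal; case: T T0 => [t| |]//=; last by rewrite subrr normr0.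
rewrite lee_fin => t0; rewrite (le_trans (key _ _ _ t0 _ _ _))//.
  by move=> tU; apply: Fe; rewrite t0.
by rewrite -[leRHS]mulr1 ler_wpM2l// exp1.
Qed.

End payoff_functional.

(** Once [1 / (n + 1) < r], the set [near_complement O n] does not meet the closed ball of radius
    [r], because the open ball of radius [2 * r] lies in [O]. *)
Lemma announced_exit_gt_ball {R : realType} {E : pmetricType R} (O : set E)
    (x0 : E) (r : R) (p : rc_path E) (t : \bar R) : 0 < r ->
  (forall y, mdist x0 y < 2 * r -> O y) ->
  (t < hitting_time [set y | (r < mdist x0 y)%R] p)%E -> (t < announced_exit O p)%E.
Proof.
move=> r0 HO tr; apply/announced_exit_gtP.
have [n _ Hn] := near_infty_natSinv_lt (PosNum r0).
have /= nr := Hn n (leqnn n).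
exists n; rewrite (lt_le_trans tr)//; apply: hitting_time_subset => x [y nOy xy] /=.
rewrite ltNge; apply/negP => xr; apply: nOy; apply: HO.
rewrite (le_lt_trans (metric_triangle _ x _))//.
have -> : 2 * r = r + r by rewrite mulr2n mulrDl mul1r.
by rewrite ler_ltD// (lt_trans xy).
Qed.

(** * Dynamic programming *)

Section dyadic_rounding.
Context {R : realType}.
Implicit Types (n m : nat) (r u : R) (b : \bar R).

Definition mesh n : R := (2 ^+ n)^-1.

Lemma mesh_gt0 n : 0 < mesh n. Proof. by rewrite invr_gt0 exprn_gt0. Qed.

Lemma mesh_cvg r : 0 < r -> \forall n \near \oo, mesh n < r.
Proof.
move=> r0; have := near_infty_natSinv_expn_lt (PosNum r0); apply: filterS => n /=.
by rewrite div1r.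
Qed.

(** The number of mesh steps to the first dyadic date strictly after [b], capped at date [n], which
    also stands for infinity. Because rounding is strict, below the cap [rounded n b <= m] means
    [b < m * mesh n]. *)
Definition rounded n b : nat :=
  if b is r%:E then minn (Num.truncn (r * 2 ^+ n)).+1 (n * 2 ^ n) else (n * 2 ^ n)%N.

Lemma rounded_le n b : (rounded n b <= n * 2 ^ n)%N.
Proof. by case: b => [r| |]//=; rewrite geq_minr. Qed.

Lemma rounded_leE n m b : (0 <= b)%E ->
  (rounded n b <= m)%N = (n * 2 ^ n <= m)%N || (b < (m%:R * mesh n)%:E)%E.
Proof.
case: b => [r| |]//=; rewrite ?orbF// lee_fin => r0.
have r20 : 0 <= r * 2 ^+ n by rewrite mulr_ge0// exprn_ge0.
by rewrite geq_min truncn_lt_nat// orbC lte_fin /mesh ltr_pdivlMr// exprn_gt0.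
Qed.

Lemma rounded_itv r : 0 <= r -> \forall n \near \oo,
  r < (rounded n r%:E)%:R * mesh n <= r + mesh n.
Proof.
move=> r0; exists (Num.truncn r).+2 => // n /= rn.
have r20 : 0 <= r * 2 ^+ n by rewrite mulr_ge0// exprn_ge0.
have p0 : 0 < (2 : R) ^+ n by rewrite exprn_gt0.
have tr := truncn_itv r20.
rewrite (minn_idPl _); last first.
  rewrite truncn_lt_nat// natrM natrX ltr_pM2r//.
  rewrite (lt_le_trans (truncnS_gt r))// ler_nat; exact: ltnW.
rewrite /mesh ltr_pdivlMr// (andP tr).2/=.
by rewrite -(natr1 (Num.truncn _)) mulrDl mul1r lerD2r ler_pdivrMr// (andP tr).1.
Qed.

Lemma rounded_cvg r : 0 <= r ->
  (rounded n r%:E)%:R * mesh n @[n --> \oo] --> r.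
Proof.
move=> r0; apply/cvgrPdist_le => e e0.
have h1 := rounded_itv r0; have h2 := mesh_cvg e0.
near=> n.
have mn : mesh n < e by near: n.
have /andP[h3 h4] : r < (rounded n r%:E)%:R * mesh n <= r + mesh n by near: n.
by rewrite ler_norml; apply/andP; split; lra.
Unshelve. all: by end_near. Qed.

Lemma rounded_ge (u : R) b : (0 <= b)%E -> \forall n \near \oo,
  (u%:E <= ((rounded n b)%:R * mesh n)%:E)%E = (u%:E <= b)%E.
Proof.
case: b => [r| |]//; last first.
  move=> _; exists (Num.truncn u).+1 => // n /= un.
  rewrite leey lee_fin natrM natrX /mesh mulfK ?expf_neq0//.
  by rewrite ltW// (lt_le_trans (truncnS_gt u))// ler_nat.
rewrite lee_fin => r0; have h1 := rounded_itv r0.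
have [ur|ru] := leP u r.
  apply: filterS h1 => n /andP[h _]; rewrite !lee_fin ur; apply/idP.
  by rewrite (le_trans ur)// ltW.
have ur0 : 0 < u - r by lra.
have h2 := mesh_cvg ur0; near=> n.
have mn : mesh n < u - r by near: n.
have /andP[_ h4] : r < (rounded n r%:E)%:R * mesh n <= r + mesh n by near: n.
by rewrite !lee_fin [RHS]leNgt ru; apply/negbTE; rewrite -ltNge; lra.
Unshelve. all: by end_near. Qed.

End dyadic_rounding.

Fixpoint running_max {R : realType} (v : nat -> R) n : R :=
  if n is m.+1 then Num.max (running_max v m) (v n) else v 0%N.

Section dynamic_programming.
Context {R : realType} {E : pmetricType R} {d : measure_display}
  {Omega : measurableType d}.
Context {Filt : R -> set (set Omega)} {X : R -> Omega -> E}
  {P : E -> probability Omega R}.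
Hypothesis std : standard_Markov_process Filt X P.
Local Notation D := (path_space E).
Local Notation leb := (@lebesgue_measure R).
Local Notation future := (future std).

Variables (O : set E) (alpha : R) (f F : R -> E -> R) (M : R).
Hypothesis alpha_gt0 : 0 < alpha.
Hypothesis mf : measurable_fun [set: R * borel E] (fun z => f z.1 z.2).
Hypothesis mF : measurable_fun [set: R * borel E] (fun z => F z.1 z.2).
Hypothesis fM : forall s x, `|f s x| <= M.
Hypothesis FM : forall s x, `|F s x| <= M.
Local Notation Psi := (path_payoff O alpha f F).
Local Notation before := (running_before alpha f).

Let M_ge0 : 0 <= M. Proof. exact: le_trans (normr_ge0 _) (fM 0 point). Qed.

(** A constant rate [M] kept for ever yields [M / alpha]; [running_split] applied to it evaluates
    the integral of the discount over [[0, dl[]. In this form the bound combines with a discounted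
    [C] to give back at most [C]. *)
Lemma running_before_sharp_bound s dl p : 0 <= dl ->
  `|before s dl p| <= M / alpha * (1 - expR (- alpha * dl)).
Proof.
move=> dl0; pose cM (_ : R) (_ : E) := M.
have mcM : measurable_fun [set: R * borel E] (fun z => cM z.1 z.2) by exact: measurable_cst.
have cMM s' x : `|cM s' x| <= M by rewrite ger0_norm.
have run z q : running alpha cM z +oo%E q = M / alpha.
  rewrite (running_as_full_integral alpha cM).
  under eq_Rintegral => u _.
    rewrite (_ : (if _ then _ else _) = M * discount alpha u); last first.
      by rewrite leey andbT /discount /running_rate /cM; case: ifP; rewrite ?mulr0// mulrC.
    over.
  by rewrite RintegralZl// ?Rintegral_discount//; exact: integrable_discount.
have := @running_split _ _ alpha cM M alpha_gt0 mcM cMM s dl +oo%E p dl0 (leey _).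
rewrite addey// !run => E1.
have -> : M / alpha * (1 - expR (- alpha * dl)) = running_before alpha cM s dl p.
  by rewrite mulrBr mulr1 {1}E1 [expR _ * _]mulrC addrK.
have S0 : `[0%R, dl[%classic `<=` [set u : R | 0 <= u].
  by move=> u /=; rewrite in_itv/= => /andP[].
have i1 := @integrable_running_rate _ _ alpha f M alpha_gt0 mf fM s p `[0%R, dl[%classic (measurable_itv _) S0.
have i2 := @integrable_running_rate _ _ alpha cM M alpha_gt0 mcM cMM s p `[0%R, dl[%classic (measurable_itv _) S0.
rewrite /running_before (le_trans (le_normr_Rintegral _ i1))//.
apply: le_Rintegral => //; first exact: integrable_norm.
by move=> u _; rewrite /running_rate normrM ger0_norm ?expR_ge0// ler_pM2l ?expR_gt0.
Qed.

Let C : R := M / alpha + M.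
Let C_ge0 : 0 <= C. Proof. by rewrite addr_ge0// divr_ge0// ltW. Qed.

Lemma measurable_payoff_section (s : R) : measurable_fun [set: borel E] (F s : borel E -> R).
Proof.
by apply: (measurableT_comp mF (g := fun y : borel E => (s, y))); exact: measurable_fun_pair.
Qed.

Lemma bounded_measurable_F s : bounded_measurable (F s : borel E -> R).
Proof. by split; [exact: measurable_payoff_section|exists M => y]. Qed.

Lemma bounded_measurable_payoff (s t : R) (b : Omega -> \bar R) : 0 <= t ->
  measurable_fun setT b -> (forall w, (0 <= b w)%E) ->
  bounded_measurable (fun w => Psi s (b w) (future t w)).
Proof.
move=> t0 mb b0; split.
  apply: (measurable_path_payoff O alpha mf mF s) => //.
  exact: measurable_future.
by exists C => w; exact: (path_payoff_bound O alpha_gt0 mf fM FM).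
Qed.

Definition on_grid (t dl : R) (N : nat) (tau : Omega -> \bar R) : Prop :=
  forall w, exists2 j : nat, (j <= N)%N & tau w = (t + j%:R * dl)%:E.

Lemma on_grid_ge t dl N tau w : 0 <= dl -> on_grid t dl N tau -> (t%:E <= tau w)%E.
Proof. by move=> dl0 gt; have [j _ ->] := gt w; rewrite lee_fin lerDl mulr_ge0. Qed.

Lemma measurable_sub_time (tau : Omega -> \bar R) (t : R) : stopping_time Filt tau ->
  measurable_fun setT (fun w => tau w - t%:E)%E.
Proof.
by move=> stau; apply: emeasurable_funB => //; exact: (measurable_stopping_time std).
Qed.

Section one_step.
Variables (s t dl : R) (V' : E -> R).
Hypothesis t0 : 0 <= t.
Hypothesis dl_gt0 : 0 < dl.
Hypothesis mV' : measurable_fun [set: borel E] (V' : borel E -> R).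
Hypothesis V'C : forall y, `|V' y| <= C.

Definition one_step_gain (p : rc_path E) : R :=
  if (dl%:E < announced_exit O p)%E then before s dl p else Psi s dl%:E p.

(** The payoff when stopping is ruled out before [dl]: paths that exit by then are settled in
    [one_step_gain], the surviving ones receive [V'] at [dl]. *)
Definition one_step (p : rc_path E) : R :=
  one_step_gain p +
  expR (- alpha * dl) * ((dl%:E < announced_exit O p)%E%:R * V' (path_at dl p)).

Let dl0 : 0 <= dl := ltW dl_gt0.

Lemma measurable_survival :
  measurable_fun [set: D] (fun p : D => (dl%:E < announced_exit O p)%E).
Proof.
apply: (measurable_fun_bool true); rewrite setTI.
rewrite (_ : _ @^-1` _ = [set p : D | (dl%:E < announced_exit O p)%E]); last first.
  by apply/seteqP; split.
rewrite -[X in measurable X]setTI; apply: emeasurable_fun_o_infty => //.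
exact: measurable_announced_exit.
Qed.

Let bV' : bounded_measurable (V' : borel E -> R).
Proof. by split => //; exists C. Qed.

Lemma bounded_measurable_gain : bounded_measurable (one_step_gain : D -> R).
Proof.
split.
  apply: measurable_fun_ifT; first exact: measurable_survival.
    exact: (measurable_running_before alpha mf s dl0).
  by apply: (measurable_path_payoff O alpha mf mF s) => // _; rewrite ?lee_fin.
exists (M * dl + C) => p; rewrite /one_step_gain; case: ifP => _.
  by rewrite (le_trans (running_before_bound alpha_gt0 mf fM s p dl0))// lerDl.
by rewrite (le_trans (path_payoff_bound O alpha_gt0 mf fM FM s p _))// ?lee_fin// lerDr mulr_ge0.
Qed.

Lemma bounded_measurable_one_step : bounded_measurable (one_step : D -> R).
Proof.
apply: bounded_measurableD; first exact: bounded_measurable_gain.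
apply: bounded_measurableZ; apply: bounded_measurableM.
  split; last by exists 1 => p; case: (_ < _)%E; rewrite ?normr1 ?normr0.
  rewrite (_ : (fun p => _) = (fun p : D => if (dl%:E < announced_exit O p)%E then 1 else 0 : R)).
    by apply: measurable_fun_ifT => //; exact: measurable_survival.
  by apply/funext => p; case: ifP.
split; last by exists C.
by apply: (measurableT_comp mV'); exact: measurable_path_at.
Qed.

(** The weights [1 - expR (- alpha * dl)] and [expR (- alpha * dl)] on [M / alpha] add up to one and
    the terminal part only shrinks, so [C] is invariant under backward steps. *)
Lemma one_step_bound p : `|one_step p| <= C.
Proof.
rewrite /one_step /one_step_gain; case: ifP => _; last first.
  rewrite mul0r mulr0 addr0; apply: (path_payoff_bound O alpha_gt0 mf fM FM).
  by rewrite lee_fin.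
rewrite mul1r (le_trans (ler_normD _ _))//.
have e1 : expR (- alpha * dl) <= 1.
  by rewrite expRN_le1// ltW.
have h1 := running_before_sharp_bound s p dl0.
have h2 : `|expR (- alpha * dl) * V' (path_at dl p)| <= expR (- alpha * dl) * C.
  by rewrite normrM ger0_norm ?expR_ge0// ler_pM2l ?expR_gt0.
apply: (le_trans (lerD h1 h2)); rewrite /C.
have -> : M / alpha * (1 - expR (- alpha * dl)) + expR (- alpha * dl) * (M / alpha + M) =
    M / alpha + expR (- alpha * dl) * M by move: (M / alpha) (expR _) => u v; ring.
by rewrite lerD2l ler_piMl.
Qed.

Lemma mean_one_step (A : set Omega) (x : E) : Filt t A ->
  \int[P x]_w (\1_A w * path_mean std one_step (X t w)) =
  \int[P x]_w (\1_A w * one_step_gain (future t w)) +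
  expR (- alpha * dl) * \int[P x]_w
   (\1_(A `&` [set w | (dl%:E < announced_exit O (future t w))%E]) w * V' (X (t + dl) w)).
Proof.
move=> FA; rewrite -(functional_Markov std bounded_measurable_one_step).2//.
have bA := @bounded_measurable_indic _ _ R _ (filt_measurable std t0 FA).
have FS : Filt (t + dl) [set w | (dl%:E < announced_exit O (future t w))%E].
  exact: filt_exit_future.
have td0 : 0 <= t + dl by rewrite addr_ge0.
have bS := @bounded_measurable_indic _ _ R _ (measurableI _ _ (filt_measurable std t0 FA) (filt_measurable std td0 FS)).
have bVX := bounded_measurable_X std td0 bV'.
rewrite -meanZ; last exact: bounded_measurableM.
rewrite -meanD; last 2 first.
- apply: bounded_measurableM => //.
  exact: (bounded_measurable_future std t0 bounded_measurable_gain).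
- by apply: bounded_measurableZ; exact: bounded_measurableM.
apply: eq_Rintegral => w _; rewrite /one_step mulrDr; congr (_ + _).
rewrite indicI/= futureE// mulrCA; congr (_ * _); rewrite -mulrA; congr (_ * (_ * _)).
by rewrite indicE; congr (_%:R); congr nat_of_bool; apply/idP/idP; [exact: mem_set|exact: set_mem].
Qed.

(** [tau1] is tied to [tau] off [B] only, so one identity serves twice: with the maximum of [tau]
    and [t + dl] for the upper bound, and with an optimal continuation for equality. *)
Lemma mean_payoff_step (A B : set Omega) (tau tau1 : Omega -> \bar R) (x : E) :
  Filt t A -> Filt t B -> stopping_time Filt tau -> stopping_time Filt tau1 ->
  (forall w, B w -> tau w = t%:E) -> (forall w, ~ B w -> tau w = tau1 w) ->
  (forall w, ((t + dl)%:E <= tau1 w)%E) ->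
  \int[P x]_w (\1_A w * Psi s (tau w - t%:E)%E (future t w)) =
  \int[P x]_w (\1_(A `&` B) w * F s (X t w)) +
  (\int[P x]_w (\1_(A `&` ~` B) w * one_step_gain (future t w)) +
   expR (- alpha * dl) * \int[P x]_w
    (\1_(A `&` ~` B `&` [set w | (dl%:E < announced_exit O (future t w))%E]) w *
      Psi (s + dl) (tau1 w - (t + dl)%:E)%E (future (t + dl) w))).
Proof.
move=> FA FB stau stau1 tauB tauNB tau1_ge.
have FS : Filt (t + dl) [set w | (dl%:E < announced_exit O (future t w))%E].
  exact: filt_exit_future.
have td0 : 0 <= t + dl by rewrite addr_ge0.
have mA := filt_measurable std t0 FA; have mB := filt_measurable std t0 FB.
have mS := filt_measurable std td0 FS.
have bF := bounded_measurable_X std t0 (bounded_measurable_F s).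
have bG := bounded_measurable_future std t0 bounded_measurable_gain.
have bPsi : bounded_measurable (fun w => Psi (s + dl) (tau1 w - (t + dl)%:E)%E (future (t + dl) w)).
  apply: bounded_measurable_payoff => //; first exact: measurable_sub_time.
  by move=> w; rewrite sube_ge0.
have bi (S : set Omega) : measurable S -> @bounded_measurable _ _ R (\1_S) by exact: bounded_measurable_indic.
have mAB : measurable (A `&` B) by exact: measurableI.
have mANB : measurable (A `&` ~` B) by apply: measurableI => //; exact: measurableC.
have b3 := bounded_measurableM (bi _ (measurableI _ _ mANB mS)) bPsi.
have b2 := bounded_measurableM (bi _ mANB) bG.
have b1 := bounded_measurableM (bi _ mAB) bF.
rewrite -meanZ// -meanD//; last exact: bounded_measurableZ.
rewrite -meanD//; last by apply: bounded_measurableD => //; exact: bounded_measurableZ.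
apply: eq_Rintegral => w _.
have [Aw|nAw] := pselect (A w); last first.
  by rewrite !indicE !memNset ?mul0r ?mulr0 ?addr0//= => [[[]]|[]|[]].
have [Bw|nBw] := pselect (B w).
  rewrite tauB// subee// path_payoff0 futureE// addr0.
  rewrite !indicE (mem_set Aw) (mem_set (conj Aw Bw : (A `&` B) w)).
  by rewrite !memNset ?mul0r ?mulr0 ?addr0//= => [[[]]|[]].
rewrite tauNB// !indicE (mem_set Aw) (mem_set (conj Aw nBw : (A `&` ~` B) w)).
rewrite memNset ?mul0r ?add0r ?mul1r; last by move=> [].
rewrite /one_step_gain; case: ifPn => Sw.
  rewrite mem_set// mul1r (path_payoff_split F alpha_gt0 mf fM s dl0 _ Sw); last first.
    by rewrite leeBrDr// -EFinD addrC.
  by rewrite future_shift// EFinD fin_num_oppeD// addeA.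
rewrite memNset ?mul0r ?mulr0 ?addr0; last by move=> [_ /= H]; move/negP: Sw.
apply: path_payoff_exited; first by rewrite leNgt.
by rewrite leeBrDr// -EFinD addrC.
Qed.

End one_step.

Lemma filt_preimage (t : R) (B : set (borel E)) : 0 <= t -> measurable B -> Filt t [set w | B (X t w)].
Proof. by move=> t0 mB; exact: (standard_adapted std t0). Qed.

(** Backward induction on the number of remaining dates, where [s] and [t] advance together. Testing
    against every [A] in [Filt t] replaces conditional expectations and lets the induction
    hypothesis act on the random event where the process goes on and survives. *)
Theorem grid_value (dl : R) (N : nat) : 0 < dl -> forall (s t : R), 0 <= t ->
  exists V : E -> R, [/\ measurable_fun [set: borel E] (V : borel E -> R),
    forall y, `|V y| <= C,
    forall tau, stopping_time Filt tau -> on_grid t dl N tau ->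
      forall A x, Filt t A ->
      \int[P x]_w (\1_A w * Psi s (tau w - t%:E)%E (future t w)) <=
      \int[P x]_w (\1_A w * V (X t w)) &
    exists tau, [/\ stopping_time Filt tau, on_grid t dl N tau &
      forall A x, Filt t A ->
      \int[P x]_w (\1_A w * Psi s (tau w - t%:E)%E (future t w)) =
      \int[P x]_w (\1_A w * V (X t w))]].
Proof.
move=> dl_gt0; have dl0 := ltW dl_gt0.
elim: N => [|N IH] s t t0.
  have E0 tau A x : on_grid t dl 0 tau ->
      \int[P x]_w (\1_A w * Psi s (tau w - t%:E)%E (future t w)) =
      \int[P x]_w (\1_A w * F s (X t w)).
    move=> gt; apply: eq_Rintegral => w _; have [j] := gt w.
    rewrite leqn0 => /eqP -> ->; rewrite mul0r addr0 subee// path_payoff0 futureE// addr0//.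
  exists (F s); split.
  - exact: measurable_payoff_section.
  - by move=> y; rewrite (le_trans (FM s y))// lerDr divr_ge0// ltW.
  - by move=> tau stau gt A x FA; rewrite E0.
  - have g0 : on_grid t dl 0 (fun=> t%:E) by move=> w; exists 0%N; rewrite ?mul0r ?addr0.
    exists (fun=> t%:E); split => //; first exact: (stopping_time_cst std t0).
    by move=> A x FA; exact: E0.
have td0 : 0 <= t + dl by rewrite addr_ge0.
have [V' [mV' V'C V'i [tau' [stau' gtau' tau'E]]]] := IH (s + dl) (t + dl) td0.
pose Phi := path_mean std (one_step s dl V').
have bos := bounded_measurable_one_step s dl_gt0 mV' V'C.
have bPhi : bounded_measurable (Phi : borel E -> R) by exact: bounded_measurable_path_mean.
have PhiC y : `|Phi y| <= C.
  by apply: bounded_path_mean => [|p]; [exact: bos.1|exact: one_step_bound].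
(* Bellman's equation: stop now, or continue for one mesh step. *)
pose V y := Num.max (F s y) (Phi y).
have bV : bounded_measurable (V : borel E -> R).
  by apply: bounded_measurable_max => //; exact: bounded_measurable_F.
have VC y : `|V y| <= C.
  rewrite /V; case: (leP (F s y) (Phi y)) => _ //.
  by rewrite (le_trans (FM s y))// lerDr divr_ge0// ltW.
have tdN j : t + dl + j%:R * dl = t + j.+1%:R * dl by rewrite -(natr1 j) mulrDl mul1r; lra.
have bi (S : set Omega) : measurable S -> @bounded_measurable _ _ R (\1_S) by exact: bounded_measurable_indic.
have bFX := bounded_measurable_X std t0 (bounded_measurable_F s).
have bPX := bounded_measurable_X std t0 bPhi.
have bVX := bounded_measurable_X std t0 bV.
exists V; split; [by case: bV|exact: VC| |].
- move=> tau stau gt A x FA; pose B := [set w | (tau w <= t%:E)%E].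
  have FB : Filt t B by have [_] := stau; exact.
  have FNB : Filt t (~` B) by apply: (filtC std).
  (* Off [B] the earliest grid date is [t + dl], so [tau1] differs from [tau] only where stopping
     has already occurred. *)
  pose tau1 w := maxe (tau w) (t + dl)%:E.
  have stau1 : stopping_time Filt tau1.
    exact: (stopping_time_max std stau (stopping_time_cst std td0)).
  have tauB w : B w -> tau w = t%:E.
    by move=> Bw; apply/eqP; rewrite eq_le Bw (on_grid_ge w dl0 gt).
  have ge1 w : ~ B w -> ((t + dl)%:E <= tau w)%E.
    rewrite /B/=; have [[|j] _ ->] := gt w; rewrite ?mul0r ?addr0 ?lexx// => _.
    by rewrite lee_fin lerD2l -natr1 mulrDl mul1r lerDr mulr_ge0.
  have gt1 : on_grid (t + dl) dl N tau1.
    move=> w; rewrite /tau1; have [j jN E1] := gt w.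
    case: j jN E1 => [|j] jN E1.
      by exists 0%N => //; rewrite E1 !mul0r !addr0 max_r// lee_fin lerDl.
    exists j => //; rewrite E1 tdN max_l// lee_fin -tdN lerDl mulr_ge0//.
  rewrite (@mean_payoff_step s t dl t0 dl_gt0 A B tau tau1 x)//; last 2 first.
  + by move=> w nBw; rewrite /tau1 max_l// ge1.
  + by move=> w; rewrite /tau1 le_max lexx orbT.
  have FANB : Filt t (A `&` ~` B) by exact: (filtI std).
  have FANBS : Filt (t + dl) (A `&` ~` B `&` [set w | (dl%:E < announced_exit O (future t w))%E]).
    apply: (filtI std) => //; last exact: filt_exit_future.
    by apply: (filt_le std t0 _ FANB); rewrite lerDl.
  apply: (@le_trans _ _ (\int[P x]_w (\1_(A `&` B) w * F s (X t w)) +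
     \int[P x]_w (\1_(A `&` ~` B) w * Phi (X t w)))).
    rewrite lerD2l (mean_one_step s t0 dl_gt0 mV' V'C x FANB) lerD2l ler_pM2l ?expR_gt0//.
    exact: V'i.
  have mAB : measurable (A `&` B) by apply: (filt_measurable std t0); exact: (filtI std).
  have mANB := filt_measurable std t0 FANB.
  rewrite -meanD; [|by apply: bounded_measurableM; [exact: bi|]|by apply: bounded_measurableM; [exact: bi|]].
  apply: le_mean.
  + by apply: bounded_measurableD; apply: bounded_measurableM => //; exact: bi.
  + by apply: bounded_measurableM => //; apply: bi; exact: (filt_measurable std t0 FA).
  move=> w; rewrite !indicE; have [Aw|nAw] := pselect (A w); last first.
    by rewrite !memNset ?mul0r ?addr0//= => [[]|[]].
  rewrite (mem_set Aw) mul1r; have [Bw|nBw] := pselect (B w).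
    rewrite (mem_set (conj Aw Bw : (A `&` B) w)) memNset; last by move=> [].
    by rewrite mul0r addr0 mul1r le_max lexx.
  rewrite (mem_set (conj Aw nBw : (A `&` ~` B) w)) memNset; last by move=> [].
  by rewrite mul0r add0r mul1r le_max lexx orbT.
- pose B := [set w | Phi (X t w) <= F s (X t w)].
  have FB : Filt t B.
    apply: (@filt_preimage t [set y | Phi y <= F s y] t0).
    have mle : measurable_fun [set: borel E] (fun y : borel E => Phi y <= F s y).
      by apply: measurable_fun_ler; [case: bPhi|exact: measurable_payoff_section].
    by rewrite -[X in measurable X]setTI; exact: (mle measurableT [set true] I).
  (* Stop at [t] where this pays at least as much as continuing; otherwise follow the optimal rule
     of the remaining grid. *)
  pose tau w := if Phi (X t w) <= F s (X t w) then t%:E else tau' w.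
  have tau'_ge w : ((t + dl)%:E <= tau' w)%E := on_grid_ge w dl0 gtau'.
  have stau : stopping_time Filt tau.
    split=> [w|u u0]; first by rewrite /tau; case: ifP => _; [rewrite lee_fin|case: stau'].
    have [ut|tu] := ltP u t.
      rewrite (_ : mkset _ = set0); first exact: (filt0 std).
      rewrite -subset0 => w /=; rewrite /tau; case: ifP => _; first by rewrite lee_fin leNgt ut.
      move=> /(le_trans (tau'_ge w)); rewrite lee_fin leNgt => /negP; apply.
      by rewrite (lt_le_trans ut)// lerDl.
    rewrite (_ : mkset _ = B `|` (~` B `&` [set w | (tau' w <= u%:E)%E])).
      have FBu : Filt u B by exact: (filt_le std t0 tu FB).
      apply: (filtU std) => //; apply: (filtI std) => //; first exact: (filtC std).
      by case: stau' => _; exact.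
    apply/seteqP; split => w; rewrite /tau /B /=; case: ifP => Bw.
    + by left.
    + by right.
    + by rewrite lee_fin.
    + by case=> // -[].
  have gt : on_grid t dl N.+1 tau.
    move=> w; rewrite /tau; case: ifP => _; first by exists 0%N; rewrite // mul0r addr0.
    by have [j jN ->] := gtau' w; exists j.+1; rewrite ?tdN.
  exists tau; split => // A x FA.
  rewrite (@mean_payoff_step s t dl t0 dl_gt0 A B tau tau' x)//; last 2 first.
  + by move=> w Bw; rewrite /tau (Bw : Phi (X t w) <= F s (X t w)).
  + by move=> w nBw; rewrite /tau; case: ifP.
  have FANB : Filt t (A `&` ~` B) by apply: (filtI std) => //; exact: (filtC std).
  have FANBS : Filt (t + dl) (A `&` ~` B `&` [set w | (dl%:E < announced_exit O (future t w))%E]).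
    apply: (filtI std) => //; last exact: filt_exit_future.
    by apply: (filt_le std t0 _ FANB); rewrite lerDl.
  rewrite tau'E// -(mean_one_step s t0 dl_gt0 mV' V'C x FANB) -/Phi.
  have mAB : measurable (A `&` B) by apply: (filt_measurable std t0); exact: (filtI std).
  have mANB := filt_measurable std t0 FANB.
  rewrite -meanD; [|by apply: bounded_measurableM; [exact: bi|]|by apply: bounded_measurableM; [exact: bi|]].
  apply: eq_Rintegral => w _; rewrite !indicE; have [Aw|nAw] := pselect (A w); last first.
    by rewrite !memNset ?mul0r ?addr0//= => [[]|[]].
  rewrite (mem_set Aw) mul1r; have [Bw|nBw] := pselect (B w).
    rewrite (mem_set (conj Aw Bw : (A `&` B) w)) memNset; last by move=> [].
    by rewrite mul0r addr0 mul1r /V max_l.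
  rewrite (mem_set (conj Aw nBw : (A `&` ~` B) w)) memNset; last by move=> [].
  rewrite mul0r add0r mul1r /V max_r// ltW// ltNge; exact/negP.
Qed.

(** With [m] the number of mesh steps completed between [t] and [u], having stopped by [u] means
    [tau < t + m * mesh n], an event known at time [u]; when [m] reaches the cap it is the whole
    space. *)
Lemma stopping_time_rounded (t : R) (tau : Omega -> \bar R) n : 0 <= t ->
  stopping_time Filt tau ->
  stopping_time Filt
    (fun w => (t + (rounded n (maxe (tau w - t%:E) 0)%E)%:R * mesh n)%:E).
Proof.
move=> t0 stau; have m0 : 0 < mesh n :> R := mesh_gt0 n; split.
  by move=> w; rewrite lee_fin addr_ge0// mulr_ge0// ltW.
move=> u u0; have [ut|tu] := ltP u t.
  rewrite (_ : mkset _ = set0); first exact: (filt0 std).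
  rewrite -subset0 => w /=; rewrite lee_fin leNgt => /negP; apply.
  by rewrite (lt_le_trans ut)// lerDl mulr_ge0// ltW.
pose m := Num.truncn ((u - t) / mesh n).
have q0 : 0 <= (u - t) / mesh n by rewrite divr_ge0 ?subr_ge0// ltW.
have km w : ((t + (rounded n (maxe (tau w - t%:E) 0)%E)%:R * mesh n)%:E <= u%:E)%E =
    (rounded n (maxe (tau w - t%:E) 0)%E <= m)%N.
  by rewrite lee_fin truncn_ge_nat// ler_pdivlMr// lerBrDl.
have mx0 w : (0 <= maxe (tau w - t%:E) 0)%E by rewrite le_max lexx orbT.
have [nm|mn] := leqP (n * 2 ^ n) m.
  rewrite (_ : mkset _ = setT); first exact: (filtT std).
  by rewrite -subTset => w _ /=; rewrite km rounded_leE// nm.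
(* For [m = 0] nothing has stopped yet, rounding being strictly upward. *)
have [m00|mgt0] := leP (m%:R * mesh n) (0:R).
  rewrite (_ : mkset _ = set0); first exact: (filt0 std).
  rewrite -subset0 => w /=; rewrite km rounded_leE// leqNgt mn/= ltNge => /negP; apply.
  by rewrite (le_trans _ (mx0 w))// lee_fin.
rewrite (_ : mkset _ = [set w | (tau w < (t + m%:R * mesh n)%:E)%E]).
  have tm0 : 0 <= t + m%:R * mesh n by rewrite addr_ge0// ltW.
  apply: (filt_le std tm0); last exact: (stopping_time_lt std stau).
  by rewrite -lerBrDl -ler_pdivlMr// truncn_le.
apply/funext => w; rewrite /mkset km rounded_leE// leqNgt mn/= gt_max [(0 < _)%E]mgt0 andbT; congr is_true.
case: (tau w) => [r| |]; [|by rewrite !ltNge !leey|by rewrite !ltNye].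
by rewrite -EFinB !lte_fin; apply/idP/idP; lra.
Qed.

Hypothesis F_joint : forall s x, 0 <= s -> O x -> forall e : R, 0 < e ->
  exists2 dl : R, 0 < dl & forall s' y, 0 <= s' -> `|s' - s| < dl ->
    mdist x y < dl -> `|F s' y - F s x| <= e.
Lemma on_grid_refine (t : R) n (tau : Omega -> \bar R) :
  on_grid t (mesh n) (n * 2 ^ n) tau -> on_grid t (mesh n.+1) (n.+1 * 2 ^ n.+1) tau.
Proof.
move=> gt w; have [j jn ->] := gt w; exists (2 * j)%N.
  rewrite expnS mulnCA leq_pmul2l//; apply: (leq_trans jn).
  by rewrite leq_mul2r leqnSn orbT.
congr (_ + _)%:E; rewrite /mesh exprS invfM natrM mulrACA divff ?mul1r//.
Qed.

Lemma on_grid_rounded (t : R) (tau : Omega -> \bar R) n :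
  on_grid t (mesh n) (n * 2 ^ n)
    (fun w => (t + (rounded n (maxe (tau w - t%:E) 0)%E)%:R * mesh n)%:E).
Proof. by move=> w; exists (rounded n (maxe (tau w - t%:E) 0)%E) => //; exact: rounded_le. Qed.

(* The grid values [Vn n (X t)] increase only almost surely; their running maxima
   increase everywhere and have the same means. *)
Lemma mean_running_max (t : R) (Vn : nat -> E -> R) n (A : set Omega) x : 0 <= t ->
  (forall n, bounded_measurable (Vn n : borel E -> R)) ->
  (forall n A, Filt t A -> \int[P x]_w (\1_A w * Vn n (X t w)) <=
     \int[P x]_w (\1_A w * Vn n.+1 (X t w))) ->
  Filt t A ->
  \int[P x]_w (\1_A w * running_max (Vn ^~ (X t w)) n) <=
  \int[P x]_w (\1_A w * Vn n (X t w)).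
Proof.
move=> t0 bV VS; have bmax k : bounded_measurable (fun y : borel E => running_max (Vn ^~ y) k).
  by elim: k => [|k IH] /=; [exact: bV|exact: bounded_measurable_max].
have bi (S : set Omega) : Filt t S -> @bounded_measurable _ _ R (\1_S).
  by move=> /(filt_measurable std t0); exact: bounded_measurable_indic.
have bX (h : borel E -> R) : bounded_measurable h -> bounded_measurable (fun w => h (X t w)).
  exact: (bounded_measurable_X std t0).
elim: n A => [//|n IH] A FA.
pose S := [set y : borel E | Vn n.+1 y <= running_max (Vn ^~ y) n].
have FB : Filt t [set w | S (X t w)].
  apply: (filt_preimage t0).
  have mle : measurable_fun [set: borel E] (fun y : borel E => Vn n.+1 y <= running_max (Vn ^~ y) n).
    by apply: measurable_fun_ler; [case: (bV n.+1)|case: (bmax n)].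
  by rewrite -[X in measurable X]setTI; exact: (mle measurableT [set true] I).
set B := [set w | S (X t w)] in FB.
have FAB : Filt t (A `&` B) by exact: (filtI std).
have FANB : Filt t (A `&` ~` B) by apply: (filtI std) => //; exact: (filtC std).
have split_mean (h : borel E -> R) : bounded_measurable h ->
    \int[P x]_w (\1_A w * h (X t w)) =
    \int[P x]_w (\1_(A `&` B) w * h (X t w)) + \int[P x]_w (\1_(A `&` ~` B) w * h (X t w)).
  move=> bh; rewrite -meanD; last 2 first.
  - by apply: bounded_measurableM; [exact: bi|exact: bX].
  - by apply: bounded_measurableM; [exact: bi|exact: bX].
  apply: eq_Rintegral => w _; rewrite -mulrDl; congr (_ * _).
  rewrite !indicE !in_setI in_setC.
  by case: (w \in A); case: (w \in B); rewrite ?addr0 ?add0r.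
rewrite (split_mean _ (bmax n.+1)) (split_mean _ (bV n.+1)); apply: lerD.
  apply: (@le_trans _ _ (\int[P x]_w (\1_(A `&` B) w * Vn n (X t w)))); last exact: VS.
  apply: le_trans (IH _ FAB); apply: le_mean.
  - by apply: bounded_measurableM; [exact: bi|exact: (bX _ (bmax n.+1))].
  - by apply: bounded_measurableM; [exact: bi|exact: (bX _ (bmax n))].
  move=> w; rewrite indicE; case: (boolP (w \in _)) => [|_]; last by rewrite !mul0r.
  by rewrite inE => -[_ Bw] /=; rewrite !mul1r max_l.
apply: le_mean.
- by apply: bounded_measurableM; [exact: bi|exact: (bX _ (bmax n.+1))].
- by apply: bounded_measurableM; [exact: bi|exact: (bX _ (bV n.+1))].
move=> w; rewrite indicE; case: (boolP (w \in _)) => [|_]; last by rewrite !mul0r.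
rewrite inE => -[_ nBw] /=; rewrite !mul1r max_r// ltW// ltNge; exact/negP.
Qed.

(** The dyadic grids are nested, so their values increase in mean over every event of [Filt t], and
    their running maxima have a bounded measurable limit [V]. Upward rounding approximates any [tau]
    from the right and gives the upper bound; optimal times on fine grids are nearly optimal. A
    decision to stop before [t] counts as stopping at [t]. *)
Theorem continuation_value (s t : R) : 0 <= s -> 0 <= t ->
  exists V : E -> R, [/\ bounded_measurable (V : borel E -> R),
    forall tau x, stopping_time Filt tau ->
      \int[P x]_w Psi s (maxe (tau w - t%:E) 0)%E (future t w) <= \int[P x]_w V (X t w) &
    forall x e, 0 < e -> exists2 tau, stopping_time Filt tau &
      \int[P x]_w V (X t w) - e <=
      \int[P x]_w Psi s (maxe (tau w - t%:E) 0)%E (future t w)].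
Proof.
move=> s0 t0.
have /choice[Vn HVn] : forall n : nat, exists V : E -> R,
    [/\ measurable_fun [set: borel E] (V : borel E -> R), forall y, `|V y| <= C,
    forall tau, stopping_time Filt tau -> on_grid t (mesh n) (n * 2 ^ n) tau ->
      forall A x, Filt t A ->
      \int[P x]_w (\1_A w * Psi s (tau w - t%:E)%E (future t w)) <=
      \int[P x]_w (\1_A w * V (X t w)) &
    exists tau, [/\ stopping_time Filt tau, on_grid t (mesh n) (n * 2 ^ n) tau &
      forall A x, Filt t A ->
      \int[P x]_w (\1_A w * Psi s (tau w - t%:E)%E (future t w)) =
      \int[P x]_w (\1_A w * V (X t w))]].
  by move=> n; exact: (grid_value _ (mesh_gt0 n) s t0).
have bV n : bounded_measurable (Vn n : borel E -> R).
  by have [mV VC _ _] := HVn n; split => //; exists C.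
have VC n y : `|Vn n y| <= C by have [_ + _ _] := HVn n; exact.
have FT : Filt t setT by exact: (filtT std).
have oneE (h : Omega -> R) x : \int[P x]_w (\1_[set: Omega] w * h w) = \int[P x]_w h w.
  by apply: eq_Rintegral => w _; rewrite indicT mul1r.
have VS x n A : Filt t A -> \int[P x]_w (\1_A w * Vn n (X t w)) <=
     \int[P x]_w (\1_A w * Vn n.+1 (X t w)).
  move=> FA; have [_ _ _ [tau [stau gtau tauE]]] := HVn n.
  rewrite -tauE//; have [_ _ + _] := HVn n.+1; apply => //.
  exact: on_grid_refine.
pose W y n := running_max (Vn ^~ y) n.
have bW n : bounded_measurable (fun y : borel E => W y n).
  by rewrite /W; elim: n => [|n IH] /=; [exact: bV|exact: bounded_measurable_max].
have WC n y : `|W y n| <= C.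
  rewrite /W; elim: n => [|n IH] //=; case: (leP (running_max _ _) _) => //.
have VW n y : Vn n y <= W y n by rewrite /W; case: n => [//|n] /=; rewrite le_max lexx orbT.
have Wcvg y : W y n @[n --> \oo] --> limn (W y).
  apply: nondecreasing_is_cvgn.
    by apply/nondecreasing_seqP => n; rewrite /W /= le_max lexx.
  by exists C => _ [n _ <-]; exact: le_trans (ler_norm _) (WC n y).
pose V : E -> R := fun y => limn (W y).
have mV : measurable_fun [set: borel E] (V : borel E -> R).
  apply: (@measurable_fun_cvg _ (borel E) R setT (fun n y => W y n)) => //.
  by move=> n; case: (bW n).
have VinfC y : `|V y| <= C.
  have := cvg_norm (Wcvg y) => h.
  by apply: (ler_cvg_to (h _) (cvg_cst C)); apply: nearW => n; exact: WC.
have bVinf : bounded_measurable (V : borel E -> R) by split => //; exists C.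
have limW x : \int[P x]_w W (X t w) n @[n --> \oo] --> \int[P x]_w V (X t w).
  apply: (@mean_cvg _ _ _ _ (fun n w => W (X t w) n) (fun w => V (X t w)) C).
  - by move=> n; case: (bounded_measurable_X std t0 (bW n)).
  - by move=> n w.
  - by apply: aeW => w; exact: Wcvg.
  - by case: (bounded_measurable_X std t0 bVinf).
(* Equality of means lets [W], which converges pointwise, stand for the grid values. *)
have VWE x n : \int[P x]_w Vn n (X t w) = \int[P x]_w W (X t w) n.
  apply/eqP; rewrite eq_le; apply/andP; split.
    by apply: le_mean => //; [exact: (bounded_measurable_X std t0 (bV n))|exact: (bounded_measurable_X std t0 (bW n))].
  have := @mean_running_max t Vn n setT x t0 bV (VS x) FT.
  by rewrite !oneE.
have limV x : \int[P x]_w Vn n (X t w) @[n --> \oo] --> \int[P x]_w V (X t w).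
  by under eq_fun do rewrite VWE; exact: limW.
exists V; split => //.
- move=> tau x stau.
  pose taun n w := (t + (rounded n (maxe (tau w - t%:E) 0)%E)%:R * mesh n)%:E.
  have staun n : stopping_time Filt (taun n) by exact: stopping_time_rounded.
  have mx0 w : (0 <= maxe (tau w - t%:E) 0)%E by rewrite le_max lexx orbT.
  have tauE n w : (taun n w - t%:E)%E = ((rounded n (maxe (tau w - t%:E) 0)%E)%:R * mesh n)%:E.
    by rewrite /taun EFinD addeAC subee// add0e.
  have tau0 n w : (0 <= taun n w - t%:E)%E.
    by rewrite tauE lee_fin mulr_ge0// ltW// mesh_gt0.
  have limPsi : \int[P x]_w Psi s (taun n w - t%:E)%E (future t w) @[n --> \oo] -->
      \int[P x]_w Psi s (maxe (tau w - t%:E) 0)%E (future t w).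
    apply: (@mean_cvg _ _ _ _ _ _ C).
    + move=> n; have [] // := bounded_measurable_payoff s t0 (measurable_sub_time t (staun n)) (tau0 n).
    + by move=> n w; exact: (path_payoff_bound O alpha_gt0 mf fM FM).
    + apply: aeW => w; apply: (path_payoff_cvg alpha_gt0 mf fM FM F_joint) => //.
        move=> u u0; have := rounded_ge u (mx0 w); apply: filterS => n.
        by rewrite tauE.
      move=> r rE; have r0 : 0 <= r by rewrite -lee_fin -rE.
      exists (fun n => (rounded n r%:E)%:R * mesh n); last exact: rounded_cvg.
      by have := rounded_itv r0; apply: filterS => n /andP[/ltW ? _]; rewrite tauE rE.
    + have mb : measurable_fun setT (fun w => maxe (tau w - t%:E) 0)%E.
        apply: measurable_maxe => //; exact: measurable_sub_time.
      by have [] := bounded_measurable_payoff s t0 mb mx0.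
  apply: (ler_cvg_to limPsi (limV x)); apply: nearW => n.
  have [_ _ Vi _] := HVn n.
  have := Vi _ (staun n) (@on_grid_rounded t tau n) setT x FT.
  by rewrite !oneE.
- move=> x e e0.
  have /cvgrPdist_le/(_ _ e0)[n _ /(_ n (leqnn n)) /= Hn] := limV x.
  have [_ _ _ [tau [stau gtau tauE]]] := HVn n.
  exists tau => //; have := tauE setT x FT; rewrite !oneE => E1.
  suff -> : \int[P x]_w Psi s (maxe (tau w - t%:E) 0)%E (future t w) = \int[P x]_w Vn n (X t w).
    by move: Hn; rewrite ler_norml => /andP[_]; lra.
  rewrite -E1; apply: eq_Rintegral => w _; rewrite max_l//.
  by rewrite sube_ge0// (on_grid_ge w _ gtau)// ltW// mesh_gt0.
Qed.

End dynamic_programming.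

(** * The exit time *)

Section exit_identification.
Context {R : realType} {E : pmetricType R} {d : measure_display}
  {Omega : measurableType d}.
Context {Filt : R -> set (set Omega)} {X : R -> Omega -> E}
  {P : E -> probability Omega R}.
Hypothesis std : standard_Markov_process Filt X P.
Variable O : set E.
Hypothesis O_open : open O.
Local Notation sigma w := (announced_exit O (trajectory std w)).

(** The outcomes where the path comes arbitrarily near the complement of [O] but is still in [O] at
    the announced time; elsewhere the announced and the true exit agree. *)
Definition exit_defect : set Omega :=
  [set w | (sigma w < +oo)%E /\ O (X (fine (sigma w)) w)].

Lemma measurable_exit_defect : measurable exit_defect.
Proof.
have ms : measurable_fun setT (fun w => sigma w).
  exact: (measurableT_comp (measurable_announced_exit O) (measurable_trajectory std)).
have -> : exit_defect = [set w | (sigma w < +oo)%E] `&`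
    [set w | O (path_at (fine (sigma w)) (trajectory std w))].
  by apply/seteqP; split => w [h1 h2]; split => //; move: h2;
    rewrite /= trajectoryE// fine_ge0// announced_exit_ge0.
apply: measurableI.
  rewrite -[X in measurable X]setTI; exact: emeasurable_fun_infty_o.
have mX : measurable_fun setT
    (fun w => path_at (fine (sigma w)) (trajectory std w) : borel E).
  apply: measurable_path_at_time; last exact: measurable_trajectory.
  exact: (measurableT_comp (fine_measurable measurableT)).
by rewrite -[X in measurable X]setTI; apply: (mX measurableT O); exact: open_borel.
Qed.

(** The hitting times of the neighbourhoods increase to the announced exit, and by
    quasi-left-continuity the positions converge. From index [n] on they lie in
    [closure (near_complement O n)], so the limit is in all these closures, hence outside the open
    [O]. *)
Lemma exit_defect_null x : P x exit_defect = 0%E.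
Proof.
have oG n := near_complement_open O n.
pose taun n w := hitting_time (near_complement O n) (trajectory std w).
have staun n : stopping_time Filt (taun n) by exact: stopping_time_hitting.
have homo w : {homo taun ^~ w : m n / (m <= n)%N >-> (m <= n)%E}.
  by move=> m n mn; apply: hitting_time_subset; exact: near_complement_subset.
have lim w : taun n w @[n --> \oo] --> sigma w by exact: ereal_nondecreasing_cvgn.
have := standard_quasi_left_continuous std staun (fun n w => homo w _ _ (leqnSn n)) lim x.
move=> [A [mA A0 HA]]; apply/eqP; rewrite eq_le measure_ge0 andbT -A0.
apply: le_measure; rewrite ?inE//; first exact: measurable_exit_defect.
move=> w [sw Ow]; apply: HA => /(_ sw) cX.
apply: (closure_near_complement O_open _ Ow) => n.
apply: (@closed_cvg _ E \oo _ (fun n => X (fine (taun n w)) w) _ (@closed_closure E (near_complement O n)) _ _ cX).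
exists n => // m /= nm; apply: (closure_subset (near_complement_subset nm)).
have tfin : (taun m w < +oo)%E by rewrite (le_lt_trans _ sw)// announced_exit_ge.
have t0 : (0 <= taun m w)%E by exact: hitting_time_ge0.
have tE : taun m w = (fine (taun m w))%:E by rewrite fineK// ge0_fin_numE.
by rewrite -(trajectoryE std)//; [exact: hitting_time_closure|exact: fine_ge0].
Qed.

Lemma exit_timeE w : ~ exit_defect w -> exit_time X O w = sigma w.
Proof.
move=> nw; apply/eqP; rewrite eq_le; apply/andP; split.
  have := announced_exit_ge0 O (trajectory std w).
  case sE : (sigma w) => [r| |] //; rewrite ?leey// lee_fin => r0; apply: ereal_inf_lbound; exists r => //; split => // Or.
  by apply: nw; split; rewrite sE/= ?ltry.
apply/ereal_infP => _ [r [r0 nO] <-]; apply: announced_exit_le => //.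
by rewrite trajectoryE.
Qed.

Lemma exit_time_ge0 w : (0 <= exit_time X O w)%E.
Proof. by apply/ereal_infP => _ [r [r0 _] <-]; rewrite lee_fin. Qed.

(** Clamping negative times to [0] gives functions measurable and bounded on all of [R * E], as the
    lemmas on [path_payoff] require. *)
Definition time_extension (g : R -> E -> R) (s : R) : E -> R := g (Num.max s 0).

Lemma measurable_time_extension g : measurable_functional g ->
  measurable_fun [set: R * borel E] (fun z => time_extension g z.1 z.2).
Proof.
move=> mg; have mH : measurable (@half_line R `*` [set: borel E]).
  apply: measurableX => //.
  rewrite (_ : @half_line R = `[0, +oo[%classic)//.
  by apply/seteqP; split => u; rewrite /half_line/= in_itv/= andbT.
apply: (measurable_comp mH _ mg (g := fun z : R * borel E => (Num.max z.1 0, z.2))).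
  by move=> _ [z _ <-]; split => //=; rewrite /half_line/= le_max lexx orbT.
apply: measurable_fun_pair => //; apply: measurable_maxr => //.
Qed.

Lemma time_extension_bound g : bounded_functional g ->
  exists2 M, 0 <= M & forall s x, `|time_extension g s x| <= M.
Proof.
move=> [B [Breal HB]]; exists (`|B| + 1); first by rewrite addr_ge0.
move=> s x; apply: (HB (`|B| + 1) _ (Num.max s 0, x)).
  by rewrite (le_lt_trans (ler_norm B))// ltrDl.
by split => //=; rewrite /half_line/= le_max lexx orbT.
Qed.

Lemma time_extensionE g s : 0 <= s -> time_extension g s = g s.
Proof. by move=> s0; rewrite /time_extension max_l. Qed.

Variables (alpha M : R) (f F : R -> E -> R).
Hypothesis alpha_gt0 : 0 < alpha.
Hypothesis mf : measurable_functional f.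
Hypothesis mF : measurable_functional F.
Local Notation f' := (time_extension f).
Local Notation F' := (time_extension F).
Hypothesis fM : forall s x, `|f' s x| <= M.
Hypothesis FM : forall s x, `|F' s x| <= M.

Lemma payoffE s tau w : 0 <= s -> (0 <= tau w)%E ->
  payoff X O alpha f F s tau w =
  running alpha f' s (mine (tau w) (exit_time X O w)) (trajectory std w) +
  terminal alpha F' s (mine (tau w) (exit_time X O w)) (trajectory std w).
Proof.
move=> s0 t0; rewrite /payoff /running /terminal.
have : (0 <= mine (tau w) (exit_time X O w))%E by rewrite le_min t0 exit_time_ge0.
move: (mine _ _) => T T0; congr (_ + _).
  apply: eq_Rintegral => u; rewrite inE => -[u0 _].
  by rewrite /running_rate trajectoryE// time_extensionE// addr_ge0.
case: T T0 => [r| |]//; rewrite lee_fin => r0.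
by rewrite trajectoryE// time_extensionE// addr_ge0.
Qed.

Lemma payoff_path_payoff s tau w : 0 <= s -> (0 <= tau w)%E -> ~ exit_defect w ->
  payoff X O alpha f F s tau w = path_payoff O alpha f' F' s (tau w) (trajectory std w).
Proof. by move=> s0 t0 nw; rewrite payoffE// exit_timeE. Qed.

Lemma bounded_measurable_path_payoff s tau : stopping_time Filt tau ->
  bounded_measurable (fun w => path_payoff O alpha f' F' s (tau w) (trajectory std w)).
Proof.
move=> stau; have [t0 _] := stau; split.
  apply: measurable_path_payoff => //; try exact: measurable_time_extension.
  - exact: (measurable_stopping_time std).
  - exact: measurable_trajectory.
exists (M / alpha + M) => w; apply: path_payoff_bound => //.
exact: measurable_time_extension.
Qed.

(** The event is null under every law, so completeness of the filtration puts its subsets in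
    [Filt 0]. This yields measurability of [payoff], which is defined through the true exit time. *)
Lemma measurable_subset_exit_defect (A : set Omega) : A `<=` exit_defect -> measurable A.
Proof.
move=> AN; apply: (filt_measurable std (lexx 0)).
apply: (standard_complete std) AN; first exact: measurable_exit_defect.
exact: exit_defect_null.
Qed.

Lemma J_path_mean s x tau : 0 <= s -> stopping_time Filt tau ->
  J X P O alpha f F s x tau =
  \int[P x]_w path_payoff O alpha f' F' s (tau w) (trajectory std w).
Proof.
move=> s0 stau; have [t0 _] := stau; rewrite /J fine_expectation.
have bPsi := bounded_measurable_path_payoff s stau.
apply: (mean_ae_eq _ bPsi measurable_exit_defect).
- split.
    move=> _ B mB; rewrite setTI.
    set pay := payoff _ _ _ _ _ _ _; set Psi := fun w : Omega => path_payoff _ _ _ _ _ _ _ in bPsi.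
    (* Off the null event this preimage is one under [path_payoff]; the remainder is a subset of the
       null event. *)
    have -> : pay @^-1` B = (Psi @^-1` B `&` ~` exit_defect) `|` (pay @^-1` B `&` exit_defect).
      apply/seteqP; split => w /=.
        move=> Bw; have [Nw|Nw] := pselect (exit_defect w); [by right|left].
        by split => //; rewrite -[Psi w]payoff_path_payoff.
      by move=> [[Bw Nw]|[]]//; rewrite /pay payoff_path_payoff.
    apply: measurableU; last exact: measurable_subset_exit_defect.
    apply: measurableI; last by apply: measurableC; exact: measurable_exit_defect.
    by rewrite -[X in measurable X]setTI; case: bPsi => + _; apply.
  exists (M / alpha + M) => w; rewrite payoffE// (le_trans (ler_normD _ _))// lerD//.
    by apply: running_bound => //; exact: measurable_time_extension.
  apply: (@terminal_bound _ _ alpha f') => //.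
  by rewrite le_min t0 exit_time_ge0.
- exact: exit_defect_null.
- by move=> w nw; exact: payoff_path_payoff.
Qed.

Lemma J_bound s x tau : 0 <= s -> stopping_time Filt tau ->
  `|J X P O alpha f F s x tau| <= M / alpha + M.
Proof.
move=> s0 stau; have [t0 _] := stau; rewrite J_path_mean//; apply: mean_norm_le.
  by case: (bounded_measurable_path_payoff s stau).
by move=> w; apply: path_payoff_bound => //; exact: measurable_time_extension.
Qed.

(** The supremum need not be attained, hence the slack [e] in the lower bound. *)
Lemma value_near s x (v c : R) : 0 <= s ->
  (forall tau, stopping_time Filt tau -> J X P O alpha f F s x tau <= v + c) ->
  (forall e, 0 < e -> exists2 tau, stopping_time Filt tau &
     v - c - e <= J X P O alpha f F s x tau) ->
  `|value Filt X P O alpha f F s x - v| <= c.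
Proof.
move=> s0 Hle Hge; rewrite ler_distl.
have ub : ubound [set J X P O alpha f F s x tau | tau in stopping_time Filt] (v + c).
  by move=> _ [tau st <-]; exact: Hle.
have ne : [set J X P O alpha f F s x tau | tau in stopping_time Filt] !=set0.
  by have [tau st _] := Hge 1 ltr01; exists (J X P O alpha f F s x tau), tau.
rewrite /value; apply/andP; split; last exact: ge_sup.
apply/ler_addgt0Pr => e e0; rewrite -lerBlDr; have [tau st h] := Hge e e0.
by apply: (le_trans h); apply: ub_le_sup; [exists (v + c)|exists tau].
Qed.

Lemma value_time_near s s' x (c : R) : 0 <= s -> 0 <= s' ->
  (forall tau, stopping_time Filt tau ->
    `|J X P O alpha f F s x tau - J X P O alpha f F s' x tau| <= c) ->
  `|value Filt X P O alpha f F s x - value Filt X P O alpha f F s' x| <= c.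
Proof.
move=> s0 s'0 H; have hs : has_sup [set J X P O alpha f F s' x tau | tau in stopping_time Filt].
  split; first by exists (J X P O alpha f F s' x (fun=> 0%:E)), (fun=> 0%:E) => //; exact: (stopping_time_cst std).
  by exists (M / alpha + M) => _ [tau st <-]; rewrite (le_trans (ler_norm _))// J_bound.
apply: value_near => //.
  move=> tau st; have := H tau st; rewrite ler_distl => /andP[_ h]; apply: (le_trans h).
  by rewrite lerD2r; apply: ub_le_sup; [exact: hs.2|exists tau].
move=> e e0; have [_ [tau st <-] h] := sup_adherent e0 hs.
exists tau => //; have := H tau st; rewrite ler_distl => /andP[h' _].
by move: h; rewrite -/(value Filt X P O alpha f F s' x); lra.
Qed.

End exit_identification.

(** * Continuity of the value *)

Section continuity_of_the_value.
Context {R : realType} {E : pmetricType R} {d : measure_display}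
  {Omega : measurableType d}.
Context {Filt : R -> set (set Omega)} {X : R -> Omega -> E}
  {P : E -> probability Omega R}.
Hypothesis std : standard_Markov_process Filt X P.
Hypothesis X_weakly_Feller : weakly_Feller X P.
Hypothesis E_balls : forall (x : E) (r : R), compact [set y | mdist x y <= r].
Variable O : set E.
Hypothesis O_open : open O.
Variables (alpha M : R) (f F : R -> E -> R).
Hypothesis alpha_gt0 : 0 < alpha.
Hypothesis mf : measurable_functional f.
Hypothesis mF : measurable_functional F.
Local Notation f' := (time_extension f).
Local Notation F' := (time_extension F).
Hypothesis fM : forall s x, `|f' s x| <= M.
Hypothesis FM : forall s x, `|F' s x| <= M.
Local Notation Psi := (path_payoff O alpha f' F').
Local Notation traj := (trajectory std).
Local Notation w_ := (value Filt X P O alpha f F).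
Let C := M / alpha + M.
Let M_ge0 : 0 <= M. Proof. exact: le_trans (normr_ge0 _) (fM 0 point). Qed.
Let C_ge0 : 0 <= C. Proof. by rewrite addr_ge0// divr_ge0// ltW. Qed.

Lemma mean_le_off_bad (Z : Omega -> R) (B : set Omega) (c K : R) x :
  bounded_measurable Z -> measurable B -> 0 <= c -> 0 <= K ->
  (forall w, ~ B w -> `|Z w| <= c) -> (forall w, `|Z w| <= K) ->
  `|\int[P x]_w Z w| <= c + K * fine (P x B).
Proof.
move=> bZ mB c0 K0 Hc HK.
have bB := @bounded_measurable_indic _ _ R _ mB.
have bW : bounded_measurable (fun w => c + K * \1_B w : R).
  by apply: bounded_measurableD; [exact: bounded_measurable_cst|exact: bounded_measurableZ].
have WE : \int[P x]_w (c + K * \1_B w) = c + K * fine (P x B).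
  by rewrite meanD ?meanZ ?mean_cst ?mean_indic//; [exact: bounded_measurable_cst|exact: bounded_measurableZ].
have ZW w : `|Z w| <= c + K * \1_B w.
  rewrite indicE; case: (boolP (w \in B)) => Bw; last first.
    by rewrite mulr0 addr0 Hc// => /mem_set; apply/negP.
  by rewrite mulr1 (le_trans (HK w))// lerDr.
rewrite -WE ler_norml; apply/andP; split; last first.
  by apply: le_mean => // w; exact: le_trans (ler_norm _) (ZW w).
rewrite -[X in - X]mul1r -mulNr -meanZ//; apply: le_mean => //.
  exact: bounded_measurableZ.
by move=> w; rewrite mulN1r lerNl; rewrite (le_trans _ (ZW w))// -normrN ler_norm.
Qed.

Lemma hitting_time_gt_mdist (x0 : E) (r u : R) (p : rc_path E) (T : \bar R) : 0 <= u ->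
  (u%:E <= T)%E -> (T < hitting_time [set y | r < mdist x0 y]%R p)%E ->
  mdist x0 (path_at u p) <= r.
Proof.
move=> u0 uT Th; rewrite leNgt; apply/negP => h.
have := @hitting_time_le _ _ [set y | r < mdist x0 y] p u u0 h.
by rewrite leNgt (le_lt_trans uT Th).
Qed.

Lemma measurable_hit (G : set E) (t : R) : open G ->
  measurable [set w | (hitting_time G (traj w) <= t%:E)%E].
Proof.
move=> oG; rewrite -[X in measurable X]setTI.
apply: emeasurable_fun_infty_c => //.
exact: (measurableT_comp (measurable_hitting_time oG) (measurable_trajectory std)).
Qed.

Hypothesis F_joint : forall s x, 0 <= s -> O x -> forall e : R, 0 < e ->
  exists2 dl : R, 0 < dl & forall s' y, 0 <= s' -> `|s' - s| < dl ->
    mdist x y < dl -> `|F' s' y - F' s x| <= e.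
Hypothesis A3 : strongly_Feller X P.

Lemma discounted_oscillation s0 x0 e : 0 <= s0 -> O x0 -> 0 < e ->
  exists r eta, [/\ 0 < r, 0 < eta, forall y, mdist x0 y < 2 * r -> O y &
    forall u y, 0 <= u <= eta -> mdist x0 y <= r ->
    `|expR (- alpha * u) * F' (s0 + u) y - F' s0 x0| <= e].
Proof.
move=> s00 Ox0 e0.
have /metricType_numDomainType.nbhs_mdistP[rO /= rO0 HO] : nbhs x0 O.
  by move: O_open; rewrite openE; exact.
have e20 : 0 < e / 2 by lra.
have [dl dl0 Hdl] := F_joint s00 Ox0 e20.
have aM : 0 < alpha * (M + 1) by rewrite mulr_gt0// ltr_wpDl.
(* [rO / 2] puts the ball of radius [2 * r] inside [O]. The last bound on [eta] comes from
   [1 - expR (- alpha * u) <= alpha * u], with [M + 1] to avoid a division by zero. *)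
exists (Num.min (rO / 2) (dl / 2)), (Num.min (dl / 2) (e / 2 / (alpha * (M + 1)))); split.
- by rewrite lt_min; apply/andP; split; lra.
- by rewrite lt_min !divr_gt0.
- move=> y; rewrite minr_pMr// => h; apply: HO => /=.
  have : 2 * (rO / 2) = rO by field.
  move: h; rewrite lt_min => /andP[]; lra.
move=> u y /andP[u0]; rewrite !le_min (ler_pdivlMr _ _ aM) => /andP[udl uM] /andP[_ ydl].
have h1 : `|F' (s0 + u) y - F' s0 x0| <= e / 2.
  apply: Hdl; first exact: addr_ge0.
  - rewrite addrAC subrr add0r ger0_norm//; lra.
  - lra.
have x1 : expR (- alpha * u) <= 1.
  by rewrite expRN_le1// ltW.
have x2 : 1 - alpha * u <= expR (- alpha * u).
  by have := expR_ge1Dx (- alpha * u); rewrite mulNr.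
have h2 : `|(expR (- alpha * u) - 1) * F' (s0 + u) y| <= e / 2.
  rewrite normrM ler0_norm ?subr_le0// opprB.
  apply: (@le_trans _ _ (alpha * u * M)); last first.
    apply: le_trans uM; have au : 0 <= alpha * u by rewrite mulr_ge0// ltW.
    rewrite (_ : u * (alpha * (M + 1)) = alpha * u * M + alpha * u); last by ring.
    by rewrite lerDl.
  by rewrite ler_pM// ?subr_ge0//; lra.
rewrite (_ : _ - _ = (expR (- alpha * u) - 1) * F' (s0 + u) y + (F' (s0 + u) y - F' s0 x0)); last by ring.
by rewrite (le_trans (ler_normD _ _))//; lra.
Qed.

Lemma value_one_step s0 x0 e : 0 <= s0 -> O x0 -> 0 < e ->
  exists eta (V : E -> R), [/\ 0 < eta, bounded_borel V &
    \forall x \near x0, `|w_ s0 x - expR (- alpha * eta) * transition X P eta V x| <= e].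
Proof.
move=> s00 Ox0 e0.
(* Five such parts make up the final error: one for the running payoff before [eta], two for the
   oscillation, two for the paths that leave the ball. *)
pose e1 := e / 8; have e10 : 0 < e1 by rewrite divr_gt0.
have [r [eta1 [r0 eta10 Hr Hosc]]] := discounted_oscillation s00 Ox0 e10.
have C10 : 0 < C + 1 by rewrite ltr_wpDl.
pose e2 := e1 / (C + 1); have e20 : 0 < e2 by rewrite divr_gt0.
have [eta2 eta20 Hnear] := path_stays_near std X_weakly_Feller E_balls x0 r0 e20.
have M10 : 0 < M + 1 by rewrite ltr_wpDl.
pose eta := Num.min (Num.min eta1 eta2) (e1 / (M + 1)).
have eta0 : 0 < eta by rewrite !lt_min eta10 eta20 divr_gt0.
have eta_1 : eta <= eta1 by rewrite !ge_min lexx.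
have eta_2 : eta <= eta2 by rewrite !ge_min lexx orbT.
have eta_M : M * eta <= e1.
  apply: (@le_trans _ _ ((M + 1) * eta)); first by rewrite ler_pM2r// lerDl.
  by rewrite mulrC -ler_pdivlMr// ge_min lexx orbT.
have se0 : 0 <= s0 + eta by rewrite addr_ge0// ltW.
have [V [bV Vle Vge]] := continuation_value std alpha_gt0
  (measurable_time_extension mf) (measurable_time_extension mF) fM FM F_joint se0 (ltW eta0).
have bbV : bounded_borel V by exact/bounded_borelP.
exists eta, V; split => //.
apply: filterS Hnear => x Hx.
set k := expR (- alpha * eta).
have k0 : 0 < k by rewrite expR_gt0.
have k1 : k <= 1.
  by rewrite expRN_le1// ltW.
have TE : transition X P eta V x = \int[P x]_w V (X eta w) by rewrite /transition fine_expectation.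
(* The bad event: on paths leaving the ball by [eta2], only the crude bound [2 * C] is used. *)
pose B := [set w | (hitting_time [set y | r < mdist x0 y]%R (traj w) <= eta2%:E)%E].
have mB : measurable B by apply: measurable_hit; exact: open_gt_mdist.
have key tau : stopping_time Filt tau ->
    `|J X P O alpha f F s0 x tau - k *
      \int[P x]_w Psi (s0 + eta) (maxe (tau w - eta%:E) 0)%E (future std eta w)| <= e.
  move=> st; have [tau0 _] := st; rewrite (J_path_mean std O_open alpha_gt0 mf mF fM FM)//.
  have b1 := bounded_measurable_path_payoff std O alpha_gt0 mf mF fM FM s0 st.
  have mx0 w : (0 <= maxe (tau w - eta%:E) 0)%E by rewrite le_max lexx orbT.
  have mb : measurable_fun setT (fun w => maxe (tau w - eta%:E) 0)%E.
    by apply: measurable_maxe => //; exact: (measurable_sub_time std).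
  have b2 := bounded_measurable_payoff std O alpha_gt0
    (measurable_time_extension mf) (measurable_time_extension mF) fM FM (s0 + eta) (ltW eta0) mb mx0.
  rewrite -meanZ// -meanB//; last exact: bounded_measurableZ.
  have P1 w : `|Psi s0 (tau w) (traj w)| <= C.
    by apply: (path_payoff_bound O alpha_gt0 (measurable_time_extension mf) fM FM).
  have P2 w : `|Psi (s0 + eta) (maxe (tau w - eta%:E) 0)%E (future std eta w)| <= C.
    by apply: (path_payoff_bound O alpha_gt0 (measurable_time_extension mf) fM FM).
  apply: (le_trans (@mean_le_off_bad _ B (M * eta + 2 * e1) (2 * C) x _ mB _ _ _ _)).
  - by apply: bounded_measurableB => //; exact: bounded_measurableZ.
  - by rewrite addr_ge0// mulr_ge0// ltW.
  - by rewrite mulr_ge0.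
  - move=> w /negP; rewrite /B/= -ltNge => hw.
    have hw1 : (eta%:E < hitting_time [set y | r < mdist x0 y]%R (traj w))%E.
      by rewrite (le_lt_trans _ hw)// lee_fin.
    have -> : future std eta w = path_shift eta (traj w).
      by rewrite -future0 future_shift ?add0r// ltW.
    apply: (path_payoff_delay alpha_gt0 (measurable_time_extension mf) fM s00 (ltW eta0) (tau0 w) _ hw1).
    + move=> u y /andP[u0 ue] yr; apply: Hosc => //; rewrite u0/=; exact: le_trans ue eta_1.
    + exact: (announced_exit_gt_ball r0 Hr hw1).
  - move=> w; rewrite (le_trans (ler_normB _ _))// mulr2n mulrDl mul1r lerD//.
    by rewrite normrM gtr0_norm// (le_trans _ (P2 w))// ler_piMl.
  have : 2 * C * fine (P x B) <= 2 * e1.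
    rewrite -mulrA ler_pM2l//; apply: (@le_trans _ _ ((C + 1) * e2)).
      by rewrite ler_pM// ?fine_ge0// lerDl.
    by rewrite /e2 mulrC divfK// gt_eqF.
  by rewrite /e1 in eta_M *; lra.
apply: value_near => //.
- move=> tau st; have := key tau st; rewrite ler_distl => /andP[_ h].
  apply: (le_trans h); rewrite lerD2r ler_pM2l// TE; exact: Vle.
- move=> a a0; have [tau st h] := Vge x a a0; exists tau => //.
  have := key tau st; rewrite ler_distl => /andP[h' _].
  apply: le_trans h'; rewrite TE addrAC lerD2r.
  apply: (@le_trans _ _ (k * (\int[P x]_w V (X eta w) - a))); last by rewrite ler_pM2l.
  by rewrite mulrBr lerD2l lerN2 ler_piMl// ltW.
Qed.

Lemma value_space_continuous s0 x0 e : 0 <= s0 -> O x0 -> 0 < e ->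
  \forall x \near x0, `|w_ s0 x - w_ s0 x0| <= e.
Proof.
move=> s00 Ox0 e0; have e30 : 0 < e / 3 by lra.
have [eta [V [eta0 bV Hx]]] := value_one_step s00 Ox0 e30.
have /cvgrPdist_le/(_ _ e30) cV := A3 bV eta0 (x := x0).
have Hx0 := nbhs_singleton Hx.
set k := expR _ in Hx Hx0.
have k0 : 0 < k by rewrite expR_gt0.
have k1 : k <= 1.
  by rewrite expRN_le1// ltW.
near=> x.
have h1 : `|w_ s0 x - k * transition X P eta V x| <= e / 3 by near: x.
have h2 : `|transition X P eta V x0 - transition X P eta V x| <= e / 3 by near: x.
have h3 : `|k * transition X P eta V x0 - k * transition X P eta V x| <= e / 3.
  by rewrite -mulrBr normrM gtr0_norm// (le_trans _ h2)// ler_piMl.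
move: Hx0 h1 h3; rewrite !ler_norml.
move: (k * _) (k * _) => a b /andP[? ?] /andP[? ?] /andP[? ?].
by apply/andP; split; lra.
Unshelve. all: by end_near. Qed.

Hypothesis f_time : time_continuous f.
Hypothesis F_time : time_continuous F.

(** [time_continuous] is uniform in space but pointwise in time. Covering [[0, U]] makes it uniform
    in [u], both values being compared with the one at the centre of the covering interval. *)
Lemma uniform_time_continuity (g : R -> E -> R) (K : set E) s0 U e :
  time_continuous g -> compact K -> 0 <= s0 -> 0 < e ->
  exists2 dl, 0 < dl & forall s u y, 0 <= s -> `|s - s0| < dl -> 0 <= u <= U -> K y ->
    `|g (s + u) y - g (s0 + u) y| <= e.
Proof.
move=> gc cK s00 e0.
have /compact_near_coveringP cov : compact `[0, U]%classic by exact: segment_compact.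
pose Q (dl u : R) := 0 <= u -> forall s y, 0 <= s -> `|s - s0| < dl -> K y ->
  `|g (s + u) y - g (s0 + u) y| <= e.
have : \forall dl \near 0^'+, `[0, U] `<=` Q dl.
  apply: cov => u; rewrite /= in_itv/= => /andP[u0 _].
  have su0 : 0 <= s0 + u by rewrite addr_ge0.
  have e20 : 0 < e / 2 by lra.
  have := gc _ su0 _ cK _ e20.
  rewrite near_withinE => /nbhs_ballP[a /= a0 Ha].
  have a20 : 0 < a / 2 by lra.
  exists ([set v | `|v - u| < a / 2], [set dl | dl < a / 2]).
    split => /=; last by exact: nbhs_right_lt.
    by apply/nbhs_ballP; exists (a / 2) => // v /=; rewrite distrC.
  move=> [v dl] [/= vu dla] v0 s y s0' sdl Ky.
  have h1 : `|g (s + v) y - g (s0 + u) y| < e / 2.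
    apply: Ha => //; last exact: addr_ge0.
    rewrite /ball/= distrC; move: vu sdl; rewrite !ltr_norml => /andP[? ?] /andP[? ?].
    by apply/andP; split; lra.
  have h2 : `|g (s0 + v) y - g (s0 + u) y| < e / 2.
    apply: Ha => //; last exact: addr_ge0.
    rewrite /ball/= distrC; move: vu; rewrite !ltr_norml => /andP[? ?].
    by apply/andP; split; lra.
  move: h1 h2; rewrite ler_norml !ltr_norml => /andP[? ?] /andP[? ?].
  by apply/andP; split; lra.
move=> H; have : \forall dl \near (0:R)^'+, 0 < dl /\ `[0, U] `<=` Q dl.
  by near=> dl; split; near: dl => //; exact: nbhs_right_gt.
move=> /filter_ex[dl [dl0 Hdl]]; exists dl => // s u y s0' sdl u0U Ky.
by apply: Hdl => //=; case/andP: u0U.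
Unshelve. all: by end_near. Qed.

(** [dl] is common to all [x] near [x0], so that joint continuity only needs continuity in space at
    the single date [s0]. *)
Lemma value_time_continuous s0 (x0 : E) e : 0 <= s0 -> 0 < e ->
  exists2 dl, 0 < dl & \forall x \near x0, forall s, 0 <= s -> `|s - s0| < dl ->
    `|w_ s x - w_ s0 x| <= e.
Proof.
move=> s00 e0.
(* [q] is the factor in [path_payoff_time]; [e1] and [e2] are chosen so that the good and the bad
   paths contribute at most [e / 2] each. *)
pose q := (alpha / 2)^-1 + 1.
have q0 : 0 < q by rewrite addr_gt0// invr_gt0 divr_gt0.
pose e1 := e / (4 * q); have e10 : 0 < e1 by rewrite divr_gt0// mulr_gt0.
have a20 : 0 < alpha / 2 by rewrite divr_gt0.
have e120 : 0 < e1 / 2 by rewrite divr_gt0.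
have [U U0 /(_ U (lexx U)) HU'] := exp_small fM a20 e120.
have HU : 2 * M * expR (- (alpha / 2) * U) <= e1 by rewrite -mulrA mulrC -ler_pdivlMr.
have C10 : 0 < C + 1 by rewrite ltr_wpDl.
pose e2 := e / (4 * (C + 1)); have e20 : 0 < e2 by rewrite divr_gt0// mulr_gt0.
have [r Hr] := path_stays_bounded std X_weakly_Feller E_balls x0 U0 e20.
have [d1 d10 H1] := uniform_time_continuity U f_time (@E_balls x0 r) s00 e10.
have [d2 d20 H2] := uniform_time_continuity U F_time (@E_balls x0 r) s00 e10.
exists (Num.min d1 d2); first by rewrite lt_min d10.
apply: filterS Hr => x Hx s s0'; rewrite lt_min => /andP[sd1 sd2].
pose B := [set w | (hitting_time [set y | r < mdist x0 y]%R (traj w) <= U%:E)%E].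
have mB : measurable B by apply: measurable_hit; exact: open_gt_mdist.
apply: (value_time_near std O_open alpha_gt0 mf mF fM FM) => // tau st.
have [tau0 _] := st; rewrite !(J_path_mean std O_open alpha_gt0 mf mF fM FM)//.
have b1 := bounded_measurable_path_payoff std O alpha_gt0 mf mF fM FM s st.
have b2 := bounded_measurable_path_payoff std O alpha_gt0 mf mF fM FM s0 st.
have PC s1 w : `|Psi s1 (tau w) (traj w)| <= C.
  by apply: (path_payoff_bound O alpha_gt0 (measurable_time_extension mf) fM FM).
rewrite -meanB//.
apply: (le_trans (@mean_le_off_bad _ B ((e1 + 2 * M * expR (- (alpha / 2) * U)) * q) (2 * C) x _ mB _ _ _ _)).
- exact: bounded_measurableB.
- by rewrite mulr_ge0 ?(ltW q0)// addr_ge0 ?(ltW e10)// mulr_ge0 ?expR_ge0// mulr_ge0.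
- by rewrite mulr_ge0.
- move=> w /negP; rewrite /B/= -ltNge => hw.
  have inK u : 0 <= u <= U -> mdist x0 (path_at u (traj w)) <= r.
    by move=> /andP[u0 uU]; apply: (hitting_time_gt_mdist u0 _ hw); rewrite lee_fin.
  apply: (path_payoff_time O alpha_gt0 (measurable_time_extension mf) fM FM U0 (ltW e10)) => //.
  + move=> u uU; have /andP[u0 _] := uU; rewrite !time_extensionE ?addr_ge0//.
    by apply: H1 => //; exact: inK.
  + move=> u uU; have /andP[u0 _] := uU; rewrite !time_extensionE ?addr_ge0//.
    by apply: H2 => //; exact: inK.
- by move=> w; rewrite (le_trans (ler_normB _ _))// mulr2n mulrDl mul1r lerD.
have quarter (z : R) : 0 < z -> 2 * (z * (e / (4 * z))) = e / 2.
  by move=> z0; field; rewrite gt_eqF.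
have h1 : (e1 + 2 * M * expR (- (alpha / 2) * U)) * q <= e / 2.
  apply: (@le_trans _ _ ((e1 + e1) * q)); first by rewrite ler_pM2r// lerD2l.
  have -> : (e1 + e1) * q = 2 * (q * e1) by rewrite mulr_natl mulr2n mulrDl [e1 * q]mulrC.
  by rewrite quarter.
have h2 : 2 * C * fine (P x B) <= e / 2.
  rewrite -mulrA; apply: (@le_trans _ _ (2 * ((C + 1) * e2))).
    by rewrite ler_pM2l// ler_pM// ?fine_ge0// lerDl.
  by rewrite quarter.
lra.
Qed.

Theorem value_continuous : jointly_continuous_on O w_.
Proof.
apply/subspace_continuousP => -[s0 x0] [/= s00 Ox0].
apply/cvgrPdist_le => e e0; have e20 : 0 < e / 2 by lra.
have hx := value_space_continuous s00 Ox0 e20.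
have [dl dl0 ht] := value_time_continuous x0 s00 e20.
rewrite near_withinE /=.
exists ([set s | `|s - s0| < dl], [set x | `|w_ s0 x - w_ s0 x0| <= e / 2 /\
   forall s, 0 <= s -> `|s - s0| < dl -> `|w_ s x - w_ s0 x| <= e / 2]).
  split => /=; last exact: filterI.
  by apply/nbhs_ballP; exists dl => // s /=; rewrite /ball/= distrC.
move=> [s x] [/= sdl [h1 h2]] [s0' _].
have h3 := h2 s s0' sdl; change (`|w_ s0 x0 - w_ s x| <= e); rewrite distrC.
rewrite (_ : _ - _ = (w_ s x - w_ s0 x) + (w_ s0 x - w_ s0 x0)); last by ring.
by rewrite (le_trans (ler_normD _ _))//; lra.
Qed.

End continuity_of_the_value.

(** As [O] is open, points close to [x] lie in [O] automatically, so the relative topology leaves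
    only the sign condition on time. *)
Lemma joint_continuity_modulus {R : realType} {E : pmetricType R} (O : set E)
    (F : R -> E -> R) : open O -> jointly_continuous_on O F ->
  forall s x, 0 <= s -> O x -> forall e : R, 0 < e ->
  exists2 dl : R, 0 < dl & forall s' y, 0 <= s' -> `|s' - s| < dl ->
    mdist x y < dl -> `|time_extension F s' y - time_extension F s x| <= e.
Proof.
move=> oO /subspace_continuousP cF s x s0 Ox e e0.
have /cvgrPdist_le/(_ _ e0) := cF (s, x) (conj s0 Ox).
rewrite near_withinE => -[[U W] /= [/nbhs_ballP[a /= a0 Ha] nW] HUW].
have /metricType_numDomainType.nbhs_mdistP[b /= b0 Hb] : nbhs x (W `&` O).
  by apply: filterI => //; move: oO; rewrite openE; exact.
exists (Num.min a b); first by rewrite lt_min a0.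
move=> s' y s'0; rewrite !lt_min => /andP[sa _] /andP[_ yb].
have [Wy Oy] := Hb y yb.
have Us : U s' by apply: Ha; rewrite /ball/= distrC.
have := HUW (s', y) (conj Us Wy) (conj s'0 Oy).
by rewrite !time_extensionE// distrC.
Qed.

Theorem proposition1 (R : realType) (E : pmetricType R)
  (E_loc_compact : locally_compact [set: E])
  (E_separable : separable E)
  (E_balls : forall (x : E) (r : R), compact [set y | mdist x y <= r])
  (d : measure_display) (Omega : measurableType d)
  (Filt : R -> set (set Omega)) (X : R -> Omega -> E)
  (P : E -> probability Omega R)
  (X_standard : standard_Markov_process Filt X P)
  (X_weakly_Feller : weakly_Feller X P)
  (O : set E) (O_open : open O)
  (alpha : R) (alpha_gt0 : 0 < alpha)
  (f F : R -> E -> R)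
  (f_measurable : measurable_functional f)
  (F_measurable : measurable_functional F)
  (f_bounded : bounded_functional f)
  (F_bounded : bounded_functional F)
  (f_time_continuous : time_continuous f)
  (F_time_continuous : time_continuous F)
  (F_continuous : jointly_continuous_on O F)
  (A2 : no_immediate_exit X P O)
  (A3 : strongly_Feller X P) :
  jointly_continuous_on O (value Filt X P O alpha f F).
Proof.
have [Mf _ HMf] := time_extension_bound f_bounded.
have [MF _ HMF] := time_extension_bound F_bounded.
have fM s x : `|time_extension f s x| <= Num.max Mf MF by rewrite le_max HMf.
have FM s x : `|time_extension F s x| <= Num.max Mf MF by rewrite le_max HMF orbT.
exact: (value_continuous X_standard X_weakly_Feller E_balls O_open alpha_gt0
  f_measurable F_measurable fM FM (joint_continuity_modulus O_open F_continuous)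
  A3 f_time_continuous F_time_continuous).
Qed.
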